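(* Let $\phi,\psi$ satisfy the wavelet condition (with constants $0<a'<a$) described in the context. Let $\tilde c_0,s,L>0$ and assume the error law $\varphi$ satisfies $|F[\varphi](t)|\ge C(1+|t|^2)^{-w/2}$ for every $t\in\mathbb{R}$ and some $C>0$, $w\ge0$. Let $f_n(\cdot,j_n)$ be the wavelet deconvolution estimator with $j_n$ satisfying $$2^{j_n}=\left(\frac{1}{2(a')^s\tilde c_0}\log n\right)^{1/s}.$$ Then there exists a constant $C'$, depending only on $\phi,\psi,\tilde c_0,s,L,C,w$, such that for every $n\ge3$, $$\sup_{f\in\mathcal{A}_{\tilde c_0,s}(L)}E\sup_{x\in\mathbb{R}}|f_n(x,j_n)-f(x)|\le C'\left(\frac{\log\log n}{n}\right)^{1/2}(\log n)^{(w+1/2)/s}.$$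
   Context: Fourier transform: $F[h](t)=\int h(x)e^{-itx}\,dx$ (extended to $L^2(\mathbb{R})$), $F^{-1}$ its inverse, and $F[\varphi](t)=\int e^{-itx}\,d\varphi(x)$. Supersmooth class: $\mathcal{A}_{\tilde c_0,s}(L)=\{f:\mathbb{R}\to[0,\infty),\ \int_{\mathbb{R}}f=1,\ \int_{\mathbb{R}}|F[f](t)|^2\exp(2\tilde c_0|t|^s)\,dt\le2\pi L\}$; its elements are identified with their continuous versions. Model: $Y=X+\epsilon$, with $X$ having density $f$ and $\epsilon$ independent of $X$ with law $\varphi$ (a probability measure on $\mathbb{R}$); $Y_1,\dots,Y_n$ are i.i.d. copies of $Y$. Wavelet condition: $\phi$ and $\psi$ are the (real-valued) scaling function and associated wavelet of an orthonormal multiresolution analysis of $L^2(\mathbb{R})$; $\phi,\psi\in L^p(\mathbb{R})$ for every $1\le p\le\infty$; for some $0<a'<a$, $\operatorname{supp}(F[\phi])\subset[-a,a]$ and $\operatorname{supp}(F[\psi])\subset[-a,a]\setminus[-a',a']$; and $\sup_{x}\sum_{k\in\mathbb{Z}}|\phi(x-k)|<\infty$, $\sup_{x}\sum_{k\in\mathbb{Z}}|\psi(x-k)|<\infty$. Estimator: with $\phi_{0k}(x)=\phi(x-k)$ and $j$ real, $$\tilde\phi_{jk}=F^{-1}\left[\frac{F[\phi_{0k}](2^{-j}\cdot)}{2^j\,\overline{F[\varphi]}}\right],\quad K_j^*(x,y)=2^j\sum_{k\in\mathbb{Z}}\phi(2^jx-k)\tilde\phi_{jk}(y),\quad f_n(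x,j)=\frac1n\sum_{m=1}^nK_j^*(x,Y_m).$$
   Formalization: The scaling function φ is taken to be its continuous version (changing φ at one point makes the sup-norm bound fail), and C' may also depend on the wavelet constants a', a (no C' works for all admissible a', since 2^{j_n} tends to infinity as a' tends to 0). *)

(* Defs.v *)
From HB Require Import structures.
From mathcomp Require Export all_boot all_order all_algebra.
From mathcomp Require Export all_classical all_reals all_analysis.
From mathcomp Require Export complex.

Set Implicit Arguments.
Unset Strict Implicit.
Unset Printing Implicit Defensive.

Export Order.TTheory GRing.Theory Num.Theory.
Export numFieldNormedType.Exports.
Export ComplexField.Normc.

#[global] Open Scope classical_set_scope.
#[global] Open Scope complex_scope.
#[global] Open Scope ring_scope.

Definition cintegral {d} {T : measurableType d} {R : realType}
    (mu : {measure set T -> \bar R}) (g : T -> R[i]) : R[i] :=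
  (\int[mu]_x complex.Re (g x)) +i* (\int[mu]_x complex.Im (g x)).

(* Limit of the symmetric partial sums over -N <= k < N. It is only applied to
   absolutely convergent families, where the order of summation is irrelevant. *)
Definition zsum {R : realType} (u : int -> R) : R :=
  limn (fun N : nat => \sum_(i < N) (u i%:Z + u (- i.+1%:Z))).

Definition czsum {R : realType} (u : int -> R[i]) : R[i] :=
  zsum (fun k => complex.Re (u k)) +i* zsum (fun k => complex.Im (u k)).

Definition expi {R : realType} (u : R) : R[i] := cos u +i* sin u.

(* The integral formulas below are the L^1 ones: every function they are
   applied to (phi, psi and their translates, densities, and the compactly
   supported bounded quotient defining [dual_phi]) is in L^1 and, when the
   L^2-extension is meant, also in L^2, where both transforms agree. *)
Definition fourier {R : realType} (h : R -> R) (t : R) : R[i] :=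
  cintegral (@lebesgue_measure R) (fun x => (h x)%:C * expi (- (t * x))).

Definition inv_fourier {R : realType} (g : R -> R[i]) (x : R) : R[i] :=
  ((2 * pi)^-1)%:C *
  cintegral (@lebesgue_measure R) (fun t => g t * expi (t * x)).

Definition fourier_law {R : realType}
    (mu : probability (measurableTypeR R) R) (t : R) : R[i] :=
  cintegral mu (fun x => expi (- (t * x))).

(* Elements of L^2(R) are represented by functions, not quotiented by almost
   everywhere equality; [closed_subspace] forces saturation under it. *)
Definition L2 {R : realType} : set (R -> R) :=
  [set f : R -> R | f \in Lfun (@lebesgue_measure R) 2%:E].

Definition L2_inner {R : realType} (f g : R -> R) : R :=
  (\int[@lebesgue_measure R]_x (f x * g x))%R.

Definition L2_norm {R : realType} (f : R -> R) : \bar R :=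
  'N[@lebesgue_measure R]_2%:E[EFin \o f].

Definition closed_subspace {R : realType} (V : set (R -> R)) : Prop :=
  [/\ V `<=` L2,
      V (fun=> 0),
      (forall (c : R) (f g : R -> R), V f -> V g -> V (fun x => c * f x + g x)) &
      (forall f : R -> R, L2 f ->
        (forall e : R, 0 < e ->
          exists2 g, V g & (L2_norm (fun x => (f x - g x)%R) < e%:E)%E) ->
        V f)].

Definition orthonormal_basis {R : realType}
    (V : set (R -> R)) (e : int -> R -> R) : Prop :=
  [/\ (forall k, V (e k)),
      (forall k l, L2_inner (e k) (e l) = (k == l)%:R) &
      (forall f, V f -> forall eps : R, 0 < eps ->
        exists (s : seq int) (c : int -> R),
          (L2_norm (fun x => (f x - \sum_(k <- s) c k * e k x)%R) < eps%:E)%E)].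

Definition translate {R : realType} (h : R -> R) (k : int) : R -> R :=
  fun x => h (x - k%:~R).

Definition is_mra {R : realType} (V : int -> set (R -> R)) (phi : R -> R) : Prop :=
  [/\ (forall j, closed_subspace (V j)),
      (forall j, V j `<=` V (j + 1)) /\
        (forall j (f : R -> R), V j f <-> V (j + 1) (fun x => f (2 * x))),
      (forall f, (forall j, V j f) -> {ae @lebesgue_measure R, forall x, f x = 0}),
      (forall f, L2 f -> forall e : R, 0 < e ->
        exists j, exists2 g, V j g & (L2_norm (fun x => (f x - g x)%R) < e%:E)%E) &
      orthonormal_basis (V 0) (translate phi)].

Definition wavelet_space {R : realType} (V : int -> set (R -> R)) : set (R -> R) :=
  [set f : R -> R | V 1 f /\ forall g, V 0 g -> L2_inner f g = 0].

Definition scaling_wavelet_pair {R : realType} (phi psi : R -> R) : Prop :=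
  exists2 V : int -> set (R -> R),
    is_mra V phi & orthonormal_basis (wavelet_space V) (translate psi).

Definition fourier_support {R : realType} (h : R -> R) : set R :=
  closure [set t | fourier h t != 0].

Definition bounded_translate_sum {R : realType} (h : R -> R) : Prop :=
  (ereal_sup [set \esum_(k in [set: int]) `|translate h k x|%:E | x in [set: R]]
     < +oo)%E.

(* phi is band-limited and is therefore identified with its continuous version:
   the estimator evaluates phi pointwise, so that changing phi on a null set
   would change the supremum over x of its error. *)
Definition wavelet_condition {R : realType} (phi psi : R -> R) (a' a : R) : Prop :=
  [/\ scaling_wavelet_pair phi psi,
      continuous phi,
      (forall p : \bar R, (1 <= p)%E ->
        phi \in Lfun (@lebesgue_measure R) p /\ psi \in Lfun (@lebesgue_measure R) p),
      [/\ 0 < a' < a,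
          fourier_support phi `<=` `[- a, a] &
          fourier_support psi `<=` `[- a, a] `\` `[- a', a']] &
      bounded_translate_sum phi /\ bounded_translate_sum psi].

(* Members are identified with their continuous versions. *)
Definition supersmooth {R : realType} (c0 s L : R) : set (R -> R) :=
  [set f : R -> R | [/\ continuous f,
               forall x, 0 <= f x,
               (\int[@lebesgue_measure R]_x (f x)%:E = 1)%E &
               (\int[@lebesgue_measure R]_t
                  ((normc (fourier f t)) ^+ 2 * expR (2 * c0 * `|t| `^ s))%:E
                <= (2 * pi * L)%:E)%E]].

Definition dual_phi {R : realType} (phi : R -> R)
    (mu : probability (measurableTypeR R) R) (j : R) (k : int) : R -> R[i] :=
  inv_fourier (fun t =>
    fourier (translate phi k) (2 `^ (- j) * t) /
      ((2 `^ j)%:C * conjc (fourier_law mu t))).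

Definition deconv_kernel {R : realType} (phi : R -> R)
    (mu : probability (measurableTypeR R) R) (j x y : R) : R[i] :=
  (2 `^ j)%:C *
  czsum (fun k => (phi (2 `^ j * x - k%:~R))%:C * dual_phi phi mu j k y).

Definition deconv_estimator {R : realType} (phi : R -> R)
    (mu : probability (measurableTypeR R) R) (n : nat) (y : 'I_n -> R) (x j : R)
    : R[i] :=
  (n%:R)^-1 * \sum_(m < n) deconv_kernel phi mu j x (y m).

Definition has_density {d} {T : measurableType d} {R : realType}
    (P : probability T R) (X : {RV P >-> measurableTypeR R}) (f : R -> R) : Prop :=
  forall A : set (measurableTypeR R), measurable A ->
    P (X @^-1` A) = (\int[@lebesgue_measure R]_(x in A) (f x)%:E)%E.

Definition has_law {d} {T : measurableType d} {R : realType}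
    (P : probability T R) (X : {RV P >-> measurableTypeR R})
    (mu : probability (measurableTypeR R) R) : Prop :=
  forall A : set (measurableTypeR R), measurable A -> P (X @^-1` A) = mu A.

Definition independent_pair {d} {T : measurableType d} {R : realType}
    (P : probability T R) (X Z : {RV P >-> measurableTypeR R}) : Prop :=
  forall A B : set (measurableTypeR R), measurable A -> measurable B ->
    P (X @^-1` A `&` Z @^-1` B) = (P (X @^-1` A) * P (Z @^-1` B))%E.

(* Taking some of the A m to be the whole line gives the product rule for every
   subfamily. *)
Definition mutually_independent {d} {T : measurableType d} {R : realType} {n : nat}
    (P : probability T R) (Y : 'I_n -> {RV P >-> measurableTypeR R}) : Prop :=
  forall A : 'I_n -> set (measurableTypeR R), (forall m, measurable (A m)) ->
    P (\bigcap_(m in [set: 'I_n]) (Y m @^-1` A m)) =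
    (\prod_(m < n) P (Y m @^-1` A m))%E.

Definition iid_copies {d d0} {T : measurableType d} {T0 : measurableType d0}
    {R : realType} {n : nat}
    (P : probability T R) (Y : 'I_n -> {RV P >-> measurableTypeR R})
    (P0 : probability T0 R) (Y0 : T0 -> R) : Prop :=
  mutually_independent Y /\
  forall m (A : set (measurableTypeR R)), measurable A ->
    P (Y m @^-1` A) = P0 (Y0 @^-1` A).

(* Main.v *)
From HB Require Import structures.
Require Import Defs.
From mathcomp Require Import measurable_realfun.
From mathcomp Require Import ring lra zify.

Set Implicit Arguments.
Unset Strict Implicit.
Unset Printing Implicit Defensive.

(** Write [N] for [2 ^ j], [F h] for the Fourier transform of [h] and [D] for
    [ln n]. The error of the estimator at [x] is the sum of a bias and of a
    stochastic term, each bounded uniformly in [x].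

    Bias. Let [h k] be the dual functions. The mean of [h k] under the law of
    the observations involves the transform of that law, which is a product by
    independence ([characteristic_function_sum]); the factor of the noise
    cancels the one in the definition of [h k]. The expected estimator is
    therefore an integral of the conjugate of [F f (t)] against
    [sum_k phi (N x - k) F phi_k (t / N)]. The main point of the
    multiresolution analysis is that this sum is the exponential
    [expi (- (t x))] as soon as [|t| < N a'] ([wavelet_reproduces_expi]).
    Indeed [phi (b y + x0) expi (tau y)] is, for [|tau| < a'] and [b] small, an
    integrable function whose spectrum is contained in [-a', a'], hence
    orthogonal to all the wavelets of nonnegative scale
    ([modulated_orthogonal]); such a function belongs to the space spanned by
    the translates of [phi] and is the sum of its expansion at every point
    ([mra_reproduce]); it remains to let [b] tend to 0. By Fourier inversion
    ([fourier_inversion]) the bias is then at most a constant times the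
    integral of [|F f|] over [|t| >= N a'] ([bias_le]). The resolution is such
    that the exponential weight of the smoothness class equals [n] at the
    cutoff [N a'], so that the inequality of arithmetic and geometric means
    bounds this tail by a multiple of [sqrt (D ^ (1 / s) / n)]
    ([exp_weight_tail]).

    Stochastic term. The weights [N phi (N x - k)] have an absolute sum bounded
    by [N Phi], whatever [x], so that only the largest of the centred empirical
    means of the [h k] matters ([estimator_error_le]): no entropy or chaining
    argument is involved, but the maximum runs over all integers [k]. It is
    controlled by the sum over [k] of [cosh (la G_k) - 1]
    ([maximal_inequality]), whose expectation is finite because
    [sum_k |h k (y)| ^ 2] is bounded uniformly in [y]: up to a constant the
    values [h k (y)] are the Fourier coefficients of one function, to which
    Bessel's inequality applies ([dual_bessel]). The means of the
    [|h k| ^ 2] are of order [M ^ 2 / N] with [M = D ^ (w / s)], one factor [N]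
    better than the uniform bound, since [F f] is integrable
    ([dual_second_moment]). With [la] of order [sqrt (n ln D D ^ (1 / s)) / M],
    the logarithm of the bound for the sum is of order [ln D]
    ([maximal_rate]), which yields [sqrt (ln D / n) D ^ ((w + 1 / 2) / s)].

    The error at each [x] is thus dominated by one measurable random variable
    with the announced mean, and so is its supremum ([estimator_risk_le]). *)

(** * Integrals of real functions *)

Notation rint mu f := (mu.-integrable [set: _] (EFin \o f)).

Section real_integrals.
Context d (T : measurableType d) (R : realType) (mu : {measure set T -> \bar R}).
Implicit Types f g b : T -> R.

Lemma rint_meas f : rint mu f -> measurable_fun setT f.
Proof. by move=> /integrableP[/measurable_EFinP]. Qed.

Lemma rint_le f b : measurable_fun setT f -> rint mu b ->
  (forall x, `|f x| <= b x) -> rint mu f.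
Proof.
move=> mf ib fb; apply: (le_integrable measurableT _ _ ib).
  exact/measurable_EFinP.
by move=> x _ /=; rewrite lee_fin (le_trans (fb x))// ler_norm.
Qed.

Lemma rint_eq f g : f =1 g -> rint mu f -> rint mu g.
Proof. by move=> fg; apply: eq_integrable => // x _ /=; rewrite fg. Qed.

Lemma rintD f g : rint mu f -> rint mu g -> rint mu (fun x => f x + g x).
Proof. by move=> fi gi; apply: (integrableD measurableT fi gi). Qed.

Lemma rintZ c f : rint mu f -> rint mu (fun x => c * f x).
Proof. by move=> fi; exact: (integrableZl measurableT c fi). Qed.

Lemma rintN f : rint mu f -> rint mu (fun x => - f x).
Proof.
by move=> /(rintZ (-1)); apply: rint_eq => x; rewrite mulN1r.
Qed.

Lemma rintB f g : rint mu f -> rint mu g -> rint mu (fun x => f x - g x).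
Proof. by move=> fi gi; apply: (integrableB measurableT fi gi). Qed.

Lemma rint_norm f : rint mu f -> rint mu (fun x => `|f x|).
Proof. exact: integrable_norm. Qed.

Lemma rint0 : rint mu (fun=> 0).
Proof. exact: (integrable0 mu setT). Qed.

Lemma rint_sum (I : Type) (s : seq I) (h : I -> T -> R) :
  (forall i, rint mu (h i)) -> rint mu (fun x => \sum_(i <- s) h i x).
Proof.
move=> hi; elim: s => [|i s IH].
  by apply: rint_eq rint0 => x; rewrite big_nil.
by apply: rint_eq (rintD (hi i) IH) => x; rewrite big_cons.
Qed.

Lemma Rint_sum (I : Type) (s : seq I) (h : I -> T -> R) :
  (forall i, rint mu (h i)) ->
  (\int[mu]_x \sum_(i <- s) h i x)%R = \sum_(i <- s) (\int[mu]_x h i x)%R.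
Proof.
move=> hi; elim: s => [|i s IH].
  by under eq_Rintegral do rewrite big_nil; rewrite Rintegral_cst// mul0r big_nil.
under eq_Rintegral do rewrite big_cons.
rewrite RintegralD//; first by rewrite IH big_cons.
exact: rint_sum.
Qed.

Lemma Rint_eq f g : f =1 g -> (\int[mu]_x f x)%R = (\int[mu]_x g x)%R.
Proof. by move=> fg; apply: eq_Rintegral => x _. Qed.

Lemma RintN f : rint mu f -> (\int[mu]_x (- f x))%R = - (\int[mu]_x f x)%R.
Proof.
move=> fi; rewrite -mulN1r -RintegralZl//.
by apply: Rint_eq => x; rewrite mulN1r.
Qed.

Lemma Rint_le f g : rint mu f -> rint mu g -> (forall x, f x <= g x) ->
  (\int[mu]_x f x)%R <= (\int[mu]_x g x)%R.
Proof. by move=> fi gi fg; apply: le_Rintegral. Qed.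

Lemma Rint_norm_le f b : measurable_fun setT f -> rint mu b ->
  (forall x, `|f x| <= b x) -> `|(\int[mu]_x f x)%R| <= (\int[mu]_x b x)%R.
Proof.
move=> mf ib fb; have fi := rint_le mf ib fb.
apply: le_trans (le_normr_Rintegral measurableT fi) _.
by apply: Rint_le => //; exact: rint_norm.
Qed.

Lemma rint_fin f : rint mu f -> (\int[mu]_x (f x)%:E)%E = ((\int[mu]_x f x)%R)%:E.
Proof.
move=> fi; rewrite /Rintegral fineK//.
exact: (integrable_fin_num measurableT fi).
Qed.

Lemma ge0_rint f (M : R) : measurable_fun setT f -> (forall x, 0 <= f x) ->
  (\int[mu]_x (f x)%:E <= M%:E)%E ->
  rint mu f /\ (\int[mu]_x f x)%R <= M.
Proof.
move=> mf f0 fM.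
have fi : rint mu f.
  apply/integrableP; split; first exact/measurable_EFinP.
  under eq_integral do rewrite /= ger0_norm//.
  by apply: le_lt_trans fM _; rewrite ltry.
by split=> //; rewrite -lee_fin -rint_fin.
Qed.

Lemma Rint_dct (f_ : nat -> T -> R) f b :
  (forall n, measurable_fun setT (f_ n)) ->
  (forall x, (fun n => f_ n x) @ \oo --> f x) -> rint mu b ->
  (forall n x, `|f_ n x| <= b x) ->
  rint mu f /\ (fun n => (\int[mu]_x f_ n x)%R) @ \oo --> (\int[mu]_x f x)%R.
Proof.
move=> mf cf ib fb.
have mlim : measurable_fun setT f.
  apply: (measurable_fun_cvg (h := f_)) => // x _; exact: cf.
have [fi _ ci] : [/\ mu.-integrable setT (EFin \o f),
    [sequence \int[mu]_x `|(f_ n x)%:E - (f x)%:E|]_n%E @ \oo --> 0%E &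
    [sequence \int[mu]_x (f_ n x)%:E]_n%E @ \oo --> (\int[mu]_x (f x)%:E)%E].
  apply: (@dominated_convergence _ _ _ mu setT measurableT _ _ (EFin \o b)) => //.
  - by move=> n; exact/measurable_EFinP.
  - exact/measurable_EFinP.
  - by apply: aeW => x _; apply: cvg_EFin; [exact: nearW|exact: cf].
  - by apply: aeW => x n _; rewrite lee_fin.
split=> //; move: ci; rewrite rint_fin// => /fine_cvg; exact.
Qed.

End real_integrals.

(** A supremum over an uncountable set of functions may fail to be measurable.
    The integral of a nonnegative function being a supremum over simple
    functions, it is monotone without any measurability. *)
Lemma ge0_le_integral_nomeas d (T : measurableType d) (R : realType)
    (mu : {measure set T -> \bar R}) (f g : T -> \bar R) :
  (forall x, 0 <= f x)%E -> (forall x, f x <= g x)%E ->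
  (\int[mu]_x f x <= \int[mu]_x g x)%E.
Proof.
move=> f0 fg; have g0 x : (0 <= g x)%E by exact: le_trans (fg x).
rewrite !ge0_integralTE//.
apply: le_ereal_sup => _ [h hf <-]; exists h => // x.
exact: le_trans (hf x) (fg x).
Qed.

Section fubini.
Context d1 d2 (T1 : measurableType d1) (T2 : measurableType d2) (R : realType).
Variables (m1 : {sigma_finite_measure set T1 -> \bar R})
  (m2 : {sigma_finite_measure set T2 -> \bar R}).
Variables (F : T1 * T2 -> R) (b1 : T1 -> R) (b2 : T2 -> R).
Hypotheses (mF : measurable_fun setT F) (ib1 : rint m1 b1) (ib2 : rint m2 b2)
  (Fb : forall x y, `|F (x, y)| <= b1 x * b2 y).

Let mF1 x : measurable_fun setT (fun y => F (x, y)).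
Proof. exact: measurableT_comp. Qed.

Let mF2 y : measurable_fun setT (fun x => F (x, y)).
Proof. by apply: (measurableT_comp mF); exact: measurable_fun_pair. Qed.

Lemma rint_section1 x : rint m2 (fun y => F (x, y)).
Proof. by apply: (rint_le (mF1 x) (rintZ (b1 x) ib2)). Qed.

Lemma rint_section2 y : rint m1 (fun x => F (x, y)).
Proof.
apply: (rint_le (mF2 y) (rintZ (b2 y) ib1)) => x.
by rewrite mulrC.
Qed.

Let imF : (m1 \x m2)%E.-integrable setT (EFin \o F).
Proof.
apply/integrable12ltyP; first exact/measurable_EFinP.
pose B2 := (\int[m2]_y b2 y)%R.
apply: (@le_lt_trans _ _ (\int[m1]_x (`|b1 x| * (\int[m2]_y `|b2 y|)%R)%:E)%E).
  apply: ge0_le_integral_nomeas => x; first exact: integral_ge0.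
  rewrite (rint_fin (rint_norm (rint_section1 x))) lee_fin.
  rewrite -RintegralZl//; last exact: rint_norm.
  apply: Rint_le => [||y]; first exact: rint_norm (rint_section1 x).
    exact/rintZ/rint_norm.
  by rewrite -normrM (le_trans (Fb x y))// ler_norm.
rewrite rint_fin ?ltry//.
apply: (rint_eq (f := fun x => (\int[m2]_y `|b2 y|)%R * `|b1 x|)).
  by move=> x; rewrite mulrC.
exact/rintZ/rint_norm.
Qed.

Lemma rint_inner1 : rint m1 (fun x => (\int[m2]_y F (x, y))%R).
Proof.
have := integrable_fubini_F imF; apply: eq_integrable => // x _.
by rewrite /fubini_F /= -(rint_fin (rint_section1 x)).
Qed.

Lemma Rint_fubini :
  (\int[m1]_x \int[m2]_y F (x, y))%R = (\int[m2]_y \int[m1]_x F (x, y))%R.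
Proof.
rewrite {1}/Rintegral [RHS]/Rintegral; congr fine.
under eq_integral do rewrite -(rint_fin (rint_section1 _)).
under [RHS]eq_integral do rewrite -(rint_fin (rint_section2 _)).
exact: (Fubini imF).
Qed.

Lemma Rint_prod :
  (\int[(m1 \x m2)%E]_z F z)%R = (\int[m1]_x \int[m2]_y F (x, y))%R.
Proof.
rewrite /Rintegral; congr fine.
under [RHS]eq_integral do rewrite -(rint_fin (rint_section1 _)).
by rewrite -(integral12_prod_meas1 imF).
Qed.

End fubini.

Section affine_substitution.
Context (R : realType).
Local Notation mu := (@lebesgue_measure R).

(** Uniqueness of the Lebesgue measure: its rescaled image assigns the right
    length to every half-open interval. *)
Lemma lebesgue_measure_affine (c e : R) (A : set R) : 0 < c -> measurable A ->
  (c%:E * mu ((fun x : R => c * x + e)%R @^-1` A) = mu A)%E.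
Proof.
move=> c0 mA.
have mphi : @measurable_fun _ _ (measurableTypeR R) (measurableTypeR R) setT
    (fun x : R => c * x + e).
  by apply: measurable_funD => //; exact: measurable_funM.
pose m' : {measure set (measurableTypeR R) -> \bar R} :=
  mscale (NngNum (ltW c0)) (measure_function_pushforward__canonical__measure_function_Measure mu mphi).
suff h X : ocitv X -> mu X = m' X.
  by rewrite (@lebesgue_measure_unique R m' h A mA).
move=> [[a b]] _ <-; rewrite /m'.
change (mu `]a, b]%classic =
  c%:E * mu ((fun x : R => c * x + e)%R @^-1` `]a, b]%classic))%E.
have -> : (fun x => c * x + e) @^-1` `]a, b]%classic = `](a - e) / c, (b - e) / c]%classic.
  apply/seteqP; split => x /=; rewrite !in_itv/= ltr_pdivrMr// ler_pdivlMr// => /andP[h1 h2];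
   apply/andP; split; lra.
rewrite !lebesgue_measure_itv/= !lte_fin ltr_pM2r ?invr_gt0// ltrD2r.
case: ifPn => _; last by rewrite mule0.
rewrite -!EFinD -EFinM; congr (_%:E); field; exact: lt0r_neq0.
Qed.

Lemma ge0_integral_affine (c e : R) (f : R -> \bar R) : 0 < c ->
  measurable_fun setT f -> (forall x, 0 <= f x)%E ->
  (\int[mu]_x f (c * x + e)%R = (c^-1)%:E * \int[mu]_x f x)%E.
Proof.
move=> c0 mf f0.
have mphi : @measurable_fun _ _ (measurableTypeR R) (measurableTypeR R) setT
    (fun x : R => c * x + e).
  by apply: measurable_funD => //; exact: measurable_funM.
have := ge0_integral_pushforward mphi mu measurableT mf (fun x _ => f0 x).
rewrite preimage_setT /= => <-.
pose m' : {measure set (measurableTypeR R) -> \bar R} :=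
  mscale (NngNum (ltW c0)) (measure_function_pushforward__canonical__measure_function_Measure mu mphi).
rewrite [X in (_ * X)%E](eq_measure_integral m'); last first.
  by move=> A mA _; apply/esym; exact: lebesgue_measure_affine.
rewrite ge0_integral_mscale//= muleA -EFinM mulVf ?mul1e//.
exact: lt0r_neq0.
Qed.

Lemma rint_affine (c e : R) (f : R -> R) : 0 < c -> rint mu f ->
  rint mu (fun x => f (c * x + e)) /\
  (\int[mu]_x f (c * x + e))%R = c^-1 * (\int[mu]_x f x)%R.
Proof.
move=> c0 fi.
have maff : measurable_fun setT ((fun x => c * x + e) : R -> R).
  by apply: measurable_funD => //; exact: measurable_funM.
have mf := rint_meas fi.
have mfa : measurable_fun setT (fun x => f (c * x + e)) by exact: measurableT_comp mf maff.
have fai : rint mu (fun x => f (c * x + e)).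
  apply/integrableP; split; first exact/measurable_EFinP.
  rewrite (ge0_integral_affine (f := fun x => `|(f x)%:E|%E) e c0)//.
    by have /integrableP[_ h] := fi; rewrite lte_mul_pinfty// ?lee_fin ?invr_ge0 ?ltW.
  by apply/measurable_EFinP; exact: measurableT_comp.
split=> //; apply: EFin_inj; rewrite -(rint_fin fai).
rewrite EFinM -rint_fin// [in RHS]integralE.
have h (g : R -> \bar R) : measurable_fun setT g -> (forall x, 0 <= g x)%E ->
  (\int[mu]_x g (c * x + e)%R = (c^-1)%:E * \int[mu]_x g x)%E.
  exact: ge0_integral_affine.
transitivity (\int[mu]_x (funepos (EFin \o f)) (c * x + e)%R -
  \int[mu]_x (funeneg (EFin \o f)) (c * x + e)%R)%E.
  rewrite [LHS]integralE; congr (_ - _)%E;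
    by apply: eq_integral => x _; rewrite ?funeposE ?funenegE.
rewrite (h (funepos (EFin \o f)))//; last exact/measurable_funepos/measurable_EFinP.
rewrite (h (funeneg (EFin \o f)))//; last exact/measurable_funeneg/measurable_EFinP.
rewrite -muleBr//.
apply: fin_num_adde_defr; exact: integrable_pos_fin_num.
Qed.

Lemma measurable_affine (c e : R) (f : R -> R) : measurable_fun setT f ->
  measurable_fun setT (fun x => f (c * x + e)).
Proof.
move=> mf; apply: (measurableT_comp mf).
by apply: measurable_funD => //; exact: measurable_funM.
Qed.

End affine_substitution.

(** * Integrals of complex functions *)

Section complex_numbers.
Context (R : realType).
Implicit Types z w : R[i].

Lemma ReD z w : complex.Re (z + w) = complex.Re z + complex.Re w.
Proof. by case: z w => [? ?] [? ?]. Qed.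

Lemma ImD z w : complex.Im (z + w) = complex.Im z + complex.Im w.
Proof. by case: z w => [? ?] [? ?]. Qed.

Lemma ReM z w : complex.Re (z * w) =
  complex.Re z * complex.Re w - complex.Im z * complex.Im w.
Proof. by case: z w => [? ?] [? ?]. Qed.

Lemma ImM z w : complex.Im (z * w) =
  complex.Re z * complex.Im w + complex.Im z * complex.Re w.
Proof. by case: z w => [? ?] [? ?]. Qed.

Lemma ReN z : complex.Re (- z) = - complex.Re z.
Proof. by case: z. Qed.

Lemma ImN z : complex.Im (- z) = - complex.Im z.
Proof. by case: z. Qed.

Lemma ReJ z : complex.Re (conjc z) = complex.Re z.
Proof. by case: z. Qed.

Lemma ImJ z : complex.Im (conjc z) = - complex.Im z.
Proof. by case: z. Qed.

Lemma complex_eqP z w :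
  complex.Re z = complex.Re w -> complex.Im z = complex.Im w -> z = w.
Proof. by case: z w => [? ?] [? ?] /= -> ->. Qed.

Lemma normcE2 z : normc z = Num.sqrt (complex.Re z ^+ 2 + complex.Im z ^+ 2).
Proof. by case: z. Qed.

Lemma sqr_normcE z : normc z ^+ 2 = complex.Re z ^+ 2 + complex.Im z ^+ 2.
Proof. by rewrite normcE2 sqr_sqrtr// addr_ge0// sqr_ge0. Qed.

Lemma normc_ge0 z : 0 <= normc z.
Proof. by rewrite normcE2 sqrtr_ge0. Qed.

Lemma ler_normcD z w : normc (z + w) <= normc z + normc w.
Proof. exact: le_normcD. Qed.

Lemma normcNE z : normc (- z) = normc z.
Proof. exact: normcN. Qed.

Lemma normc_sum (I : Type) (s : seq I) (F : I -> R[i]) :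
  normc (\sum_(i <- s) F i) <= \sum_(i <- s) normc (F i).
Proof.
elim: s => [|i s IH]; first by rewrite !big_nil normc0.
by rewrite !big_cons (le_trans (ler_normcD _ _))// lerD2l.
Qed.

Lemma normc_Re z : `|complex.Re z| <= normc z.
Proof. by rewrite normcE2 -sqrtr_sqr ler_wsqrtr// lerDl sqr_ge0. Qed.

Lemma normc_Im z : `|complex.Im z| <= normc z.
Proof. by rewrite normcE2 -sqrtr_sqr ler_wsqrtr// lerDr sqr_ge0. Qed.

Lemma normc_le_ReIm z : normc z <= `|complex.Re z| + `|complex.Im z|.
Proof.
rewrite -(@ler_pXn2r _ 2)// ?nnegrE ?normc_ge0 ?addr_ge0//.
rewrite sqr_normcE sqrrD !real_normK ?num_real//.
by rewrite lerD2r lerDl mulrn_wge0// mulr_ge0.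
Qed.

Lemma normcR (r : R) : normc r%:C = `|r|.
Proof. by rewrite normcE2/= expr0n addr0 sqrtr_sqr. Qed.

Lemma normc_conj z : normc (conjc z) = normc z.
Proof. by rewrite !normcE2 ReJ ImJ sqrrN. Qed.

Lemma normc_expi (u : R) : normc (expi u) = 1.
Proof. by rewrite normcE2/= cos2Dsin2 sqrtr1. Qed.

Lemma expiD (u v : R) : expi (u + v) = expi u * expi v.
Proof.
apply: complex_eqP; first by rewrite ReM/= cosD.
by rewrite ImM/= sinD addrC mulrC [X in _ + X]mulrC addrC [X in _ + X]mulrC.
Qed.

Lemma expi0 : expi (0 : R) = 1.
Proof. by rewrite /expi cos0 sin0. Qed.

Lemma conj_expi (u : R) : conjc (expi u) = expi (- u).
Proof. by rewrite /expi cosN sinN. Qed.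

Lemma conjcM z w : conjc (z * w) = conjc z * conjc w.
Proof. by apply: complex_eqP; rewrite ?(ReJ, ImJ, ReM, ImM); ring. Qed.

Lemma conjcR (r : R) : conjc r%:C = r%:C.
Proof. by apply: complex_eqP; rewrite ?(ReJ, ImJ)/= ?oppr0. Qed.

Lemma conj_conjc z : conjc (conjc z) = z.
Proof. by apply: complex_eqP; rewrite ?(ReJ, ImJ) ?opprK. Qed.

Lemma mulc_conj z : z * conjc z = (normc z ^+ 2)%:C.
Proof.
apply: complex_eqP; rewrite ?ReM ?ImM ReJ ImJ /= ?sqr_normcE; ring.
Qed.

Lemma invc_conj z : z^-1 = conjc z * ((normc z ^+ 2)^-1)%:C.
Proof.
have [->|z0] := eqVneq z 0.
  by rewrite invr0 normc0 expr0n invr0 mulr0.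
have nz0 : normc z ^+ 2 != 0.
  by rewrite sqrf_eq0; apply: contra z0 => /eqP/eq0_normc ->.
apply: (mulfI z0); rewrite divff// mulrA mulc_conj -rmorphM/= divff//.
Qed.

End complex_numbers.

Definition cmeas d (T : measurableType d) (R : realType) (g : T -> R[i]) :=
  measurable_fun setT (fun x => complex.Re (g x)) /\
  measurable_fun setT (fun x => complex.Im (g x)).

Section complex_measurable.
Context d (T : measurableType d) (R : realType).
Implicit Types g h : T -> R[i].

Lemma cmeasD g h : cmeas g -> cmeas h -> cmeas (fun x => g x + h x).
Proof.
move=> [g1 g2] [h1 h2]; split.
  by under eq_fun do rewrite ReD; exact: measurable_funD.
by under eq_fun do rewrite ImD; exact: measurable_funD.
Qed.

Lemma cmeasM g h : cmeas g -> cmeas h -> cmeas (fun x => g x * h x).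
Proof.
move=> [g1 g2] [h1 h2]; split.
  by under eq_fun do rewrite ReM; apply: measurable_funB; exact: measurable_funM.
by under eq_fun do rewrite ImM; apply: measurable_funD; exact: measurable_funM.
Qed.

Lemma cmeas_conj g : cmeas g -> cmeas (fun x => conjc (g x)).
Proof.
move=> [g1 g2]; split; first by under eq_fun do rewrite ReJ.
by under eq_fun do rewrite ImJ; exact: measurable_funN.
Qed.

Lemma cmeas_cst (z : R[i]) : cmeas (fun _ : T => z).
Proof. by split; exact: measurable_cst. Qed.

Lemma cmeas_real (f : T -> R) : measurable_fun setT f -> cmeas (fun x => (f x)%:C).
Proof. by split=> //; exact: measurable_cst. Qed.

Lemma cmeas_expi (f : T -> R) : measurable_fun setT f -> cmeas (fun x => expi (f x)).
Proof.
move=> mf; split=> /=; apply: measurableT_comp => //; apply: continuous_measurable_fun.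
  exact: continuous_cos.
exact: continuous_sin.
Qed.

Lemma cmeas_normc g : cmeas g -> measurable_fun setT (fun x => normc (g x)).
Proof.
move=> [g1 g2]; under eq_fun do rewrite normcE2.
apply: (measurableT_comp (f := @Num.sqrt R)).
  by apply: continuous_measurable_fun; exact: sqrt_continuous.
by apply: measurable_funD; exact: measurable_funX.
Qed.

Lemma cmeasV g : cmeas g -> cmeas (fun x => (g x)^-1).
Proof.
move=> mg.
have -> : (fun x => (g x)^-1) =
    (fun x => conjc (g x) * ((normc (g x) ^+ 2) `^ (-1))%:C).
  by apply/funext => x; rewrite invc_conj powR_inv1// sqr_ge0.
apply: cmeasM; first exact: cmeas_conj.
apply: cmeas_real; apply: (measurableT_comp (measurable_powR _)).
by apply: measurable_funX; exact: cmeas_normc.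
Qed.

Lemma cmeas_sum (I : Type) (s : seq I) (F : I -> T -> R[i]) :
  (forall i, cmeas (F i)) -> cmeas (fun x => \sum_(i <- s) F i x).
Proof.
move=> mF; elim: s => [|i s IH].
  by under eq_fun do rewrite big_nil; exact: cmeas_cst.
by under eq_fun do rewrite big_cons; exact: cmeasD.
Qed.

Lemma cmeas_comp d' (T' : measurableType d') (g : T -> R[i]) (f : T' -> T) :
  measurable_fun setT f -> cmeas g -> cmeas (fun x => g (f x)).
Proof. by move=> mf [g1 g2]; split; [exact: (measurableT_comp g1 mf)|exact: (measurableT_comp g2 mf)]. Qed.

End complex_measurable.

Definition cintble d (T : measurableType d) (R : realType)
  (mu : {measure set T -> \bar R}) (g : T -> R[i]) :=
  rint mu (fun x => complex.Re (g x)) /\ rint mu (fun x => complex.Im (g x)).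

Section complex_integral.
Context d (T : measurableType d) (R : realType) (mu : {measure set T -> \bar R}).
Implicit Types g h : T -> R[i].

Lemma cintble_meas g : cintble mu g -> cmeas g.
Proof. by move=> [/rint_meas ? /rint_meas ?]. Qed.

Lemma cintble_le g b : cmeas g -> rint mu b -> (forall x, normc (g x) <= b x) ->
  cintble mu g.
Proof.
move=> [g1 g2] ib gb; split; apply: rint_le ib _ => // x; apply: le_trans (gb x).
  exact: normc_Re.
exact: normc_Im.
Qed.

Lemma cintble_real (f : T -> R) : rint mu f -> cintble mu (fun x => (f x)%:C).
Proof. by move=> fi; split=> //; exact: rint0. Qed.

Lemma cintegral_real (f : T -> R) :
  cintegral mu (fun x => (f x)%:C) = ((\int[mu]_x f x)%R)%:C.
Proof.
apply: complex_eqP => //=.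
by rewrite (Rintegral_cst _ measurableT) mul0r.
Qed.

Lemma eq_cintegral g h : g =1 h -> cintegral mu g = cintegral mu h.
Proof. by move=> /funext ->. Qed.

Lemma cintegralD g h : cintble mu g -> cintble mu h ->
  cintble mu (fun x => g x + h x) /\
  cintegral mu (fun x => g x + h x) = cintegral mu g + cintegral mu h.
Proof.
move=> [g1 g2] [h1 h2]; rewrite /cintble.
under eq_fun do rewrite ReD.
under [X in _ /\ rint _ X]eq_fun do rewrite ImD.
split; first by split; exact: rintD.
apply: complex_eqP => /=; under Rint_eq do rewrite ?ReD ?ImD; exact: RintegralD.
Qed.

Lemma cintegralZ (z : R[i]) g : cintble mu g ->
  cintble mu (fun x => z * g x) /\
  cintegral mu (fun x => z * g x) = z * cintegral mu g.
Proof.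
move=> [g1 g2]; rewrite /cintble.
under eq_fun do rewrite ReM.
under [X in _ /\ rint _ X]eq_fun do rewrite ImM.
split; first by split; [apply: rintB|apply: rintD]; exact: rintZ.
apply: complex_eqP; rewrite ?ReM ?ImM /=.
  under Rint_eq do rewrite ReM.
  by rewrite RintegralB ?RintegralZl//; exact: rintZ.
under Rint_eq do rewrite ImM.
by rewrite RintegralD ?RintegralZl//; exact: rintZ.
Qed.

Lemma cintegralB g h : cintble mu g -> cintble mu h ->
  cintble mu (fun x => g x - h x) /\
  cintegral mu (fun x => g x - h x) = cintegral mu g - cintegral mu h.
Proof.
move=> gi hi; have [h1 h2] := cintegralZ (-1) hi.
have [k1 k2] := cintegralD gi h1.
under eq_fun do rewrite -mulN1r.
by rewrite k2 h2 mulN1r.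
Qed.

Lemma cintegral0 : cintble mu (fun=> 0) /\ cintegral mu (fun=> 0) = 0.
Proof.
split; first exact: (cintble_real (rint0 mu)).
have := cintegral_real (fun=> 0); rewrite Rintegral_cst// mul0r.
exact.
Qed.

Lemma cintegral_sum (I : Type) (s : seq I) (F : I -> T -> R[i]) :
  (forall i, cintble mu (F i)) ->
  cintble mu (fun x => \sum_(i <- s) F i x) /\
  cintegral mu (fun x => \sum_(i <- s) F i x) = \sum_(i <- s) cintegral mu (F i).
Proof.
move=> Fi; elim: s => [|i s [IH1 IH2]].
  by rewrite big_nil; under eq_fun do rewrite big_nil; exact: cintegral0.
under eq_fun do rewrite big_cons; rewrite big_cons -IH2.
exact: cintegralD.
Qed.

Lemma cintegral_conj g :  cintble mu g ->
  cintble mu (fun x => conjc (g x)) /\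
  cintegral mu (fun x => conjc (g x)) = conjc (cintegral mu g).
Proof.
move=> [g1 g2]; rewrite /cintble; under eq_fun do rewrite ReJ.
under [X in _ /\ rint _ X]eq_fun do rewrite ImJ.
split; first by split=> //; exact: rintN.
apply: complex_eqP; rewrite ?ReJ ?ImJ /=.
  by under Rint_eq do rewrite ReJ.
by under Rint_eq do rewrite ImJ; exact: RintN.
Qed.

(** Rotating the integral onto the positive real axis reduces the triangle
    inequality to the one for real parts. *)
Lemma normc_cintegral g b : cmeas g -> rint mu b ->
  (forall x, normc (g x) <= b x) ->
  normc (cintegral mu g) <= (\int[mu]_x b x)%R.
Proof.
move=> mg ib gb; have gi := cintble_le mg ib gb.
set z := cintegral mu g.
have [z0|z0] := eqVneq z 0.
  rewrite z0 normc0; apply: Rintegral_ge0 => x _.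
  exact: le_trans (normc_ge0 _) (gb x).
have nz0 : normc z != 0 by apply: contra z0 => /eqP/eq0_normc ->.
pose u := conjc z * ((normc z)^-1)%:C.
have nu : normc u = 1.
  by rewrite normcM normc_conj normcR ger0_norm ?invr_ge0 ?normc_ge0// divff.
have uz : u * z = (normc z)%:C.
  by rewrite /u mulrAC [_ * z]mulrC mulc_conj -rmorphM/= expr2 mulfK.
have [ug1 ug2] := cintegralZ u gi.
have -> : normc z = (\int[mu]_x complex.Re (u * g x))%R.
  by have := congr1 (@complex.Re R) ug2; rewrite -/z uz/= => ->.
apply: Rint_le => //; first by case: ug1.
move=> x; apply: le_trans (ler_norm _) _; apply: le_trans (normc_Re _) _.
by rewrite normcM nu mul1r.
Qed.

Lemma cintegral_dct (g_ : nat -> T -> R[i]) g b :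
  (forall n, cmeas (g_ n)) ->
  (forall x, (fun n => complex.Re (g_ n x)) @ \oo --> complex.Re (g x)) ->
  (forall x, (fun n => complex.Im (g_ n x)) @ \oo --> complex.Im (g x)) ->
  rint mu b -> (forall n x, normc (g_ n x) <= b x) ->
  [/\ cintble mu g,
    (fun n => complex.Re (cintegral mu (g_ n))) @ \oo --> complex.Re (cintegral mu g) &
    (fun n => complex.Im (cintegral mu (g_ n))) @ \oo --> complex.Im (cintegral mu g)].
Proof.
move=> mg c1 c2 ib gb.
have [i1 l1] := @Rint_dct _ _ _ mu (fun n x => complex.Re (g_ n x))
  (fun x => complex.Re (g x)) b (fun n => (mg n).1) c1 ib
  (fun n x => le_trans (normc_Re _) (gb n x)).
have [i2 l2] := @Rint_dct _ _ _ mu (fun n x => complex.Im (g_ n x))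
  (fun x => complex.Im (g x)) b (fun n => (mg n).2) c2 ib
  (fun n x => le_trans (normc_Im _) (gb n x)).
by split.
Qed.

End complex_integral.

Section complex_fubini.
Context d1 d2 (T1 : measurableType d1) (T2 : measurableType d2) (R : realType).
Variables (m1 : {sigma_finite_measure set T1 -> \bar R})
  (m2 : {sigma_finite_measure set T2 -> \bar R}).
Variables (F : T1 * T2 -> R[i]) (b1 : T1 -> R) (b2 : T2 -> R).
Hypotheses (mF : cmeas F) (ib1 : rint m1 b1) (ib2 : rint m2 b2)
  (Fb : forall x y, normc (F (x, y)) <= b1 x * b2 y).

Let FbR x y : `|complex.Re (F (x, y))| <= b1 x * b2 y.
Proof. exact: le_trans (normc_Re _) (Fb x y). Qed.

Let FbI x y : `|complex.Im (F (x, y))| <= b1 x * b2 y.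
Proof. exact: le_trans (normc_Im _) (Fb x y). Qed.

Lemma cintble_inner1 : cintble m1 (fun x => cintegral m2 (fun y => F (x, y))).
Proof.
by split; [exact: (rint_inner1 (F := fun z => complex.Re (F z)) mF.1 ib1 ib2 FbR)|exact: (rint_inner1 (F := fun z => complex.Im (F z)) mF.2 ib1 ib2 FbI)].
Qed.

Lemma cintegral_fubini :
  cintegral m1 (fun x => cintegral m2 (fun y => F (x, y))) =
  cintegral m2 (fun y => cintegral m1 (fun x => F (x, y))).
Proof.
by apply: complex_eqP;
  [exact: (Rint_fubini (F := fun z => complex.Re (F z)) mF.1 ib1 ib2 FbR)|exact: (Rint_fubini (F := fun z => complex.Im (F z)) mF.2 ib1 ib2 FbI)].
Qed.

Lemma cintegral_prod :
  cintegral (m1 \x m2)%E F = cintegral m1 (fun x => cintegral m2 (fun y => F (x, y))).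
Proof.
by apply: complex_eqP;
  [exact: (Rint_prod (F := fun z => complex.Re (F z)) mF.1 ib1 ib2 FbR)|exact: (Rint_prod (F := fun z => complex.Im (F z)) mF.2 ib1 ib2 FbI)].
Qed.

End complex_fubini.

Section complex_affine.
Context (R : realType).
Local Notation mu := (@lebesgue_measure R).

Lemma cintegral_affine (c e : R) (g : R -> R[i]) : 0 < c -> cintble mu g ->
  cintble mu (fun x => g (c * x + e)) /\
  cintegral mu (fun x => g (c * x + e)) = (c^-1)%:C * cintegral mu g.
Proof.
move=> c0 [g1 g2]; have [i1 e1] := rint_affine e c0 g1.
have [i2 e2] := rint_affine e c0 g2.
split; first by split.
apply: complex_eqP; rewrite ?ReM ?ImM/= ?mul0r ?subr0 ?addr0 ?e1 ?e2//.
Qed.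

Lemma cmeas_affine (c e : R) (g : R -> R[i]) : cmeas g ->
  cmeas (fun x => g (c * x + e)).
Proof.
by move=> [h1 h2]; split; [exact: (measurable_affine c e h1)|exact: (measurable_affine c e h2)].
Qed.

End complex_affine.

(** * Fourier transforms and inversion *)

Section fourier_basics.
Context (R : realType).
Local Notation mu := (@lebesgue_measure R).

(** The integral theorems give measurability in [t] for integrands that are
    also integrable in [t]: a Gaussian factor provides this and is divided out
    afterwards. *)
Lemma cmeas_param d (T : measurableType d) (m : {sigma_finite_measure set T -> \bar R})
    (F : measurableTypeR R * T -> R[i]) (b : T -> R) :
  cmeas F -> rint m b -> (forall t y, normc (F (t, y)) <= b y) ->
  cmeas (fun t => cintegral m (fun y => F (t, y))).
Proof.
move=> mF ib Fb.
pose G (z : measurableTypeR R * T) : R[i] := (expR (- z.1 ^+ 2))%:C * F z.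
have mG : cmeas G.
  apply: cmeasM => //; apply: cmeas_real.
  apply: (measurableT_comp (@measurable_expR R)); apply: measurable_funN.
  exact: measurable_funX.
have ig : rint mu (fun t : R => expR (- t ^+ 2)).
  exact: integrableT_gauss.
have Gb t y : normc (G (t, y)) <= expR (- t ^+ 2) * b y.
  by rewrite normcM normcR ger0_norm ?expR_ge0// ler_wpM2l ?expR_ge0.
have mGi := cintble_meas (cintble_inner1 mG ig ib Gb).
have Fi t : cintble m (fun y => F (t, y)).
  by apply: cintble_le ib (Fb t); apply: cmeas_comp mF.
have -> : (fun t => cintegral m (fun y => F (t, y))) =
    (fun t => (expR (t ^+ 2))%:C * cintegral m (fun y => G (t, y))).
  apply/funext => t; rewrite /G /= (cintegralZ _ (Fi t)).2 mulrA -rmorphM/=.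
  by rewrite -expRD subrr expR0 mul1r.
apply: cmeasM => //; apply: cmeas_real.
by apply: (measurableT_comp (@measurable_expR R)); exact: measurable_funX.
Qed.

Lemma measurable_mul1 (c : R) : measurable_fun setT (fun x : R => c * x).
Proof. exact: measurable_funM. Qed.

Section one_function.
Variables (h : R -> R).
Hypothesis hi : rint mu h.

Let mh : measurable_fun setT h. Proof. exact: rint_meas hi. Qed.

Lemma cintble_modulated (f : R -> R) : measurable_fun setT f ->
  cintble mu (fun x => (h x)%:C * expi (f x)).
Proof.
move=> mf; apply: (cintble_le _ (rint_norm hi)) => [|x].
  by apply: cmeasM; [exact: cmeas_real|exact: cmeas_expi].
by rewrite normcM normcR normc_expi mulr1.
Qed.

Lemma fourier_le t : normc (fourier h t) <= (\int[mu]_x `|h x|)%R.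
Proof.
apply: normc_cintegral (rint_norm hi) _ => [|x].
  apply: cmeasM; first exact: cmeas_real.
  by apply: cmeas_expi; apply: measurable_funN; exact: measurable_mul1.
by rewrite normcM normcR normc_expi mulr1.
Qed.

Lemma cmeas_fourier : cmeas (fourier h).
Proof.
apply: (cmeas_param (m := mu)
  (F := fun z : measurableTypeR R * measurableTypeR R => (h z.2)%:C * expi (- (z.1 * z.2))) (b := fun x => `|h x|)).
- apply: cmeasM; first by apply: cmeas_real; exact: (measurableT_comp mh).
  by apply: cmeas_expi; apply: measurable_funN; exact: measurable_funM.
- exact: rint_norm.
- by move=> t x; rewrite normcM normcR normc_expi mulr1.
Qed.

End one_function.

Lemma fourier_affine (h : R -> R) (c e t : R) : 0 < c -> rint mu h ->
  fourier (fun x => h (c * x + e)) t =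
    (c^-1)%:C * (expi (t * e / c) * fourier h (t / c)).
Proof.
move=> c0 hi; have cn0 : c != 0 by rewrite gt_eqF.
have i1 : cintble mu (fun x => (h x)%:C * expi (- (t / c * x))).
  by apply: (cintble_modulated hi); apply: measurable_funN; exact: measurable_mul1.
have [i2 e2] := cintegralZ (expi (t * e / c)) i1.
have [_ e3] := cintegral_affine e c0 i2.
rewrite /fourier -e2 -e3.
apply: eq_cintegral => x; rewrite mulrCA -expiD; congr (_ * expi _).
by field.
Qed.

End fourier_basics.

Section cauchy_kernel.
Context (R : realType).
Local Notation mu := (@lebesgue_measure R).

Lemma oneDsqr_integral :
  rint mu (fun x : R => (1 + x ^+ 2)^-1) /\ (\int[mu]_x (1 + x ^+ 2)^-1)%R = pi :> R.
Proof.
have e : (\int[mu]_x ((1 + x ^+ 2)^-1)%:E = (pi : R)%:E)%E.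
  rewrite (@ge0_symfun_integralT R (fun x : R => (1 + x ^+ 2)^-1)).
  - rewrite -set_itvcy.
    have := @integral0y_oneDsqr R; rewrite /oneDsqr => ->.
    by rewrite -EFinM; congr (_%:E); field.
  - by move=> x; rewrite invr_ge0 addr_ge0// sqr_ge0.
  - exact: continuous_oneDsqrV.
  - by move=> x /=; rewrite sqrrN.
have m : measurable_fun setT (fun x : R => (1 + x ^+ 2)^-1).
  by apply: continuous_measurable_fun; exact: continuous_oneDsqrV.
have [i _] : rint mu (fun x : R => (1 + x ^+ 2)^-1) /\ (\int[mu]_x (1 + x ^+ 2)^-1)%R <= pi :> R.
  by apply: ge0_rint => //; [move=> x; rewrite invr_ge0 addr_ge0// sqr_ge0|rewrite e].
by split=> //; rewrite /Rintegral e.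
Qed.

Lemma cauchy_integral (eps x : R) : 0 < eps ->
  rint mu (fun y : R => 2 * eps / (eps ^+ 2 + (y - x) ^+ 2)) /\
  (\int[mu]_y (2 * eps / (eps ^+ 2 + (y - x) ^+ 2)))%R = 2 * pi :> R.
Proof.
move=> e0; have [i1 e1] := oneDsqr_integral.
have en0 : eps != 0 by rewrite gt_eqF.
have ei : 0 < eps^-1 by rewrite invr_gt0.
have [i2 e2] := rint_affine (- x / eps) ei i1.
have E : (fun y : R => 2 * eps / (eps ^+ 2 + (y - x) ^+ 2)) =
    (fun y => 2 / eps * (1 + (eps^-1 * y + - x / eps) ^+ 2)^-1).
  apply/funext => y; field; rewrite en0/=.
  by apply: lt0r_neq0; rewrite ltr_pwDl ?sqr_ge0 ?exprn_gt0.
rewrite E; split; first exact: rintZ.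
rewrite RintegralZl// e2 e1; by field.
Qed.

Lemma laplace_cos_half (eps u : R) : 0 < eps ->
  (\int[mu]_(t in `[0%R, +oo[) (expR (- (eps * t)) * (1 + cos (t * u)))%:E
   = (eps^-1 + eps / (eps ^+ 2 + u ^+ 2))%:E)%E.
Proof.
move=> e0.
have en0 : eps != 0 by rewrite gt_eqF.
have d0 : eps ^+ 2 + u ^+ 2 != 0.
  by apply: lt0r_neq0; rewrite ltr_pwDl ?sqr_ge0 ?exprn_gt0.
pose F (t : R) := expR (- (eps * t)) *
  (- eps^-1 + (u * sin (t * u) - eps * cos (t * u)) / (eps ^+ 2 + u ^+ 2)).
pose f (t : R) := expR (- (eps * t)) * (1 + cos (t * u)).
have dF (t : R) : is_derive t 1 F (f t).
  rewrite /F /f.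
  apply: is_derive_eq.
  rewrite /GRing.scale /=; field; exact/andP.
have cf : continuous f.
  move=> t; apply: differentiable_continuous; apply/derivable1_diffP.
  by rewrite /f; apply: ex_derive.
have cF : continuous F.
  move=> t; apply: differentiable_continuous; apply/derivable1_diffP.
  exact: ex_derive.
have Fy : F t @[t --> +oo%R] --> (0 : R).
  pose M := eps^-1 + (`|u| + eps) / (eps ^+ 2 + u ^+ 2).
  have B (t : R) : `|- eps^-1 + (u * sin (t * u) - eps * cos (t * u)) / (eps ^+ 2 + u ^+ 2)|
      <= M.
    apply: le_trans (ler_normD _ _) _; rewrite normrN gtr0_norm ?invr_gt0// lerD2l.
    have dp : 0 < eps ^+ 2 + u ^+ 2 by rewrite ltr_pwDl ?sqr_ge0 ?exprn_gt0.
    rewrite normrM [X in _ * X]gtr0_norm ?invr_gt0// ler_pM2r ?invr_gt0//.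
    apply: le_trans (ler_normB _ _) _; rewrite !normrM (gtr0_norm e0).
    apply: lerD; first by apply: ler_piMr => //; rewrite ler_norml sin_geN1 sin_le1.
    by apply: ler_piMr; [exact: ltW|rewrite ler_norml cos_geN1 cos_le1].
  apply/norm_cvg0P.
  apply: (@squeeze_cvgr _ _ _ _ (fun=> 0) (fun t => expR (- (eps * t)) * M)).
  - apply: nearW => t; rewrite normr_ge0/= normrM ger0_norm ?expR_ge0//.
    by apply: ler_wpM2l; [exact: expR_ge0|exact: B].
  - exact: cvg_cst.
  - rewrite -(mul0r M); apply: cvgMl.
    apply: (cvg_comp (fun t => eps * t) (fun x => expR (- x))); last exact: cvgr_expR.
    by apply: gt0_cvgMry => //; exact: cvg_id.
rewrite (@ge0_continuous_FTC2y _ _ F _ _ _ _ Fy).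
- rewrite /F mulr0 oppr0 expR0 mul0r sin0 cos0 mulr0 -EFinB; congr (_%:E).
  by field; rewrite en0 d0.
- by move=> x _; rewrite mulr_ge0 ?expR_ge0// -lerBlDl sub0r cos_geN1.
- by apply: continuous_subspaceT => t; exact: cf.
- by move=> t _; exact: ex_derive.
- by apply: cvg_at_right_filter; exact: cF.
- by move=> t _; rewrite derive1E; exact: derive_val.
Qed.

(** Adding 1 to the cosine makes the integrand nonnegative, so that the
    improper integral can be evaluated by monotone convergence. *)
Lemma laplace_cos (eps u : R) : 0 < eps ->
  [/\ rint mu (fun t : R => expR (- (eps * `|t|))) ,
      (\int[mu]_t expR (- (eps * `|t|)))%R = 2 / eps &
      (\int[mu]_t (expR (- (eps * `|t|)) * cos (t * u)))%R = 2 * eps / (eps ^+ 2 + u ^+ 2)].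
Proof.
move=> e0.
have en0 : eps != 0 by rewrite gt_eqF.
have d0 v : eps ^+ 2 + v ^+ 2 != 0.
  by apply: lt0r_neq0; rewrite ltr_pwDl ?sqr_ge0 ?exprn_gt0.
pose f v (t : R) := expR (- (eps * `|t|)) * (1 + cos (t * v)).
have f0 v t : 0 <= f v t.
  by rewrite mulr_ge0 ?expR_ge0// -lerBlDl sub0r cos_geN1.
have cabs : continuous (fun t : R => expR (- (eps * `|t|))).
  move=> t; apply: continuous_comp; last exact: continuous_expR.
  apply: cvgN; apply: cvgMr; exact: norm_continuous.
have ccos v : continuous (fun t : R => cos (t * v)).
  move=> t; apply: continuous_comp; last exact: continuous_cos.
  by apply: cvgMl; exact: cvg_id.
have cf v : continuous (f v).
  move=> t; apply: cvgM; first exact: cabs.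
  by apply: cvgD; [exact: cvg_cst|exact: ccos].
have ff v : (\int[mu]_t (f v t)%:E = (2 * (eps^-1 + eps / (eps ^+ 2 + v ^+ 2)))%:E)%E.
  rewrite ge0_symfun_integralT//; last first.
    by move=> t; rewrite /f /= normrN mulNr cosN.
  rewrite -set_itvcy EFinM -laplace_cos_half//; congr (_ * _)%E.
  apply: eq_integral => t; rewrite inE/= in_itv/= andbT => t0.
  by rewrite /f ger0_norm.
have mf v : measurable_fun setT (f v) by exact: continuous_measurable_fun.
have fie v : rint mu (f v) /\
    (\int[mu]_t f v t)%R = 2 * (eps^-1 + eps / (eps ^+ 2 + v ^+ 2)).
  have fle : (\int[mu]_t (f v t)%:E <= (2 * (eps^-1 + eps / (eps ^+ 2 + v ^+ 2)))%:E)%E.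
    by rewrite ff.
  have [fi _] := ge0_rint (mu := mu) (mf v) (f0 v) fle.
  by split=> //; rewrite /Rintegral ff.
have E0 : (fun t : R => expR (- (eps * `|t|))) = (fun t => 2^-1 * f 0 t).
  by apply/funext => t; rewrite /f mulr0 cos0; field.
have i0 : rint mu (fun t : R => expR (- (eps * `|t|))).
  by rewrite E0; apply: rintZ; exact: (fie 0).1.
have v0 : (\int[mu]_t expR (- (eps * `|t|)))%R = 2 / eps.
  by rewrite E0 RintegralZl ?(fie 0).2//; [rewrite expr0n addr0; field|exact: (fie 0).1].
split=> //.
have -> : (fun t : R => expR (- (eps * `|t|)) * cos (t * u)) =
    (fun t => f u t - expR (- (eps * `|t|))).
  by apply/funext => t; rewrite /f; ring.
rewrite RintegralB//; last exact: (fie u).1.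
rewrite (fie u).2 v0; field; exact/andP.
Qed.

Lemma Rint_opp (f : R -> R) : rint mu f ->
  rint mu (fun x => f (- x)) /\ (\int[mu]_x f (- x))%R = (\int[mu]_x f x)%R.
Proof.
move=> fi.
have mphi : @measurable_fun _ _ (measurableTypeR R) (measurableTypeR R) setT
    (fun x : R => - x) by exact: measurable_funN.
have mf := rint_meas fi.
have ge0 (g : R -> \bar R) : measurable_fun setT g -> (forall x, 0 <= g x)%E ->
    (\int[mu]_x g (- x)%R = \int[mu]_x g x)%E.
  move=> mg g0.
  have := ge0_integral_pushforward mphi mu measurableT mg (fun x _ => g0 x).
  rewrite preimage_setT /= => <-.
  pose m' : {measure set (measurableTypeR R) -> \bar R} :=
    measure_function_pushforward__canonical__measure_function_Measure mu mphi.
  rewrite [RHS](eq_measure_integral m')//.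
  by move=> A mA _; apply/esym; exact: lebesgue_measureN.
have foi : rint mu (fun x => f (- x)).
  apply/integrableP; split.
    by apply/measurable_EFinP; exact: (measurableT_comp mf).
  rewrite (ge0 (fun x => `|(f x)%:E|%E))//; first by have /integrableP[] := fi.
  by apply/measurable_EFinP; exact: measurableT_comp.
split=> //; apply: EFin_inj; rewrite -(rint_fin foi) -(rint_fin fi).
rewrite [RHS]integralE.
rewrite -(ge0 (funepos (EFin \o f)))//; last exact/measurable_funepos/measurable_EFinP.
rewrite -(ge0 (funeneg (EFin \o f)))//; last exact/measurable_funeneg/measurable_EFinP.
rewrite [LHS]integralE; congr (_ - _)%E;
  by apply: eq_integral => x _; rewrite ?funeposE ?funenegE.
Qed.

Lemma laplace_expi (eps u : R) : 0 < eps ->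
  cintegral mu (fun t => (expR (- (eps * `|t|)))%:C * expi (t * u)) =
  (2 * eps / (eps ^+ 2 + u ^+ 2))%:C.
Proof.
move=> e0; have [i0 _ ec] := laplace_cos u e0.
apply: complex_eqP => /=.
  by rewrite -ec; apply: Rint_eq => t; rewrite mul0r subr0.
have mulu : measurable_fun setT (fun t : R => t * u) by exact: measurable_funM.
have iS : rint mu (fun t => expR (- (eps * `|t|)) * sin (t * u)).
  apply: (rint_le _ i0) => [|t].
    apply: measurable_funM; first exact: rint_meas i0.
    by apply: (measurableT_comp _ mulu); apply: continuous_measurable_fun; exact: continuous_sin.
  rewrite normrM ger0_norm ?expR_ge0// ler_piMr ?expR_ge0//.
  by rewrite ler_norml sin_geN1 sin_le1.
transitivity (\int[mu]_t (expR (- (eps * `|t|)) * sin (t * u)))%R.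
  by apply: Rint_eq => t; rewrite mul0r addr0.
have [_] := Rint_opp iS.
under Rint_eq do rewrite normrN mulNr sinN mulrN.
rewrite RintN// => e; lra.
Qed.

End cauchy_kernel.

Section inversion.
Context (R : realType).
Local Notation mu := (@lebesgue_measure R).
Variables (h : R -> R) (x : R).
Hypotheses (hi : rint mu h) (fi : rint mu (fun t => normc (fourier h t)))
  (hx : {for x, continuous h}).

Let mh := rint_meas hi.

Let reg (eps : R) (t : R) : R[i] :=
  (expR (- (eps * `|t|)))%:C * (fourier h t * expi (t * x)).

Let cauchy (eps : R) (y : R) := 2 * eps / (eps ^+ 2 + (y - x) ^+ 2).

(** The factor [exp (- eps |t|)] makes the double integral absolutely
    convergent; once the integrals are exchanged, the inner one is a Cauchy
    kernel. *)
Lemma regularized_inversion (eps : R) : 0 < eps ->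
  cintegral mu (reg eps) = ((\int[mu]_y (h y * cauchy eps y))%R)%:C.
Proof.
move=> e0; have [i0 _ _] := laplace_cos 0 e0.
pose F (z : measurableTypeR R * measurableTypeR R) : R[i] :=
  (expR (- (eps * `|z.1|)))%:C * ((h z.2)%:C * expi (z.1 * (x - z.2))).
have mF : cmeas F.
  apply: cmeasM; first by apply: cmeas_real; exact: (measurableT_comp (rint_meas i0)).
  apply: cmeasM; first by apply: cmeas_real; exact: (measurableT_comp mh).
  apply: cmeas_expi; apply: measurable_funM => //; exact: measurable_funB.
have Fb t y : normc (F (t, y)) <= expR (- (eps * `|t|)) * `|h y|.
  by rewrite !normcM !normcR normc_expi mulr1 ger0_norm ?expR_ge0.
have := cintegral_fubini mF i0 (rint_norm hi) Fb.
have -> : (fun t => cintegral mu (fun y => F (t, y))) = reg eps.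
  apply/funext => t; rewrite /reg /F /=.
  have m1 : measurable_fun setT (fun y : R => - (t * y)).
    by apply: measurable_funN; exact: measurable_mul1.
  have [j1 j2] := cintegralZ ((expR (- (eps * `|t|)))%:C * expi (t * x)) (cintble_modulated hi m1).
  transitivity ((expR (- (eps * `|t|)))%:C * expi (t * x) * fourier h t); last by ring.
  rewrite -j2; apply: eq_cintegral => y; rewrite mulrBr expiD; ring.
move=> ->; rewrite -cintegral_real; apply: eq_cintegral => y.
rewrite /F /=.
have j : cintble mu (fun t => (expR (- (eps * `|t|)))%:C * expi (t * (x - y))).
  by apply: (cintble_modulated i0); exact: measurable_funM.
transitivity (cintegral mu (fun t =>
    (h y)%:C * ((expR (- (eps * `|t|)))%:C * expi (t * (x - y))))).
  by apply: eq_cintegral => t; rewrite mulrCA.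
have [_ ->] := cintegralZ (h y)%:C j.
rewrite laplace_expi// -rmorphM/= /cauchy; congr ((_ * (_ / (_ + _)))%:C).
by rewrite -sqrrN opprB.
Qed.

(** The Cauchy kernel concentrates at [x]: continuity controls the mass near
    [x], while off a neighbourhood of [x] the kernel is at most a multiple of
    eps, which only needs [h] to be integrable. *)
Lemma cauchy_mean_cvg :
  (fun n : nat => (\int[mu]_y (h y * cauchy n.+1%:R^-1 y))%R) @ \oo --> 2 * pi * h x.
Proof.
have hx2 : rint mu (fun y : R => `|h y| + `|h x| * (1 + (y - x) ^+ 2)^-1).
  apply: rintD; first exact: rint_norm.
  apply: rintZ; have := (rint_affine (- x) ltr01 (oneDsqr_integral R).1).1.
  by apply: rint_eq => y; rewrite mul1r.
set M := (\int[mu]_y (`|h y| + `|h x| * (1 + (y - x) ^+ 2)^-1))%R.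
have M0 : 0 <= M.
  apply: Rintegral_ge0 => y _; rewrite addr_ge0// mulr_ge0// invr_ge0.
  by rewrite addr_ge0// sqr_ge0.
apply/cvgrPdist_le => e e0.
pose eta := e / (4 * pi).
have pi0 : (0 : R) < pi by exact: pi_gt0.
have eta0 : 0 < eta by rewrite divr_gt0// mulr_gt0.
have [dlt /= d0 hd] : exists2 d : R, 0 < d & forall y, `|x - y| < d -> `|h x - h y| <= eta.
  have /cvgrPdist_le/(_ _ eta0)/nbhs_ballP[d /= d0 hd] := hx.
  by exists d => // y xy; apply: hd.
pose D := 2 * (1 + dlt ^- 2).
have D0 : 0 < D by rewrite mulr_gt0// ltr_pwDl// invr_ge0 sqr_ge0.
have small : \forall n \near \oo, n.+1%:R^-1 * (D * M) <= e / 2.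
  have [->|Mp] := eqVneq M 0.
    by near=> n; rewrite mulr0 mulr0 divr_ge0// ltW.
  have DM : 0 < D * M by rewrite mulr_gt0// lt0r Mp.
  have e1 := divr_gt0 (divr_gt0 e0 (ltr0Sn R 1)) DM.
  apply: filterS (near_infty_natSinv_lt (PosNum e1)) => n /ltW /=.
  by rewrite ler_pdivlMr.
near=> n.
set eps : R := n.+1%:R^-1.
have e0' : 0 < eps by rewrite invr_gt0.
have [ci ce'] := cauchy_integral x e0'.
have ce : (\int[mu]_y cauchy eps y)%R = 2 * pi := ce'.
have c0 y : 0 <= cauchy eps y.
  by rewrite mulr_ge0 ?invr_ge0 ?addr_ge0 ?sqr_ge0// mulr_ge0// ltW.
have cle y : `|(h y - h x) * cauchy eps y| <=
    eta * cauchy eps y + eps * D * (`|h y| + `|h x| * (1 + (y - x) ^+ 2)^-1).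
  rewrite normrM [X in _ * X]ger0_norm//.
  have q0 : 0 < 1 + (y - x) ^+ 2 by rewrite ltr_pwDl// sqr_ge0.
  have [xy|xy] := ltP `|x - y| dlt.
    rewrite ler_wpDr//; last by rewrite ler_wpM2r// distrC hd.
    rewrite mulr_ge0//; first by rewrite mulr_ge0// ltW.
    by rewrite addr_ge0// mulr_ge0// invr_ge0 ltW.
  rewrite ler_wpDl//; first by rewrite mulr_ge0// ltW.
  have q1 : dlt ^+ 2 <= (y - x) ^+ 2.
    by rewrite -(real_normK (num_real (y - x))) distrC lerXn2r// nnegrE ltW.
  have dd : 0 < dlt ^+ 2 by rewrite exprn_gt0.
  have ck : cauchy eps y <= eps * D * (1 + (y - x) ^+ 2)^-1.
    have key : 1 + (y - x) ^+ 2 <= (1 + dlt ^- 2) * (eps ^+ 2 + (y - x) ^+ 2).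
      have : 1 <= (y - x) ^+ 2 / dlt ^+ 2 by rewrite ler_pdivlMr// mul1r.
      have : 0 <= eps ^+ 2 / dlt ^+ 2 by rewrite divr_ge0// sqr_ge0.
      have : 0 <= eps ^+ 2 by rewrite sqr_ge0.
      rewrite mulrDl mul1r mulrDr ![dlt ^- 2 * _]mulrC; lra.
    rewrite /cauchy /D ler_pdivrMr; last by rewrite ltr_pwDl ?sqr_ge0 ?exprn_gt0.
    rewrite mulrAC ler_pdivlMr//.
    have := ler_wpM2l (ltW (mulr_gt0 (ltr0Sn R 1) e0')) key.
    by congr (_ <= _); ring.
  apply: le_trans (ler_wpM2r (c0 y) (ler_normB _ _)) _.
  rewrite mulrDl [X in _ <= X]mulrDr lerD//.
    rewrite mulrC ler_wpM2r//; apply: le_trans ck _.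
    rewrite ler_piMr//; first by rewrite mulr_ge0// ltW.
    by rewrite invf_le1// lerDl sqr_ge0.
  by rewrite [leRHS]mulrCA ler_wpM2l.
have hci : rint mu (fun y => h y * cauchy eps y).
  apply: (rint_le _ (rintZ (2 / eps) (rint_norm hi))) => [|y].
    by apply: measurable_funM => //; exact: rint_meas ci.
  rewrite normrM mulrC ler_wpM2r// ger0_norm// /cauchy.
  rewrite ler_pdivrMr; last by rewrite ltr_pwDl ?sqr_ge0 ?exprn_gt0.
  have -> : 2 * eps = 2 / eps * eps ^+ 2 by field; rewrite gt_eqF.
  by apply: ler_wpM2l; rewrite ?lerDl ?sqr_ge0// divr_ge0// ltW.
have -> : 2 * pi * h x = (\int[mu]_y (h x * cauchy eps y))%R.
  by rewrite RintegralZl// ce mulrC.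
rewrite -RintegralB//; last exact: rintZ.
have -> : (fun y => h x * cauchy eps y - h y * cauchy eps y) =
    (fun y => - ((h y - h x) * cauchy eps y)) by apply/funext => y; ring.
have bi : rint mu (fun y => eta * cauchy eps y +
    eps * D * (`|h y| + `|h x| * (1 + (y - x) ^+ 2)^-1)).
  by apply: rintD; exact: rintZ.
apply: le_trans (Rint_norm_le _ bi _) _.
- apply: measurable_funN; apply: measurable_funM; last exact: rint_meas ci.
  exact: measurable_funB.
- by move=> y; rewrite normrN.
rewrite RintegralD; [|by []|exact: rintZ|exact: rintZ].
rewrite RintegralZl// RintegralZl//.
rewrite ce -/M.
have -> : eta * (2 * pi) = e / 2.
  by rewrite /eta; have pn0 := lt0r_neq0 pi0; move: (pi : R) pn0 => p pn0; field.
have hn : n.+1%:R^-1 * (D * M) <= e / 2 by near: n; exact: small.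
by move: hn; rewrite -/eps mulrA; lra.
Unshelve. all: by end_near. Qed.

(** Both sides of [regularized_inversion] are followed as eps tends to 0: the
    left one by domination, the right one by [cauchy_mean_cvg]. *)
Lemma fourier_inversion :
  cintegral mu (fun t => fourier h t * expi (t * x)) = (2 * pi * h x)%:C.
Proof.
have mf : cmeas (fun t => fourier h t * expi (t * x)).
  apply: cmeasM; first exact: cmeas_fourier.
  by apply: cmeas_expi; exact: measurable_funM.
have mE (n : nat) : measurable_fun setT (fun t : R => expR (- (n.+1%:R^-1 * `|t|))).
  have n0 : 0 < n.+1%:R^-1 :> R by rewrite invr_gt0.
  by have [i0 _ _] := laplace_cos 0 n0; exact: rint_meas i0.
have E1 (t : R) : (fun n : nat => expR (- (n.+1%:R^-1 * `|t|))) @ \oo --> (1 : R).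
  rewrite -[X in _ --> X]expR0 -oppr0 -[X in - X](mul0r `|t|).
  apply: continuous_cvg; first exact: continuous_expR.
  by apply: cvgN; apply: cvgMl; exact: cvg_harmonic.
have bnd (n : nat) t : normc (reg n.+1%:R^-1 t) <= normc (fourier h t).
  rewrite /reg !normcM normcR normc_expi mulr1 ger0_norm ?expR_ge0//.
  apply: ler_piMl; first exact: normc_ge0.
  by rewrite -[leRHS]expR0 ler_expR oppr_le0 mulr_ge0.
have E2 (t z : R) : (fun n : nat => expR (- (n.+1%:R^-1 * `|t|)) * z) @ \oo --> z.
  by rewrite -[X in _ --> X]mul1r; apply: cvgMl; exact: E1.
have [_ c1 c2] : [/\ cintble mu (fun t => fourier h t * expi (t * x)),
    (fun n => complex.Re (cintegral mu (reg n.+1%:R^-1))) @ \oo -->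
      complex.Re (cintegral mu (fun t => fourier h t * expi (t * x))) &
    (fun n => complex.Im (cintegral mu (reg n.+1%:R^-1))) @ \oo -->
      complex.Im (cintegral mu (fun t => fourier h t * expi (t * x)))].
  apply: (@cintegral_dct _ _ R mu (fun n : nat => reg n.+1%:R^-1) _
    (fun t => normc (fourier h t))) => //.
  - by move=> n; exact: (cmeasM (cmeas_real (mE n)) mf).
  - by move=> t; under eq_fun do rewrite /reg ReM/= mul0r subr0; exact: E2.
  - by move=> t; under eq_fun do rewrite /reg ImM/= mul0r addr0; exact: E2.
have n0 (n : nat) : 0 < n.+1%:R^-1 :> R by rewrite invr_gt0.
apply: complex_eqP => /=.
  rewrite -[LHS](cvg_lim (@Rhausdorff R) c1); apply: cvg_lim => //.
  by under eq_fun do rewrite regularized_inversion//=; exact: cauchy_mean_cvg.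
rewrite -[LHS](cvg_lim (@Rhausdorff R) c2); apply: cvg_lim => //.
by under eq_fun do rewrite regularized_inversion//=; exact: cvg_cst.
Qed.

End inversion.

(** * Sums over the integers *)

(** Each window is a tail of the next one, so that a difference of two partial
    sums is again a sum over a list without repetition. *)
Fixpoint zwindow (K : nat) : seq int :=
  if K is K'.+1 then K'%:Z :: - K'.+1%:Z :: zwindow K' else [::].

Lemma mem_zwindow K (k : int) : (k \in zwindow K) = (- K%:Z <= k < K%:Z)%R.
Proof.
elim: K => [|K IH]; first by rewrite in_nil; lia.
by rewrite /= !inE IH; lia.
Qed.

Lemma uniq_zwindow K : uniq (zwindow K).
Proof.
elim: K => [//|K IH]; rewrite /= IH andbT inE !mem_zwindow; lia.
Qed.

Lemma zwindow_split K m : exists r, zwindow (K + m) = r ++ zwindow K.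
Proof.
elim: m => [|m [r IH]]; first by exists [::]; rewrite addn0.
by exists ((K + m)%N%:Z :: - (K + m).+1%:Z :: r); rewrite addnS /= IH.
Qed.

Definition zpart (V : zmodType) (u : int -> V) (K : nat) : V :=
  \sum_(i < K) (u i%:Z + u (- i.+1%:Z)).

Lemma zpartE (V : zmodType) (u : int -> V) K : zpart u K = \sum_(k <- zwindow K) u k.
Proof.
elim: K => [|K IH]; first by rewrite /zpart big_ord0 big_nil.
rewrite /zpart big_ord_recr /= -/(zpart u K) IH !big_cons.
by rewrite addrC addrA.
Qed.

Section real_zsums.
Context (R : realType).
Implicit Types (u v : int -> R) (K : nat) (M : R).

Lemma zpart_norm u K : `|zpart u K| <= zpart (fun k => `|u k|) K.
Proof. by rewrite !zpartE; exact: ler_norm_sum. Qed.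

Lemma zpart_le u v K : (forall k, u k <= v k) -> zpart u K <= zpart v K.
Proof. by move=> uv; rewrite !zpartE; exact: ler_sum. Qed.

Lemma zpartZ (c : R) u K : zpart (fun k => c * u k) K = c * zpart u K.
Proof. by rewrite !zpartE mulr_sumr. Qed.

Lemma zpart_nd u : (forall k, 0 <= u k) -> nondecreasing_seq (zpart u).
Proof.
move=> u0; apply/nondecreasing_seqP => K.
by rewrite /zpart big_ord_recr/= lerDl addr_ge0.
Qed.

Lemma zpart_term u M k : (forall k, 0 <= u k) -> (forall K, zpart u K <= M) -> u k <= M.
Proof.
move=> u0 uM; apply: le_trans (uM `|k|.+1%N); rewrite zpartE.
have kin : k \in zwindow `|k|.+1%N by rewrite mem_zwindow; lia.
by rewrite (big_rem k)//= lerDl; exact: sumr_ge0.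
Qed.

Lemma zpart_nonneg_cvg v M : (forall k, 0 <= v k) -> (forall K, zpart v K <= M) ->
  zpart v @ \oo --> zsum v.
Proof.
move=> v0 vM; apply: nondecreasing_is_cvgn; first exact: zpart_nd.
by exists M => _ [K _ <-].
Qed.

Definition ztail v K := zsum v - zpart v K.

Lemma ztail_cvg v M : (forall k, 0 <= v k) -> (forall K, zpart v K <= M) ->
  ztail v @ \oo --> (0 : R).
Proof.
move=> v0 vM; rewrite -(subrr (zsum v)); apply: cvgB; first exact: cvg_cst.
exact: zpart_nonneg_cvg vM.
Qed.

Lemma zpart_tail u v M K m : (forall k, `|u k| <= v k) -> (forall K, zpart v K <= M) ->
  `|zpart u (K + m) - zpart u K| <= ztail v K.
Proof.
move=> uv vM; have v0 k : 0 <= v k by exact: le_trans (uv k).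
have vs : zpart v (K + m) <= zsum v.
  apply: nondecreasing_cvgn_le; first exact: zpart_nd.
  exact: (zpart_nonneg_cvg v0 vM).
rewrite /ztail; apply: (@le_trans _ _ (zpart v (K + m) - zpart v K)); last by rewrite lerB.
have [r e] := zwindow_split K m.
rewrite !zpartE e !big_cat/= !addrK; apply: le_trans (ler_norm_sum _ _ _) _.
exact: ler_sum.
Qed.

Lemma zpart_cvg u v M : (forall k, `|u k| <= v k) -> (forall K, zpart v K <= M) ->
  zpart u @ \oo --> zsum u.
Proof.
move=> uv vM; have v0 k : 0 <= v k by exact: le_trans (uv k).
have uE : zpart u = series (fun i => u i%:Z + u (- i.+1%:Z)).
  by rewrite seriesEord.
suff : cvgn (zpart u) by apply.
rewrite uE; apply: normed_cvg; apply: nondecreasing_is_cvgn.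
  by apply: nondecreasing_series => i _ _ /=.
exists M => _ [K _ <-]; apply: le_trans (vM K).
change (series (fun i => `|u i%:Z + u (- i.+1%:Z)|) K <= zpart v K).
rewrite seriesEord.
by apply: ler_sum => i _; rewrite (le_trans (ler_normD _ _))// lerD.
Qed.

Lemma zsum_tail u v M K : (forall k, `|u k| <= v k) -> (forall K, zpart v K <= M) ->
  `|zsum u - zpart u K| <= ztail v K.
Proof.
move=> uv vM; have cu := zpart_cvg uv vM.
have c : (fun m => `|zpart u (m + K) - zpart u K|) @ \oo --> `|zsum u - zpart u K|.
  apply: cvg_norm; apply: cvgB; last exact: cvg_cst.
  by rewrite (cvg_shiftn K (zpart u)).
apply: (cvgr_to_le c); apply: nearW => m; rewrite addnC; exact: zpart_tail uv vM.
Qed.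

Lemma zsum_le u v M : (forall k, `|u k| <= v k) -> (forall K, zpart v K <= M) ->
  `|zsum u| <= M.
Proof.
move=> uv vM; apply: (cvgr_to_le (cvg_norm (zpart_cvg uv vM))).
apply: nearW => K; apply: le_trans (zpart_norm _ _) _; apply: le_trans (vM K).
exact: zpart_le.
Qed.

Lemma cvg_sumr (I T : Type) (F : set_system T) {FF : Filter F} (s : seq I)
    (a : I -> T -> R) (l : I -> R) : (forall i, a i t @[t --> F] --> l i) ->
  (\sum_(i <- s) a i t) @[t --> F] --> \sum_(i <- s) l i.
Proof.
move=> al; elim: s => [|i s IH].
  by rewrite big_nil; under eq_fun do rewrite big_nil; exact: cvg_cst.
by rewrite big_cons; under eq_fun do rewrite big_cons; exact: cvgD.
Qed.

(** The tails of the dominating sum are small uniformly in [n], and the finite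
    windows converge term by term. *)
Lemma zsum_tannery (a : nat -> int -> R) u v M :
  (forall n k, `|a n k| <= v k) -> (forall K, zpart v K <= M) ->
  (forall k, (fun n => a n k) @ \oo --> u k) ->
  (fun n => zsum (a n)) @ \oo --> zsum u.
Proof.
move=> av vM au.
have v0 k : 0 <= v k by exact: le_trans (av 0%N k).
have uv k : `|u k| <= v k.
  by apply: (cvgr_to_le (cvg_norm (au k))); apply: nearW => n; exact: av.
apply/cvgrPdist_le => e e0; have e3 : 0 < e / 3 by rewrite divr_gt0.
have [K tK] : exists K, ztail v K <= e / 3.
  have /cvgrPdist_le/(_ _ e3)[K _ HK] := ztail_cvg v0 vM.
  exists K; have := HK K (leqnn K); rewrite /= sub0r normrN; exact: le_trans (ler_norm _).
have cK : (fun n => zpart (a n) K) @ \oo --> zpart u K.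
  by rewrite zpartE; under eq_fun do rewrite zpartE; exact: cvg_sumr.
move/cvgrPdist_le : cK => /(_ _ e3); apply: filterS => n hn.
have h1 := zsum_tail K uv vM; have h2 := zsum_tail K (av n) vM.
have -> : zsum u - zsum (a n) = (zsum u - zpart u K) + (zpart u K - zpart (a n) K)
   - (zsum (a n) - zpart (a n) K) by ring.
apply: le_trans (ler_normB _ _) _; apply: le_trans (lerD (ler_normD _ _) h2) _.
by move: h1 hn tK; lra.
Qed.

(** The supremum of sums of extended reals is turned into one real bound for
    all the finite partial sums, the form that domination arguments need. *)
Lemma bounded_translate_sumP (h : R -> R) : bounded_translate_sum h ->
  exists2 Phi : R, 0 < Phi &
    forall x K, zpart (fun k => `|translate h k x|) K <= Phi.
Proof.
rewrite /bounded_translate_sum; set S := ereal_sup _ => Soo.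
have Sle x : (\esum_(k in [set: int]) `|translate h k x|%:E <= S)%E.
  by apply: ereal_sup_ubound; exists x.
have S0 : (0 <= S)%E.
  by apply: le_trans (Sle 0); apply: esum_ge0 => k _; rewrite lee_fin.
have Sf : S \is a fin_num by rewrite ge0_fin_numE.
exists (fine S + 1) => [|x K]; first by rewrite ltr_pwDr// fine_ge0.
rewrite -lee_fin EFinD fineK//; apply: (@le_trans _ _ S); last by rewrite leeDl.
apply: le_trans (Sle x); apply: esum_ge.
exists [set` zwindow K]; first by split=> //; exact: finite_seq.
by rewrite -fsbig_seq ?uniq_zwindow// zpartE sumEFin.
Qed.

End real_zsums.

(** * Square-integrable functions *)

Section square_integrable.
Context (R : realType).
Local Notation mu := (@lebesgue_measure R).
Implicit Types f g : R -> R.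

Definition sqnorm f : R := (\int[mu]_x (f x ^+ 2))%R.

Lemma L2_meas f : L2 f -> measurable_fun setT f.
Proof. by rewrite /L2/= inE => /andP[/[!inE]/= mf _]. Qed.

Lemma L2_rint f : L2 f -> rint mu (fun x => f x ^+ 2).
Proof. exact: Lfun2_integrable_sqr. Qed.

Lemma sqnorm_ge0 f : 0 <= sqnorm f.
Proof. by apply: Rintegral_ge0 => x _; exact: sqr_ge0. Qed.

Lemma L2_norm_powR f : (L2_norm f `^ 2 = \int[mu]_x (f x ^+ 2)%:E)%E.
Proof.
rewrite /L2_norm powR_Lnorm//; apply: eq_integral => x _ /=.
by rewrite powR_mulrn ?normr_ge0// real_normK ?num_real.
Qed.

Lemma L2P f : L2 f <-> measurable_fun setT f /\ rint mu (fun x => f x ^+ 2).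
Proof.
split=> [Lf|[mf f2]]; first by split; [exact: L2_meas|exact: L2_rint].
rewrite /L2/= inE; apply/andP; split; rewrite inE//=.
rewrite /finite_norm ltey; apply/eqP => e.
have := L2_norm_powR f; rewrite /L2_norm e poweRyr// (rint_fin f2).
by [].
Qed.

Lemma L2_mul f g : L2 f -> L2 g -> rint mu (fun x => f x * g x).
Proof. by move=> Lf Lg; apply/Lfun1_integrable; exact: (Lfun2_mul_Lfun1 Lf Lg). Qed.

Lemma sqnormE f : L2 f -> L2_norm f = (Num.sqrt (sqnorm f))%:E.
Proof.
move=> Lf; have := L2_norm_powR f; rewrite (rint_fin (L2_rint Lf)) -/(sqnorm f).
have : (0 <= L2_norm f)%E by exact: Lnorm_ge0.
case: (L2_norm f) => [r r0 /=|_|//]; last by rewrite poweRyr.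
move: r0; rewrite lee_fin => r0 [] <-.
by rewrite powR_mulrn// sqrtr_sqr ger0_norm.
Qed.

Lemma L2_norm_lt f (e : R) : L2 f -> 0 < e -> (L2_norm f < e%:E)%E = (sqnorm f < e ^+ 2).
Proof.
move=> Lf e0; rewrite sqnormE// lte_fin -{1}(ger0_norm (ltW e0)) -sqrtr_sqr.
by rewrite ltr_sqrt ?exprn_gt0.
Qed.

Lemma L2D f g : L2 f -> L2 g -> L2 (fun x => f x + g x).
Proof.
move=> Lf Lg; have mf := L2_meas Lf; have mg := L2_meas Lg.
apply/L2P; split; first exact: measurable_funD.
have h := rintD (rintZ 2 (L2_rint Lf)) (rintZ 2 (L2_rint Lg)).
apply: (rint_le _ h) => [|x]; first by apply: measurable_funX; exact: measurable_funD.
rewrite ger0_norm ?sqr_ge0//; have := sqr_ge0 (f x - g x); rewrite !expr2; lra.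
Qed.

Lemma L2Z c f : L2 f -> L2 (fun x => c * f x).
Proof.
move=> Lf; apply/L2P; split; first by apply: measurable_funM => //; exact: L2_meas.
by apply: rint_eq (rintZ (c ^+ 2) (L2_rint Lf)) => x; rewrite exprMn.
Qed.

Lemma L2B f g : L2 f -> L2 g -> L2 (fun x => f x - g x).
Proof.
move=> Lf Lg; have := L2D Lf (L2Z (-1) Lg).
by under eq_fun do rewrite mulN1r.
Qed.

Lemma L2_sum (I : Type) (s : seq I) (F : I -> R -> R) :
  (forall i, L2 (F i)) -> L2 (fun x => \sum_(i <- s) F i x).
Proof.
move=> LF; elim: s => [|i s IH].
  under eq_fun do rewrite big_nil; apply/L2P; split; first exact: measurable_cst.
  by under eq_fun do rewrite expr0n; exact: rint0.
by under eq_fun do rewrite big_cons; exact: L2D.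
Qed.

Lemma innerC f g : L2_inner f g = L2_inner g f.
Proof. by apply: Rint_eq => x; rewrite mulrC. Qed.

Lemma innerff f : L2_inner f f = sqnorm f.
Proof. by apply: Rint_eq => x; rewrite expr2. Qed.

Lemma innerBl f g h : L2 f -> L2 g -> L2 h ->
  L2_inner (fun x => f x - g x) h = L2_inner f h - L2_inner g h.
Proof.
move=> Lf Lg Lh; rewrite /L2_inner -RintegralB//; try exact: L2_mul.
by apply: Rint_eq => x; rewrite mulrBl.
Qed.

Lemma innerBr f g h : L2 f -> L2 g -> L2 h ->
  L2_inner h (fun x => f x - g x) = L2_inner h f - L2_inner h g.
Proof. by move=> Lf Lg Lh; rewrite innerC innerBl// !(innerC h). Qed.

Lemma innerZr c f g : L2 f -> L2 g -> L2_inner f (fun x => c * g x) = c * L2_inner f g.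
Proof.
move=> Lf Lg; rewrite /L2_inner -RintegralZl//; last exact: L2_mul.
by apply: Rint_eq => x; rewrite mulrCA.
Qed.

Lemma inner_sumr (I : Type) (s : seq I) (F : I -> R -> R) f :
  L2 f -> (forall i, L2 (F i)) ->
  L2_inner f (fun x => \sum_(i <- s) F i x) = \sum_(i <- s) L2_inner f (F i).
Proof.
move=> Lf LF; rewrite -Rint_sum; last by move=> i; exact: L2_mul.
by apply: Rint_eq => x; rewrite mulr_sumr.
Qed.

Lemma sqnormB f g : L2 f -> L2 g ->
  sqnorm (fun x => f x - g x) = sqnorm f - 2 * L2_inner f g + sqnorm g.
Proof.
move=> Lf Lg; rewrite -!innerff innerBl//; last exact: L2B.
by rewrite !innerBr// (innerC g f); ring.
Qed.

Lemma sqnormZ c f : L2 f -> sqnorm (fun x => c * f x) = c ^+ 2 * sqnorm f.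
Proof.
move=> Lf; rewrite /sqnorm -RintegralZl//; last exact: L2_rint.
by apply: Rint_eq => x; rewrite exprMn.
Qed.

Lemma cauchy_schwarz f g : L2 f -> L2 g -> L2_inner f g ^+ 2 <= sqnorm f * sqnorm g.
Proof.
move=> Lf Lg.
have q t : 0 <= sqnorm f - 2 * (t * L2_inner f g) + t ^+ 2 * sqnorm g.
  have := sqnorm_ge0 (fun x => f x - t * g x).
  rewrite sqnormB//; last exact: L2Z.
  by rewrite innerZr// sqnormZ.
have g0 := sqnorm_ge0 g; have f0 := sqnorm_ge0 f.
have [e|n0] := eqVneq (sqnorm g) 0.
  have [->|i0] := eqVneq (L2_inner f g) 0; first by rewrite expr0n mulr_ge0.
  have := q ((sqnorm f + 1) / (2 * L2_inner f g)); rewrite e mulr0 addr0.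
  rewrite (_ : 2 * _ = sqnorm f + 1); first lra.
  by field.
have gp : 0 < sqnorm g by rewrite lt0r n0.
have := q (L2_inner f g / sqnorm g).
rewrite (_ : _ + _ = sqnorm f - L2_inner f g ^+ 2 / sqnorm g); last by field.
by rewrite subr_ge0 ler_pdivrMr.
Qed.

(** Replaces the completeness of L2: the limits below are pointwise limits in
    the first place, and Fatou's lemma shows that they are square integrable. *)
Lemma sqnorm_fatou (f_ : nat -> R -> R) f (M : R) :
  (forall n, L2 (f_ n)) -> (forall x, (fun n => f_ n x) @ \oo --> f x) ->
  (forall n, sqnorm (f_ n) <= M) -> L2 f /\ sqnorm f <= M.
Proof.
move=> Lf cf fM.
have mf : measurable_fun setT f.
  apply: (measurable_fun_cvg (h := f_)) => [n|x _]; [exact: L2_meas|exact: cf].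
have le : (\int[mu]_x (f x ^+ 2)%:E <= M%:E)%E.
  have := @fatou _ _ R mu setT measurableT (fun n x => (f_ n x ^+ 2)%:E).
  have -> : (fun x => limn_einf ((fun n x0 => (f_ n x0 ^+ 2)%:E) ^~ x)) =
            (fun x => (f x ^+ 2)%:E).
    apply/funext => x.
    have c : (fun n => (f_ n x ^+ 2)%:E) @ \oo --> (f x ^+ 2)%:E.
      by apply: cvg_EFin; [exact: nearW|apply: cvgM; exact: cf].
    by rewrite (cvg_limn_einf_sup c).1.
  move=> h; apply: le_trans (h _ _) _.
  - by move=> n; apply/measurable_EFinP; apply: measurable_funX; exact: L2_meas.
  - by move=> n x _; rewrite lee_fin sqr_ge0.
  rewrite limn_einf_lim; apply: lime_le; first exact: is_cvg_einfs.
  apply: nearW => n; apply: (@le_trans _ _ (\int[mu]_x (f_ n x ^+ 2)%:E)%E).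
    by apply: ereal_inf_lbound; exists n => //=.
  by rewrite (rint_fin (L2_rint (Lf n))) lee_fin; exact: fM.
have [i1 i2] := ge0_rint (mu := mu) (measurable_funX 2 mf) (fun x => sqr_ge0 (f x)) le.
by split=> //; apply/L2P.
Qed.

Lemma rint_indic (A : set R) (M : R) : measurable A -> mu A = M%:E ->
  rint mu (\1_A : R -> R) /\ (\int[mu]_x \1_A x)%R = M.
Proof.
move=> mA muA.
have e : (\int[mu]_x (\1_A x)%:E = M%:E)%E by rewrite integral_indic// setIT.
have le : (\int[mu]_x (\1_A x)%:E <= M%:E)%E by rewrite e.
have m : measurable_fun setT (\1_A : R -> R) by exact: measurable_indic.
have g0 x : 0 <= (\1_A x : R) by rewrite indicE.
have [i _] := ge0_rint (mu := mu) m g0 le.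
by split=> //; rewrite /Rintegral e.
Qed.

(** Turns equality almost everywhere into equality everywhere: a continuous
    function is bounded away from 0 near any point where it does not vanish. *)
Lemma continuous_sqnorm0 f : continuous f -> L2 f -> sqnorm f = 0 -> forall x, f x = 0.
Proof.
move=> cf Lf f0 x; apply/eqP; apply: contrapT => /negP fx.
have fx0 : 0 < `|f x| / 2 by rewrite divr_gt0// normr_gt0.
have /cvgrPdist_lt/(_ _ fx0)/nbhs_ballP[r /= r0 hr] := cf x.
pose I := ball x r : set R.
have [I1 I2] := rint_indic (measurable_ball x r) (lebesgue_measure_ball x (ltW r0)).
have Ii := rintZ ((`|f x| / 2) ^+ 2) I1.
have : (\int[mu]_y ((`|f x| / 2) ^+ 2 * \1_I y))%R <= sqnorm f.
  apply: Rint_le => //; first exact: L2_rint.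
  move=> y; rewrite indicE; case: (boolP (y \in I)) => [|_]; last first.
    by rewrite mulr0 sqr_ge0.
  rewrite inE => yI; rewrite mulr1 -(real_normK (num_real (f y))).
  apply: lerXn2r; rewrite ?nnegrE ?normr_ge0 ?(ltW fx0)//.
  have := hr y yI; rewrite /= => h1; have := ler_normD (f x - f y) (f y).
  rewrite subrK => h2; lra.
rewrite f0 RintegralZl// I2 leNgt => /negP; apply.
by rewrite mulr_gt0// ?exprn_gt0// mulrn_wgt0.
Qed.

End square_integrable.

(** * Projections given by orthonormal bases *)

Section orthogonal_projection.
Context (R : realType).
Local Notation mu := (@lebesgue_measure R).
Variables (V : set (R -> R)) (e : int -> R -> R).
Hypotheses (Vcl : closed_subspace V) (Ve : orthonormal_basis V e).

Lemma subspace_L2 f : V f -> L2 f. Proof. by case: Vcl => + _ _ _; apply. Qed.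

Lemma basis_L2 k : L2 (e k).
Proof. by apply: subspace_L2; case: Ve => + _ _; apply. Qed.

Lemma subspace_lin (c : R) f g : V f -> V g -> V (fun x => c * f x + g x).
Proof. by case: Vcl => _ _ + _; apply. Qed.

Lemma subspaceB f g : V f -> V g -> V (fun x => f x - g x).
Proof.
move=> Vf Vg; have := subspace_lin (-1) Vg Vf.
by under eq_fun do rewrite mulN1r addrC.
Qed.

Lemma subspace_sum (s : seq int) (c : int -> R) : V (fun x => \sum_(k <- s) c k * e k x).
Proof.
elim: s => [|k s IH].
  by under eq_fun do rewrite big_nil; case: Vcl.
under eq_fun do rewrite big_cons; apply: subspace_lin => //.
by case: Ve => + _ _; apply.
Qed.

Lemma subspace_closed f : L2 f ->
  (forall eps, 0 < eps -> exists2 g, V g & sqnorm (fun x => f x - g x) < eps) -> V f.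
Proof.
move=> Lf fV; case: Vcl => _ _ _; apply => // r r0.
have [g Vg gle] := fV (r ^+ 2) (exprn_gt0 2 r0); exists g => //.
by rewrite L2_norm_lt//; apply: L2B => //; exact: subspace_L2.
Qed.

Lemma basis_approx f (eps : R) : V f -> 0 < eps -> exists (s : seq int) (c : int -> R),
  sqnorm (fun x => f x - \sum_(k <- s) c k * e k x) < eps.
Proof.
move=> Vf eps0; case: Ve => _ _ /(_ f Vf (Num.sqrt eps)).
rewrite sqrtr_gt0 => /(_ eps0)[s [c h]]; exists s, c.
rewrite L2_norm_lt ?sqrtr_gt0// in h; first by rewrite sqr_sqrtr// ltW in h.
apply: L2B; first exact: subspace_L2.
by apply: L2_sum => k; apply: L2Z; exact: basis_L2.
Qed.

Lemma inner_basis k l : L2_inner (e k) (e l) = (k == l)%:R.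
Proof. by case: Ve => _ + _; apply. Qed.

Lemma L2_comb (s : seq int) (c : int -> R) : L2 (fun x => \sum_(k <- s) c k * e k x).
Proof. exact/subspace_L2/subspace_sum. Qed.

Lemma inner_comb (s : seq int) (c : int -> R) l : uniq s ->
  L2_inner (e l) (fun x => \sum_(k <- s) c k * e k x) = if l \in s then c l else 0.
Proof.
move=> us; rewrite inner_sumr; [|exact: basis_L2|by move=> k; apply: L2Z; exact: basis_L2].
have -> : \sum_(i <- s) L2_inner (e l) (fun x => c i * e i x) =
    \sum_(i <- s | i == l) c i.
  rewrite [RHS]big_mkcond; apply: eq_bigr => i _.
  rewrite innerZr; [|exact: basis_L2|exact: basis_L2].
  by rewrite inner_basis eq_sym; case: eqP; rewrite (mulr1, mulr0).
rewrite -big_filter; case: ifPn => ls.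
  by rewrite filter_pred1_uniq// big_seq1.
rewrite (_ : [seq i <- s | i == l] = [::]) ?big_nil//.
by apply/eqP; rewrite -size_eq0 size_filter -[_ == _]negbK -lt0n -has_count has_pred1.
Qed.

Lemma sqnorm_comb (s : seq int) (c : int -> R) : uniq s ->
  sqnorm (fun x => \sum_(k <- s) c k * e k x) = \sum_(k <- s) c k ^+ 2.
Proof.
move=> us; rewrite -innerff inner_sumr; [|exact: L2_comb|by move=> k; apply: L2Z; exact: basis_L2].
apply: eq_big_seq => k ks; rewrite innerZr; [|exact: L2_comb|exact: basis_L2].
by rewrite innerC inner_comb// ks expr2.
Qed.

Lemma bessel_le f (s : seq int) : L2 f -> uniq s ->
  \sum_(k <- s) L2_inner f (e k) ^+ 2 <= sqnorm f.
Proof.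
move=> Lf us; set c := fun k => L2_inner f (e k).
have := sqnorm_ge0 (fun x => f x - \sum_(k <- s) c k * e k x).
rewrite sqnormB//; last exact: L2_comb.
rewrite sqnorm_comb// inner_sumr//; last by move=> k; apply: L2Z; exact: basis_L2.
have -> : \sum_(i <- s) L2_inner f (fun x => c i * e i x) = \sum_(i <- s) c i ^+ 2.
  by apply: eq_bigr => i _; rewrite innerZr//; exact: basis_L2.
rewrite -/c; lra.
Qed.

Variable Phi : R.
Hypothesis ePhi : forall x K, zpart (fun k => `|e k x|) K <= Phi.

(** A pointwise sum rather than a class in L2: the expansion of a function is
    needed at every point. *)
Definition proj (v : R -> R) (x : R) : R := zsum (fun k => L2_inner v (e k) * e k x).

Let S v K x := zpart (fun k => L2_inner v (e k) * e k x) K.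

Lemma coef_le v k : L2 v -> `|L2_inner v (e k)| <= sqnorm v + 1.
Proof.
move=> Lv; have := cauchy_schwarz Lv (basis_L2 k).
rewrite -(innerff (e k)) inner_basis eqxx mulr1 => h.
have v0 := sqnorm_ge0 v.
rewrite -(@ler_pXn2r _ 2)// ?nnegrE ?addr_ge0// real_normK ?num_real//.
by apply: le_trans h _; rewrite expr2; nra.
Qed.

Lemma proj_cvg v x : L2 v -> (fun K => S v K x) @ \oo --> proj v x.
Proof.
move=> Lv; apply: (@zpart_cvg _ _ (fun k => (sqnorm v + 1) * `|e k x|) ((sqnorm v + 1) * Phi)).
  by move=> k; rewrite normrM ler_wpM2r// coef_le.
by move=> K; rewrite zpartZ ler_wpM2l// addr_ge0// sqnorm_ge0.
Qed.

Lemma S_comb v K : S v K = (fun x => \sum_(k <- zwindow K) L2_inner v (e k) * e k x).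
Proof. by apply/funext => x; rewrite /S zpartE. Qed.

(** Partial sums converge both pointwise and, by Bessel's inequality, in mean
    square; Fatou's lemma identifies the two limits. *)
Lemma proj_L2cvg v : L2 v ->
  exists2 tau : nat -> R, tau @ \oo --> (0 : R) &
    forall K, L2 (fun x => proj v x - S v K x) /\
      sqnorm (fun x => proj v x - S v K x) <= tau K.
Proof.
move=> Lv; pose c2 k := L2_inner v (e k) ^+ 2.
have c20 k : 0 <= c2 k by exact: sqr_ge0.
have c2M K : zpart c2 K <= sqnorm v.
  by rewrite zpartE; apply: bessel_le => //; exact: uniq_zwindow.
exists (ztail c2); first exact: ztail_cvg c2M.
move=> K; pose f_ m (x : R) := S v (m + K) x - S v K x.
have fE m : exists2 r, uniq r /\ \sum_(k <- r) c2 k = zpart c2 (K + m) - zpart c2 K &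
    f_ m = (fun x => \sum_(k <- r) L2_inner v (e k) * e k x).
  have [r Er] := zwindow_split K m; exists r.
    split; first by have := uniq_zwindow (K + m); rewrite Er cat_uniq => /andP[].
    by rewrite !zpartE Er big_cat/= addrK.
  apply/funext => x; rewrite /f_ addnC !S_comb Er big_cat/=.
  by rewrite addrK.
apply: (@sqnorm_fatou _ f_) => [m|x|m].
- by have [r _ ->] := fE m; exact: L2_comb.
- apply: cvgB; last exact: cvg_cst.
  by have := @proj_cvg v x Lv; rewrite -(cvg_shiftn K).
- have [r [ur rE] ->] := fE m; rewrite sqnorm_comb// -/c2 rE.
  apply: le_trans (ler_norm _) _.
  by apply: zpart_tail c2M => k; rewrite ger0_norm.
Qed.

Lemma proj_subspace v : L2 v -> V (proj v).
Proof.
move=> Lv; have [tau tau0 H] := proj_L2cvg Lv.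
have VS K : V (S v K) by rewrite S_comb; exact: subspace_sum.
apply: subspace_closed => [|eps eps0].
  have := L2D (H 0%N).1 (subspace_L2 (VS 0%N)).
  by under eq_fun do rewrite subrK.
have /cvgrPdist_lt/(_ _ eps0)[K _ HK] := tau0.
exists (S v K) => //; apply: le_lt_trans (H K).2 _.
by have := HK K (leqnn K); rewrite /= sub0r normrN; exact: le_lt_trans (ler_norm _).
Qed.

(** Continuity of the inner product, used to pass from finite combinations of
    basis functions to their closure. *)
Lemma inner_small (f g : R -> R) : L2 f -> L2 g ->
  (forall eps : R, 0 < eps -> exists2 h : R -> R, L2 h /\ L2_inner f h = 0 &
     sqnorm (fun x => g x - h x) < eps) -> L2_inner f g = 0.
Proof.
move=> Lf Lg H; apply/eqP; apply: contrapT => /negP i0.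
have f0 := sqnorm_ge0 f.
have i2 : 0 < L2_inner f g ^+ 2 by rewrite exprn_even_gt0.
have [h [Lh fh] hlt] := H _ (divr_gt0 i2 (ltr_pwDr ltr01 f0)).
have := cauchy_schwarz Lf (L2B Lg Lh); rewrite innerBr// fh subr0 => le1.
have := sqnorm_ge0 (fun x => g x - h x).
move: hlt; rewrite ltr_pdivlMr ?ltr_pwDr//; nra.
Qed.

Lemma proj_orth v u : L2 v -> V u -> L2_inner (fun x => v x - proj v x) u = 0.
Proof.
move=> Lv Vu; have [tau tau0 H] := proj_L2cvg Lv.
have Lp := subspace_L2 (proj_subspace Lv).
have LS K : L2 (S v K) by rewrite S_comb; exact: L2_comb.
have Lvp := L2B Lv Lp.
have ek k : L2_inner (fun x => v x - proj v x) (e k) = 0.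
  rewrite innerC; apply: inner_small => // [|eps eps0]; first exact: basis_L2.
  have /cvgrPdist_lt/(_ _ eps0)[K0 _ HK] := tau0.
  pose K := maxn K0 `|k|.+1%N.
  exists (fun x => v x - S v K x).
    split; first exact: L2B.
    rewrite innerBr//; last exact: basis_L2.
    rewrite S_comb inner_comb ?uniq_zwindow// mem_zwindow innerC ifT ?subrr//.
    by rewrite /K; lia.
  have -> : (fun x => v x - proj v x - (v x - S v K x)) =
      (fun x => - 1 * (proj v x - S v K x)) by apply/funext => x; ring.
  rewrite sqnormZ; last exact: (H K).1.
  rewrite sqrrN expr1n mul1r; apply: le_lt_trans (H K).2 _.
  have := HK K (leq_maxl _ _).
  by rewrite /= sub0r normrN; exact: le_lt_trans (ler_norm _).
apply: inner_small => //; first exact: subspace_L2.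
move=> eps eps0; have [s [c h]] := basis_approx Vu eps0.
exists (fun x => \sum_(k <- s) c k * e k x) => //; split; first exact: L2_comb.
rewrite inner_sumr//; last by move=> k; apply: L2Z; exact: basis_L2.
by apply: big1 => k _; rewrite innerZr// ?ek ?mulr0//; exact: basis_L2.
Qed.

Lemma proj_id v : V v -> sqnorm (fun x => v x - proj v x) = 0.
Proof.
move=> Vv; have Lv := subspace_L2 Vv.
by rewrite -innerff proj_orth//; apply: subspaceB => //; exact: proj_subspace.
Qed.

End orthogonal_projection.

(** * Multiresolution analyses *)

Section dilations.
Context (R : realType).
Local Notation mu := (@lebesgue_measure R).
Implicit Types f g : R -> R.

Lemma rint_dilate (c : R) f : 0 < c -> rint mu f ->
  rint mu (fun x => f (c * x)) /\
  (\int[mu]_x f (c * x))%R = c^-1 * (\int[mu]_x f x)%R.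
Proof.
move=> c0 fi; have := rint_affine 0 c0 fi.
by under eq_fun do rewrite addr0.
Qed.

Lemma L2_dilate (c : R) f : 0 < c -> L2 f -> L2 (fun x => f (c * x)).
Proof.
move=> c0 Lf; apply/L2P; split; last exact: (rint_dilate c0 (L2_rint Lf)).1.
have := measurable_affine c 0 (L2_meas Lf).
by under eq_fun do rewrite addr0.
Qed.

Lemma sqnorm_dilate (c : R) f : 0 < c -> L2 f ->
  sqnorm (fun x => f (c * x)) = c^-1 * sqnorm f.
Proof. by move=> c0 Lf; exact: (rint_dilate c0 (L2_rint Lf)).2. Qed.

Lemma inner_dilate (c : R) f g : 0 < c -> L2 f -> L2 g ->
  L2_inner (fun x => f (c * x)) (fun x => g (c * x)) = c^-1 * L2_inner f g.
Proof. by move=> c0 Lf Lg; exact: (rint_dilate c0 (L2_mul Lf Lg)).2. Qed.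

End dilations.

Section multiresolution.
Context (R : realType).
Local Notation mu := (@lebesgue_measure R).
Variables (V : int -> set (R -> R)) (phi psi : R -> R) (Phi : R).
Hypotheses (Vphi : is_mra V phi)
  (Vpsi : orthonormal_basis (wavelet_space V) (translate psi))
  (phiPhi : forall x K, zpart (fun k => `|translate phi k x|) K <= Phi).

Let Vcl j : closed_subspace (V j). Proof. by case: Vphi => + _ _ _ _; apply. Qed.

Let Vbasis : orthonormal_basis (V 0) (translate phi).
Proof. by case: Vphi. Qed.

Lemma mra_nested j (n : nat) f : V j f -> V (j + n%:Z) f.
Proof.
move=> Vf; elim: n => [|n IH]; first by rewrite addr0.
have -> : j + n.+1%:Z = (j + n%:Z) + 1 by lia.
by case: Vphi => _ [+ _] _ _ _; apply.
Qed.

Lemma mra_dilate j f : V j f <-> V (j + 1) (fun x => f (2 * x)).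
Proof. by case: Vphi => _ [_ +] _ _ _; apply. Qed.

Let psi_L2 k : L2 (translate psi k).
Proof.
by case: Vpsi => + _ _ => /(_ k)[/= V1 _]; exact: (subspace_L2 (Vcl 1)).
Qed.

(** What [v] loses by projection onto [V 0] lies in the wavelet space, hence is
    orthogonal to [g]: by Pythagoras the projection is not farther from [g]. *)
Lemma wavelet_step g v : L2 g -> (forall k, L2_inner g (translate psi k) = 0) ->
  V 1 v -> exists2 v0, V 0 v0 &
  sqnorm (fun x => g x - v0 x) <= sqnorm (fun x => g x - v x).
Proof.
move=> Lg gpsi V1; pose v0 := proj (translate phi) v.
have Lv := subspace_L2 (Vcl 1) V1.
have V0 : V 0 v0 := proj_subspace (Vcl 0) Vbasis phiPhi Lv.
have L0 := subspace_L2 (Vcl 0) V0.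
exists v0 => //; pose w x := v x - v0 x.
have Lw : L2 w := L2B Lv L0.
have worth u : V 0 u -> L2_inner w u = 0.
  by move=> Vu; exact: (proj_orth (Vcl 0) Vbasis phiPhi Lv Vu).
have Ww : wavelet_space V w.
  split => //; apply: (subspaceB (Vcl 1) V1).
  by have := mra_nested 1 V0; rewrite add0r.
have gw : L2_inner g w = 0.
  apply: inner_small => // eps eps0.
  case: Vpsi => _ _ /(_ w Ww (Num.sqrt eps)); rewrite sqrtr_gt0 => /(_ eps0)[s [c h]].
  have Lc : L2 (fun x => \sum_(k <- s) c k * translate psi k x).
    by apply: L2_sum => k; exact: L2Z.
  exists (fun x => \sum_(k <- s) c k * translate psi k x).
    split=> //; rewrite inner_sumr//; last by move=> k; exact: L2Z.
    by apply: big1 => k _; rewrite innerZr// gpsi mulr0.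
  rewrite L2_norm_lt ?sqrtr_gt0// in h; first by rewrite sqr_sqrtr// ltW in h.
  exact: L2B.
have -> : (fun x => g x - v x) = (fun x => (g x - v0 x) - w x).
  by apply/funext => x; rewrite /w; ring.
rewrite [leRHS]sqnormB//; last exact: L2B.
rewrite innerBl// gw (innerC v0) worth// subrr mulr0 subr0.
by rewrite lerDl sqnorm_ge0.
Qed.

(** A dilation by 2 brings level [l + 1] to level [l]; the last level is removed
    by [wavelet_step]. *)
Lemma wavelet_descent (l : nat) g v : L2 g ->
  (forall (i : nat) k, L2_inner g (fun x => psi (2 ^+ i * x - k%:~R)) = 0) ->
  V l%:Z v -> exists2 v0, V 0 v0 &
  sqnorm (fun x => g x - v0 x) <= sqnorm (fun x => g x - v x).
Proof.
elim: l g v => [|l IH] g v Lg gpsi Vv; first by exists v.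
have h0 : 0 < 2^-1 :> R by rewrite invr_gt0.
have t0 : 0 < 2 :> R by [].
pose g' (x : R) := g (2^-1 * x); pose v' (x : R) := v (2^-1 * x).
have Lv := subspace_L2 (Vcl l.+1%:Z) Vv.
have Lg' : L2 g' := L2_dilate h0 Lg.
have K f : (fun x : R => f (2^-1 * (2 * x))) = f :> (R -> R).
  by apply/funext => x; rewrite mulKf.
have Vv' : V l%:Z v'.
  apply/mra_dilate; rewrite /v' K (_ : l%:Z + 1 = l.+1%:Z)//; lia.
have gpsi' i k : L2_inner g' (fun x => psi (2 ^+ i * x - k%:~R)) = 0.
  have Lpsi : L2 (fun x => psi (2 ^+ i.+1 * x - k%:~R)).
    have := L2_dilate (exprn_gt0 i.+1 t0) (psi_L2 k).
    by [].
  have := inner_dilate h0 Lg Lpsi; rewrite gpsi mulr0 => e.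
  rewrite -[RHS]e; apply: Rint_eq => x; congr (_ * psi _).
  by rewrite exprS; field.
have [v0' V0' le'] := IH g' v' Lg' gpsi' Vv'.
have L0' := subspace_L2 (Vcl 0) V0'.
have V1 : V 1 (fun x => v0' (2 * x)) by have /mra_dilate := V0'; rewrite add0r.
have gpsi0 k : L2_inner g (translate psi k) = 0.
  by rewrite -[RHS](gpsi 0%N k); apply: Rint_eq => x; rewrite expr0 mul1r.
have [v0 V0 le0] := wavelet_step Lg gpsi0 V1.
exists v0 => //; apply: le_trans le0 _.
have := sqnorm_dilate t0 (L2B Lg' L0').
have := sqnorm_dilate h0 (L2B Lg Lv).
rewrite -[X in sqnorm X = _ -> _]/(fun x => g' x - v' x) => e1.
have -> : (fun x : R => g' (2 * x) - v0' (2 * x)) = (fun x => g x - v0' (2 * x)).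
  by apply/funext => x; rewrite /g' mulKf.
move=> ->; rewrite -(ler_pM2l t0) mulVKf//.
by apply: le_trans le' _; rewrite e1 invrK.
Qed.

Hypothesis phi_cont : continuous phi.

Let phi_le x : `|phi x| <= Phi.
Proof.
have := @zpart_term _ (fun k => `|translate phi k x|) Phi 0 (fun k => normr_ge0 _) (phiPhi x).
by rewrite /translate subr0.
Qed.

Lemma zpart_coef_le g : L2 g -> rint mu g -> forall K,
  zpart (fun k => `|L2_inner g (translate phi k)|) K <= Phi * (\int[mu]_x `|g x|)%R.
Proof.
move=> Lg ig K; have Lk := basis_L2 (Vcl 0) Vbasis.
rewrite zpartE; apply: (@le_trans _ _ (\sum_(k <- zwindow K)
    (\int[mu]_x `|g x * translate phi k x|)%R)).
  apply: ler_sum => k _; apply: le_normr_Rintegral => //; exact: L2_mul.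
rewrite -Rint_sum; last by move=> k; apply: rint_norm; exact: L2_mul.
rewrite -RintegralZl//; last exact: rint_norm.
apply: Rint_le => [||x].
- by apply: rint_sum => k; apply: rint_norm; exact: L2_mul.
- by apply: rintZ; exact: rint_norm.
- under eq_bigr do rewrite normrM; rewrite -mulr_sumr mulrC ler_wpM2r//.
  by have := phiPhi x K; rewrite zpartE.
Qed.

(** The coefficients of an integrable function are absolutely summable, so that
    its expansion converges uniformly. *)
Lemma continuous_proj g : L2 g -> rint mu g -> continuous (proj (translate phi) g).
Proof.
move=> Lg ig x; have P0 : 0 <= Phi by exact: le_trans (normr_ge0 _) (phi_le 0).
set c := fun k => L2_inner g (translate phi k).
pose v k := Phi * `|c k|.
have vM K : zpart v K <= Phi * (Phi * (\int[mu]_x `|g x|)%R).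
  by rewrite zpartZ ler_wpM2l// zpart_coef_le.
have v0 k : 0 <= v k by rewrite mulr_ge0.
have cv y k : `|c k * translate phi k y| <= v k.
  by rewrite normrM mulrC ler_wpM2r// phi_le.
apply/cvgrPdist_le => e e0; have e3 : 0 < e / 3 by rewrite divr_gt0.
have [K tK] : exists K, ztail v K <= e / 3.
  have /cvgrPdist_le/(_ _ e3)[K _ HK] := ztail_cvg v0 vM.
  by exists K; have := HK K (leqnn K); rewrite /= sub0r normrN; exact: le_trans (ler_norm _).
have cS : (fun y => zpart (fun k => c k * translate phi k y) K) @ x -->
    zpart (fun k => c k * translate phi k x) K.
  rewrite zpartE; under eq_fun do rewrite zpartE.
  apply: cvg_sumr => k; apply: cvgMr; rewrite /translate.
  apply: (cvg_comp (fun y => y - k%:~R) phi); last exact: phi_cont.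
  by apply: cvgB; [exact: cvg_id|exact: cvg_cst].
move/cvgrPdist_le : cS => /(_ _ e3); apply: filterS => y hy.
have h1 := zsum_tail K (cv x) vM; have h2 := zsum_tail K (cv y) vM.
rewrite /proj -/c.
set A := zsum _ in h1 *; set B := zsum _ in h2 *.
set A' := zpart _ _ in h1 hy *; set B' := zpart _ _ in h2 hy *.
have -> : A - B = (A - A') + (A' - B') - (B - B') by ring.
apply: le_trans (ler_normB _ _) _; apply: le_trans (lerD (ler_normD _ _) h2) _.
by move: h1 hy tK; lra.
Qed.

(** The spaces [V l] are dense, and [wavelet_descent] carries an approximation
    in any of them down to [V 0]: hence [g] lies in [V 0]. There it is almost
    everywhere equal to its projection, and everywhere because both are
    continuous. *)
Lemma mra_reproduce g : L2 g -> rint mu g -> continuous g ->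
  (forall (i : nat) k, L2_inner g (fun x => psi (2 ^+ i * x - k%:~R)) = 0) ->
  forall x, g x = zsum (fun k => L2_inner g (translate phi k) * translate phi k x).
Proof.
move=> Lg ig cg gpsi.
have Vg : V 0 g.
  apply: (subspace_closed (Vcl 0)) => // eps eps0.
  case: Vphi => _ _ _ /(_ g Lg (Num.sqrt eps)); rewrite sqrtr_gt0.
  move=> /(_ eps0)[j [v Vv vle]] _.
  rewrite L2_norm_lt ?sqrtr_gt0// in vle; last first.
    by apply: L2B => //; exact: (subspace_L2 (Vcl j)).
  rewrite sqr_sqrtr ?ltW// in vle.
  have [n nE] : exists n : nat, j + n%:Z = `|j|%N%:Z.
    by exists (absz (`|j|%N%:Z - j)); lia.
  have Vl : V `|j|%N%:Z v by rewrite -nE; exact: mra_nested.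
  have [v0 V0 le0] := wavelet_descent Lg gpsi Vl.
  by exists v0 => //; exact: le_lt_trans le0 vle.
move=> x; apply/eqP; rewrite -subr_eq0; apply/eqP.
have cp := continuous_proj Lg ig.
have Lp : L2 (proj (translate phi) g).
  apply: (subspace_L2 (Vcl 0)); exact: (proj_subspace (Vcl 0) Vbasis phiPhi Lg).
apply: (@continuous_sqnorm0 _ (fun x => g x - proj (translate phi) g x)).
- by move=> y; apply: cvgB; [exact: cg|exact: cp].
- exact: L2B.
- exact: (proj_id (Vcl 0) Vbasis phiPhi Vg).
Qed.

End multiresolution.

(** * Reproduction of exponentials of low frequency *)

Section reproduction_of_exponentials.
Context (R : realType).
Local Notation mu := (@lebesgue_measure R).

Lemma fourier_supportP (h : R -> R) (S : set R) t :
  fourier_support h `<=` S -> ~ S t -> fourier h t = 0.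
Proof.
move=> hS nS; apply/eqP; apply: contrapT => /negP ht; apply/nS/hS.
exact: subset_closure.
Qed.

Lemma fourier_le_indic (h : R -> R) (a t : R) : rint mu h ->
  fourier_support h `<=` `[- a, a]%classic ->
  normc (fourier h t) <= (\int[mu]_x `|h x|)%R * \1_`[- a, a] t.
Proof.
move=> hi hS; rewrite indicE; case: (boolP (t \in _)) => [_|].
  by rewrite mulr1 fourier_le.
by rewrite notin_setE => nt; rewrite (fourier_supportP hS nt) normc0 mulr0.
Qed.

Lemma rint_indic_itv (a b : R) : a <= b ->
  rint mu (\1_`[a, b]%classic : R -> R) /\ (\int[mu]_x \1_`[a, b]%classic x)%R = b - a.
Proof.
move=> ab; apply: rint_indic => //; rewrite lebesgue_measure_itv/= lte_fin.
case: ltP => // ba; rewrite (_ : a = b) ?subrr//; apply/eqP; rewrite eq_le ab.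
exact: ba.
Qed.

Lemma band_limited_rint (h : R -> R) (a : R) : 0 < a -> rint mu h ->
  fourier_support h `<=` `[- a, a]%classic -> rint mu (fun t => normc (fourier h t)).
Proof.
move=> a0 hi hS.
have aa : - a <= a by rewrite ge0_cp// ltW.
apply: (rint_le _ (rintZ (\int[mu]_x `|h x|)%R (rint_indic_itv aa).1)) => [|t].
  by apply: cmeas_normc; exact: cmeas_fourier.
by rewrite ger0_norm ?normc_ge0// fourier_le_indic.
Qed.

Lemma zsumZ (c : R) (u v : int -> R) (M : R) : (forall k, `|u k| <= v k) ->
  (forall K, zpart v K <= M) -> zsum (fun k => c * u k) = c * zsum u.
Proof.
move=> uv vM; apply: cvg_lim => //.
have -> : (fun N : nat => \sum_(i < N) (c * u i%:Z + c * u (- i.+1%:Z))) =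
   (fun K => c * zpart u K) by apply/funext => K; rewrite -zpartZ.
by apply: cvgMr; exact: zpart_cvg vM.
Qed.

Variables (phi psi : R -> R) (a' a Phi : R).
Hypotheses (pair : scaling_wavelet_pair phi psi) (cphi : continuous phi)
  (iphi : rint mu phi) (ipsi : rint mu psi)
  (a'0 : 0 < a') (a'a : a' < a)
  (Sphi : fourier_support phi `<=` `[- a, a]%classic)
  (Spsi : fourier_support psi `<=` (`[- a, a] `\` `[- a', a'])%classic)
  (phiPhi : forall x K, zpart (fun k => `|translate phi k x|) K <= Phi).

Lemma phi_bounded x : `|phi x| <= Phi.
Proof.
have := @zpart_term _ (fun k => `|translate phi k x|) Phi 0 (fun k => normr_ge0 _) (phiPhi x).
by rewrite /translate subr0.
Qed.

Let phi_L2 : L2 phi.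
Proof.
have [V [Vcl _ _ _ Vb] _] := pair.
by have := basis_L2 (Vcl 0) Vb 0; rewrite /translate; under eq_fun do rewrite subr0.
Qed.

Let a0 : 0 < a. Proof. exact: lt_trans a'0 a'a. Qed.

Let fphi_rint : rint mu (fun t => normc (fourier phi t)).
Proof. exact: band_limited_rint Sphi. Qed.

Lemma phi_nonzero : exists x0, phi x0 != 0.
Proof.
apply: contrapT => H.
have p0 x : phi x = 0 by apply/eqP; apply: contrapT => /negP h; apply: H; exists x.
have [V [_ _ _ _ [_ on _]] _] := pair.
have /eqP := on 0 0; rewrite eqxx /L2_inner.
under Rint_eq do rewrite /translate p0 mul0r.
by rewrite Rintegral_cst// mul0r eq_sym oner_eq0.
Qed.

Lemma translate_rint (h : R -> R) k : rint mu h ->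
  rint mu (translate h k) /\
  (\int[mu]_x `|translate h k x|)%R = (\int[mu]_x `|h x|)%R.
Proof.
move=> hi; split.
  have := (rint_affine (- k%:~R) ltr01 hi).1.
  by under eq_fun do rewrite mul1r.
have := (rint_affine (- k%:~R) ltr01 (rint_norm hi)).2.
by rewrite invr1 mul1r; under eq_fun do rewrite mul1r.
Qed.

(** The spectrum of the modulated dilate lies within [b * a] of a frequency of
    modulus [|tau|], hence in [-a', a'], where the transforms of the wavelets of
    nonnegative scale vanish. The passage to transforms is Fubini's theorem,
    after [phi] has been written by the inversion formula. *)
Lemma modulated_orthogonal (b x0 tau : R) (i : nat) (k : int) :
  0 < b -> b * a + `|tau| <= a' ->
  cintegral mu (fun x => (phi (b * x + x0) * psi (2 ^+ i * x - k%:~R))%:C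
    * expi (tau * x)) = 0.
Proof.
move=> b0 bt; set h := fun x => psi (2 ^+ i * x - k%:~R).
have p0 : 0 < 2 ^+ i :> R by rewrite exprn_gt0.
have hi : rint mu h := (rint_affine (- k%:~R) p0 ipsi).1.
have fh u : `|u| <= a' -> fourier h u = 0.
  move=> ua; rewrite /h (fourier_affine (- k%:~R) u p0 ipsi).
  rewrite (fourier_supportP Spsi) ?mulr0// => -[_ /=]; apply.
  rewrite in_itv/= -ler_norml normrM [X in _ * X]gtr0_norm ?invr_gt0//.
  rewrite ler_pdivrMr//; apply: le_trans ua _; apply: ler_peMr; first exact: ltW.
  by rewrite exprn_ege1// ler1n.
pose F (z : measurableTypeR R * measurableTypeR R) : R[i] :=
  (fourier phi z.2 * expi (z.2 * x0)) * ((h z.1)%:C * expi ((b * z.2 + tau) * z.1)).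
have mF : cmeas F.
  apply: cmeasM.
    apply: cmeasM; first by apply: cmeas_comp => //; exact: cmeas_fourier.
    by apply: cmeas_expi; exact: measurable_funM.
  apply: cmeasM; first by apply: cmeas_real; exact: (measurableT_comp (rint_meas hi)).
  apply: cmeas_expi; apply: measurable_funM => //; apply: measurable_funD => //.
  exact: measurable_funM.
have Fb x v : normc (F (x, v)) <= `|h x| * normc (fourier phi v).
  by rewrite !normcM normcR !normc_expi !mulr1 mulrC.
have := cintegral_fubini mF (rint_norm hi) fphi_rint Fb.
have -> : (fun v => cintegral mu (fun x => F (x, v))) = (fun=> 0).
  apply/funext => v; rewrite /F /=.
  have m1 : measurable_fun setT (fun x : R => (b * v + tau) * x) by exact: measurable_mul1.
  have [_ ->] := cintegralZ (fourier phi v * expi (v * x0)) (cintble_modulated hi m1).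
  have [va|va] := leP `|v| a; last first.
    rewrite (fourier_supportP Sphi) ?mul0r// /= in_itv/= -ler_norml.
    by apply/negP; rewrite -ltNge.
  have -> : cintegral mu (fun x => (h x)%:C * expi ((b * v + tau) * x)) =
      fourier h (- (b * v + tau)).
    by apply: eq_cintegral => x; rewrite mulNr opprK.
  rewrite fh ?mulr0// normrN; apply: le_trans (ler_normD _ _) _; apply: le_trans bt.
  by rewrite lerD2r normrM gtr0_norm//; apply: ler_wpM2l => //; exact: ltW.
rewrite (cintegral0 mu).2.
have -> : (fun x => cintegral mu (fun v => F (x, v))) =
    (fun x => (2 * pi)%:C * ((phi (b * x + x0) * h x)%:C * expi (tau * x))).
  apply/funext => x.
  have ci : cintble mu (fun v => fourier phi v * expi (v * (b * x + x0))).
    apply: (cintble_le _ fphi_rint) => [|v]; last by rewrite normcM normc_expi mulr1.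
    apply: cmeasM; first exact: cmeas_fourier.
    by apply: cmeas_expi; exact: measurable_funM.
  transitivity (((h x)%:C * expi (tau * x)) *
     cintegral mu (fun v => fourier phi v * expi (v * (b * x + x0)))).
    rewrite -(cintegralZ _ ci).2; apply: eq_cintegral => v; rewrite /F /=.
    rewrite (_ : (b * v + tau) * x = v * (b * x) + tau * x); last by ring.
    by rewrite mulrDr !expiD; ring.
  rewrite (fourier_inversion iphi fphi_rint); last exact: cphi.
  by rewrite !rmorphM/=; ring.
have gi : cintble mu (fun x => (phi (b * x + x0) * h x)%:C * expi (tau * x)).
  apply: (cintble_le _ (rintZ Phi (rint_norm hi))) => [|x].
    apply: cmeasM.
      apply: cmeas_real; apply: measurable_funM; last exact: rint_meas hi.
      exact: (measurable_affine b x0 (rint_meas iphi)).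
    by apply: cmeas_expi; exact: measurable_mul1.
  by rewrite normcM normcR normc_expi mulr1 normrM ler_wpM2r// phi_bounded.
rewrite (cintegralZ _ gi).2 => /eqP; rewrite mulf_eq0 => /orP[|/eqP //].
move=> /eqP/(congr1 (@complex.Re R))/= /eqP.
by rewrite mulf_eq0 (gt_eqF (pi_gt0 R)) orbF pnatr_eq0.
Qed.

Section part.
(* [T] is a cosine or a sine: the real and imaginary parts are treated alike. *)
Variables (tau : R) (T : R -> R).
Hypotheses (cT : continuous T) (T1 : forall x, `|T x| <= 1)
  (Torth : forall b x0 (i : nat) k, 0 < b -> b * a + `|tau| <= a' ->
    (\int[mu]_x (phi (b * x + x0) * psi (2 ^+ i * x - k%:~R) * T x))%R = 0)
  (taua : `|tau| < a').

Let mT : measurable_fun setT T. Proof. exact: continuous_measurable_fun. Qed.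

(** The slowly varying factor [phi (b n * x + x0)] makes [T] integrable and
    tends to the nonzero constant [phi x0]; [mra_reproduce] applies to the
    product, and domination gives the limit of the coefficients and of the
    sum. *)
Lemma reproduce_part z :
  zsum (fun k => (\int[mu]_x (translate phi k x * T x))%R * translate phi k z) = T z.
Proof.
have [x0 p0] := phi_nonzero.
have P0 : 0 <= Phi by exact: le_trans (normr_ge0 _) (phi_bounded 0).
pose rho := (a' - `|tau|) / a.
have rho0 : 0 < rho by rewrite divr_gt0// subr_gt0.
pose b (n : nat) := rho * n.+1%:R^-1.
have b0 n : 0 < b n by rewrite mulr_gt0.
have ba n : b n * a + `|tau| <= a'.
  rewrite -lerBrDr /b mulrAC /rho mulfVK ?gt_eqF//.
  apply: ler_piMr; first by rewrite subr_ge0 ltW.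
  by rewrite invf_le1// ler1n.
pose g n x := phi (b n * x + x0) * T x.
have mphi n : measurable_fun setT (fun x => phi (b n * x + x0)).
  exact: (measurable_affine (b n) x0 (rint_meas iphi)).
have gle n x : `|g n x| <= `|phi (b n * x + x0)|.
  by rewrite normrM ler_piMr.
have mg n : measurable_fun setT (g n) by exact: (measurable_funM (mphi n) mT).
have gi n : rint mu (g n).
  apply: (rint_le _ (rint_norm (rint_affine x0 (b0 n) iphi).1) (gle n)).
  exact: mg.
have gL n : L2 (g n).
  apply/L2P; split; first exact: mg.
  apply: (rint_le _ (rint_affine x0 (b0 n) (L2_rint phi_L2)).1) => [|x].
    by apply: measurable_funX; exact: mg.
  rewrite normrX -[leRHS](real_normK (num_real _)).
  by apply: lerXn2r; rewrite ?nnegrE.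
have gc n : continuous (g n).
  move=> x; apply: cvgM; last exact: cT.
  apply: (cvg_comp (fun x => b n * x + x0) phi); last exact: cphi.
  by apply: cvgD; [apply: cvgMr; exact: cvg_id|exact: cvg_cst].
have go n (i : nat) k : L2_inner (g n) (fun x => psi (2 ^+ i * x - k%:~R)) = 0.
  rewrite -[RHS](Torth x0 i k (b0 n) (ba n)); apply: Rint_eq => x.
  by rewrite /g mulrAC.
have [V mra wav] := pair.
have rep n : g n z = zsum (fun k => L2_inner (g n) (translate phi k) * translate phi k z).
  exact: (mra_reproduce mra wav phiPhi cphi (gL n) (gi n) (gc n) (go n) z).
have phik k := translate_rint k iphi.
have cb : b @ \oo --> (0 : R).
  by rewrite -(mulr0 rho); apply: cvgMr; exact: cvg_harmonic.
have cph x : (fun n => phi (b n * x + x0)) @ \oo --> phi x0.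
  have h : (fun n => b n * x + x0) @ \oo --> 0 * x + x0.
    by apply: cvgD; [apply: cvgMl; exact: cb|exact: cvg_cst].
  rewrite mul0r add0r in h.
  exact: (cvg_comp _ _ h (@cphi x0)).
pose I k := (\int[mu]_x (translate phi k x * T x))%R.
have inner_le (h : R -> R) k : measurable_fun setT h -> (forall x, `|h x| <= Phi) ->
    `|(\int[mu]_x (h x * translate phi k x))%R| <= Phi * (\int[mu]_x `|phi x|)%R.
  move=> mh hP; rewrite -(phik k).2 -RintegralZl//; last exact: rint_norm (phik k).1.
  apply: Rint_norm_le => [||x].
  - by apply: measurable_funM => //; exact: rint_meas (phik k).1.
  - exact/rintZ/rint_norm/(phik k).1.
  - by rewrite normrM ler_wpM2r.
have gP n x : `|g n x| <= Phi by apply: le_trans (gle n x) (phi_bounded _).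
have ci k : (fun n => L2_inner (g n) (translate phi k)) @ \oo --> phi x0 * I k.
  have := @Rint_dct _ _ _ mu (fun n x => g n x * translate phi k x)
    (fun x => phi x0 * (translate phi k x * T x)) (fun x => Phi * `|translate phi k x|).
  case.
  - by move=> n; apply: measurable_funM; [exact: mg|exact: rint_meas (phik k).1].
  - move=> x; rewrite (mulrC (translate phi k x)) mulrA.
    by apply: cvgMl; apply: cvgMl; exact: (cph x).
  - exact/rintZ/rint_norm/(phik k).1.
  - by move=> n x; rewrite normrM ler_wpM2r.
  move=> _; rewrite RintegralZl//.
  apply: (rint_le _ (rint_norm (phik k).1)) => [|x].
    by apply: measurable_funM => //; exact: rint_meas (phik k).1.
  by rewrite normrM ler_piMr.
pose M := Phi * (\int[mu]_x `|phi x|)%R.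
have M0 : 0 <= M by rewrite mulr_ge0// Rintegral_ge0.
have vM K : zpart (fun k => M * `|translate phi k z|) K <= M * Phi.
  by rewrite zpartZ ler_wpM2l.
have lim1 : (fun n => zsum (fun k => L2_inner (g n) (translate phi k) * translate phi k z))
    @ \oo --> zsum (fun k => phi x0 * I k * translate phi k z).
  apply: (zsum_tannery _ vM) => [n k|k].
    rewrite normrM ler_wpM2r//; apply: inner_le => //; exact: mg.
  by apply: cvgMl; exact: ci.
have lim2 : (fun n => g n z) @ \oo --> phi x0 * T z.
  by apply: cvgMl; exact: cph.
have E : zsum (fun k => phi x0 * I k * translate phi k z) = phi x0 * T z.
  rewrite -(cvg_lim (@Rhausdorff R) lim1); apply: cvg_lim => //.
  by under eq_fun do rewrite -rep; exact: lim2.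
apply: (mulfI p0); rewrite -E.
have N1 : 0 <= (\int[mu]_x `|phi x|)%R by exact: Rintegral_ge0.
rewrite -(@zsumZ (phi x0) _ (fun k => (\int[mu]_x `|phi x|)%R * `|translate phi k z|)
  ((\int[mu]_x `|phi x|)%R * Phi)).
- by congr zsum; apply/funext => k; rewrite mulrA.
- move=> k; rewrite normrM ler_wpM2r// -(phik k).2; apply: Rint_norm_le => [||x].
  + by apply: measurable_funM => //; exact: rint_meas (phik k).1.
  + exact/rint_norm/(phik k).1.
  + by rewrite normrM ler_piMr.
- by move=> K; rewrite zpartZ ler_wpM2l.
Qed.

End part.

(** The wavelets, whose spectra avoid [-a', a'], do not see the exponentials of
    lower frequency, which the translates of [phi] therefore reproduce alone. *)
Lemma wavelet_reproduces_expi (tau z : R) : `|tau| < a' ->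
  zsum (fun k => complex.Re (fourier (translate phi k) tau) * translate phi k z)
    = cos (tau * z) /\
  zsum (fun k => complex.Im (fourier (translate phi k) tau) * translate phi k z)
    = - sin (tau * z).
Proof.
move=> taua; split.
- rewrite -(@reproduce_part tau (fun x => cos (tau * x))).
  + congr zsum; apply/funext => k; congr (_ * _); apply: Rint_eq => x.
    by rewrite ReM/= mul0r subr0 cosN.
  + move=> x; apply: continuous_comp; last exact: continuous_cos.
    by apply: cvgMr; exact: cvg_id.
  + by move=> x; rewrite ler_norml cos_geN1 cos_le1.
  + move=> b x0 i k b0 bt.
    have := congr1 (@complex.Re R) (modulated_orthogonal x0 i k b0 bt) => /= <-.
    by apply: Rint_eq => x; rewrite mul0r subr0.
  + exact: taua.
- rewrite -sinN -mulrN.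
  have := @reproduce_part tau (fun x => sin (tau * x)).
  move=> H; rewrite mulrN sinN -H.
  + rewrite -mulN1r -(@zsumZ (-1) _ (fun k => (\int[mu]_x `|phi x|)%R * `|translate phi k z|)
      ((\int[mu]_x `|phi x|)%R * Phi)).
    * congr zsum; apply/funext => k; rewrite mulrA; congr (_ * _).
      rewrite mulN1r -RintN; last first.
        apply: (rint_le _ (rint_norm (translate_rint k iphi).1)) => [|x].
          apply: measurable_funM; first exact: rint_meas (translate_rint k iphi).1.
          apply: continuous_measurable_fun => x; apply: continuous_comp; last exact: continuous_sin.
          by apply: cvgMr; exact: cvg_id.
        by rewrite normrM ler_piMr// ler_norml sin_geN1 sin_le1.
      by apply: Rint_eq => x; rewrite ImM/= mul0r addr0 sinN mulrN.
    * move=> k; rewrite normrM ler_wpM2r// -(translate_rint k iphi).2.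
      apply: Rint_norm_le => [||x].
      - apply: measurable_funM; first exact: rint_meas (translate_rint k iphi).1.
        apply: continuous_measurable_fun => x; apply: continuous_comp; last exact: continuous_sin.
        by apply: cvgMr; exact: cvg_id.
      - exact/rint_norm/(translate_rint k iphi).1.
      - by rewrite normrM ler_piMr// ler_norml sin_geN1 sin_le1.
    * by move=> K; rewrite zpartZ ler_wpM2l// Rintegral_ge0.
  + move=> x; apply: continuous_comp; last exact: continuous_sin.
    by apply: cvgMr; exact: cvg_id.
  + by move=> x; rewrite ler_norml sin_geN1 sin_le1.
  + move=> b x0 i k b0 bt.
    have := congr1 (@complex.Im R) (modulated_orthogonal x0 i k b0 bt) => /= <-.
    by apply: Rint_eq => x; rewrite mul0r addr0.
  + exact: taua.
Qed.

End reproduction_of_exponentials.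

(** * Densities and independence *)

Section density.
Local Open Scope ereal_scope.
Context d d' (T : measurableType d) (T' : measurableType d') (R : realType).
Variables (P : {measure set T -> \bar R}) (m : {measure set T' -> \bar R}).
Variables (W : T -> R) (Y : T -> T').
Hypotheses (W0 : forall x, (0 <= W x)%R) (mW : measurable_fun setT W)
  (mY : measurable_fun setT Y)
  (mE : forall A, measurable A -> m A = \int[P]_x (W x * \1_A (Y x))%:E).

Import HBNNSimple.

Let mWg (g : T' -> R) : measurable_fun setT g ->
  measurable_fun setT (fun x => (W x * g (Y x))%:E).
Proof.
move=> mg; apply/measurable_EFinP; apply: measurable_funM => //.
exact: (measurableT_comp mg mY).
Qed.

Let density_nnsfun (h : {nnsfun T' >-> R}) :
  \int[m]_y (h y)%:E = \int[P]_x (W x * h (Y x))%:E.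
Proof.
under [LHS]eq_integral do rewrite fimfunE -fsumEFin//.
rewrite [LHS]ge0_integral_fsum//; last 2 first.
  - by move=> r; exact/measurable_EFinP/measurableT_comp.
  - by move=> n x _; rewrite EFinM nnfun_muleindic_ge0.
under [RHS]eq_integral.
  move=> x _.
  have -> : (W x * h (Y x))%:E =
      \sum_(y \in range h) (y * (W x * \1_(h @^-1` [set y]) (Y x)))%:E.
    rewrite fsumEFin//; congr (_%:E); rewrite fimfunE mulrC.
    rewrite fsbig_finite//= fsbig_finite//= mulr_suml; apply: eq_bigr => r _.
    by rewrite mulrAC mulrA.
  over.
rewrite [RHS]ge0_integral_fsum//; last 2 first.
  - move=> r; apply/measurable_EFinP; apply: measurable_funM => //.
    apply: measurable_funM => //; apply: (measurableT_comp _ mY).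
    exact: measurable_indic.
  - move=> r x _; have := nnfun_muleindic_ge0 h r (Y x).
    rewrite -EFinM !lee_fin => h0.
    by rewrite mulrCA mulr_ge0.
apply: eq_fsbigr => r _.
under [LHS]eq_integral do rewrite EFinM.
rewrite integralZl_indic_nnsfun// integral_indic// setIT mE//.
have [r0|r0] := leP 0%R r.
  rewrite -ge0_integralZl//.
  - by apply: mWg; exact: measurable_indic.
  - by move=> x _; rewrite lee_fin mulr_ge0.
have e : h @^-1` [set r] = set0.
  apply/seteqP; split => // y /= hy.
  have : (0 <= h y)%R by [].
  by rewrite hy leNgt r0.
rewrite e; under eq_integral do rewrite indic0 mulr0.
rewrite integral0 mule0; apply/esym; apply: integral0_eq => x _.
by rewrite indic0 !mulr0.
Qed.

(** Extension from indicators through simple functions and monotone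
    convergence. It serves twice: with the density of a random variable as
    weight, and with a product of independent factors as weight. *)
Lemma ge0_integral_density (g : T' -> R) : measurable_fun setT g ->
  (forall y, (0 <= g y)%R) ->
  \int[m]_y (g y)%:E = \int[P]_x (W x * g (Y x))%:E.
Proof.
move=> mg g0.
have mEg : measurable_fun setT (EFin \o g) by exact/measurable_EFinP.
pose h := nnsfun_approx measurableT mEg.
have hg y : (fun n => (h n y)%:E) @ \oo --> (g y)%:E.
  have g0E x : [set: T'] x -> 0 <= (EFin \o g) x by move=> _; rewrite /= lee_fin.
  by have := @cvg_nnsfun_approx _ _ _ _ measurableT _ mEg g0E y I.
have hnd y a b : (a <= b)%N -> (h a y <= h b y)%R.
  by move=> ab; exact/lefP/nd_nnsfun_approx.
have c1 : \int[m]_y (h n y)%:E @[n --> \oo] --> \int[m]_y (g y)%:E.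
  rewrite (_ : (fun y => (g y)%:E) = (fun y => limn (fun n => (h n y)%:E))); last first.
    by apply/funext => y; apply/esym/cvg_lim.
  apply: cvg_monotone_convergence => //.
  - by move=> n; apply/measurable_EFinP.
  - by move=> n x _; rewrite lee_fin.
  - by move=> x _ a b ab; rewrite lee_fin hnd.
have c2 : \int[P]_x (W x * h n (Y x))%:E @[n --> \oo] --> \int[P]_x (W x * g (Y x))%:E.
  rewrite (_ : (fun x => (W x * g (Y x))%:E) =
      (fun x => limn (fun n => (W x * h n (Y x))%:E))); last first.
    apply/funext => x; apply/esym/cvg_lim => //; apply: cvg_EFin; first exact: nearW.
    apply: cvgMr; have /fine_cvg := hg (Y x); exact.
  apply: cvg_monotone_convergence => //.
  - by move=> n; exact: mWg.
  - by move=> n x _; rewrite lee_fin mulr_ge0.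
  - by move=> x _ a b ab; rewrite lee_fin ler_wpM2l// hnd.
rewrite -(cvg_lim _ c1)// -(cvg_lim _ c2)//.
by congr (limn _); apply/funext => n; exact: density_nnsfun.
Qed.

End density.

Lemma bounded_rint d (T : measurableType d) (R : realType) (P : probability T R)
    (f : T -> R) (B : R) : measurable_fun setT f -> (forall x, `|f x| <= B) -> rint P f.
Proof.
by move=> mf fB; apply: (rint_le mf _ fB); exact: finite_measure_integrable_cst.
Qed.

Lemma prob_rint_cst d (T : measurableType d) (R : realType) (P : probability T R) (c : R) :
  rint P (fun=> c).
Proof. exact: finite_measure_integrable_cst. Qed.

Section independence.
Context d (T : measurableType d) (R : realType) (P : probability T R) (n : nat).
Variable Y : 'I_n -> {RV P >-> measurableTypeR R}.
Hypothesis indY : mutually_independent Y.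

Let measY (g : R -> R) m : measurable_fun setT (g : measurableTypeR R -> R) ->
  measurable_fun setT (fun w => g (Y m w)).
Proof. by move=> mg; exact: measurableT_comp mg _. Qed.

Lemma prob_indic m (A : set (measurableTypeR R)) : measurable A ->
  (\int[P]_w \1_A (Y m w))%R = fine (P (Y m @^-1` A)).
Proof.
move=> mA; rewrite /Rintegral; congr fine.
have mYA : measurable (Y m @^-1` A) by rewrite -[X in measurable X]setTI; exact: measurable_funP.
rewrite -[X in P X]setIT -integral_indic//.
Qed.

Let prodY (g : 'I_n -> R -> R) w := \prod_(m < n) g m (Y m w).

(** Induction on the number [r] of factors that are not indicators. Replacing
    one of them by an arbitrary indicator shows that the product of the others
    is a weight under which the remaining variable keeps its law, up to a
    constant; [ge0_integral_density] then allows any function. *)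
Lemma independent_prod_step (r : nat) (B : R) (A : 'I_n -> set (measurableTypeR R))
    (g : 'I_n -> R -> R) : 1 <= B -> (forall m, measurable (A m)) ->
  (forall m, measurable_fun setT (g m : measurableTypeR R -> R)) ->
  (forall m y, 0 <= g m y <= B) ->
  (forall m : 'I_n, (r <= m)%N -> g m = \1_(A m)) ->
  (\int[P]_w prodY g w)%R = \prod_(m < n) (\int[P]_w g m (Y m w))%R.
Proof.
move=> B1; have B0 : 0 <= B by exact: le_trans B1.
elim: r A g => [|r IH] A g mA mg gB gA.
  have E m : g m = \1_(A m) by exact: gA.
  have -> : prodY g = \1_(\bigcap_(m in [set: 'I_n]) (Y m @^-1` A m)).
    apply/funext => w; rewrite /prodY indicE.
    have [wA|wA] := boolP (w \in _).
      apply: big1 => m _; rewrite E indicE; move: wA; rewrite inE => /(_ m I) wA.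
      by rewrite mem_set.
    move: wA; rewrite notin_setE => /existsNP[m /not_implyP[_ wA]].
    by rewrite (bigD1 m)//= E indicE memNset ?mul0r.
  under [RHS]eq_bigr do rewrite E prob_indic//.
  rewrite /Rintegral integral_indic// ?setIT; last first.
    apply: fin_bigcap_measurable; first exact: finite_finset.
    by move=> m _; rewrite -[X in measurable X]setTI; exact: measurable_funP.
  transitivity (fine (\prod_(m < n) P (Y m @^-1` A m))%E).
    by congr fine; exact: (indY mA).
  have mYA m : measurable (Y m @^-1` A m).
    by rewrite -[X in measurable X]setTI; exact: measurable_funP.
  transitivity (fine (\prod_(m < n) (fine (P (Y m @^-1` A m)))%:E)%E).
    congr fine; apply: eq_bigr => m _.
    by rewrite fineK// fin_num_measure.
  by rewrite prodEFin.
have [nr|rn] := leqP n r.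
  by apply: IH => // m rm; have := ltn_ord m; rewrite ltnNge (leq_trans nr rm).
pose r0 := Ordinal rn.
have gint m : rint P (fun w => g m (Y m w)).
  apply: (@bounded_rint _ _ _ _ _ B) => [|w]; first exact: measY.
  by have /andP[? ?] := gB m (Y m w); rewrite ger0_norm.
pose W w := \prod_(m < n | m != r0) g m (Y m w).
pose c := \prod_(m < n | m != r0) (\int[P]_w g m (Y m w))%R.
have W0 w : 0 <= W w by apply: prodr_ge0 => m _; have /andP[] := gB m (Y m w).
have c0 : 0 <= c.
  by apply: prodr_ge0 => m _; apply: Rintegral_ge0 => w _; have /andP[] := gB m (Y m w).
have mW : measurable_fun setT W.
  rewrite /W; under eq_fun do rewrite -big_filter.
  elim: [seq _ <- _ | _] => [|m s IHs].
    by under eq_fun do rewrite big_nil; exact: measurable_cst.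
  by under eq_fun do rewrite big_cons; apply: measurable_funM => //; exact: measY.
pose WB := \prod_(m < n | m != r0) B.
have WWB w : W w <= WB by apply: ler_prod => m _; exact: gB.
have mYr : measurable_fun setT (Y r0) by exact: measurable_funP.
pose mu1 := mscale (NngNum c0) (distribution P (Y r0)).
have mE D : measurable D -> mu1 D = (\int[P]_w (W w * \1_D (Y r0 w))%:E)%E.
  move=> mD.
  pose g' m := if m == r0 then \1_D else g m.
  have g'r : g' r0 = \1_D by rewrite /g' eqxx.
  have g'n m : m != r0 -> g' m = g m by rewrite /g' => /negbTE ->.
  have mg' m : measurable_fun setT (g' m : measurableTypeR R -> R).
    by rewrite /g'; case: ifP => // _; exact: measurable_indic.
  pose A' m := if m == r0 then D else A m.
  have gB' m y : 0 <= g' m y <= B.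
    rewrite /g'; case: ifP => // _; rewrite indicE ler0n/=.
    by case: (_ \in _) => //=.
  have mA' m : measurable (A' m) by rewrite /A'; case: ifP.
  have gA' (m : 'I_n) : (r <= m)%N -> g' m = \1_(A' m).
    move=> rm; rewrite /g' /A'; case: eqP => // /eqP mr.
    apply: gA; rewrite ltn_neqAle rm andbT; apply: contra mr => /eqP e.
    by apply/eqP/val_inj.
  have := IH A' g' mA' mg' gB' gA'.
  rewrite (bigD1 r0)//= g'r prob_indic// => e.
  have -> : mu1 D = (c * fine (P (Y r0 @^-1` D)))%:E.
    by rewrite EFinM fineK// fin_num_measure// -[X in measurable X]setTI; exact: mYr.
  have cE : c = \prod_(i < n | i != r0) (\int[P]_w g' i (Y i w))%R.
    by apply: eq_bigr => m mr; rewrite g'n.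
  rewrite mulrC cE -e -rint_fin.
    apply: eq_integral => w _; rewrite /prodY (bigD1 r0)//= g'r mulrC.
    by congr ((_ * _)%:E); apply: eq_bigr => m mr; rewrite g'n.
  have -> : prodY g' = (fun w => W w * \1_D (Y r0 w)).
    apply/funext => w; rewrite /prodY (bigD1 r0)//= g'r mulrC.
    by congr (_ * _); apply: eq_bigr => m mr; rewrite g'n.
  apply: (@bounded_rint _ _ _ _ _ WB) => [|w].
    by apply: measurable_funM => //; apply: (measurableT_comp _ mYr); exact: measurable_indic.
  rewrite normrM ger0_norm// -[leRHS]mulr1; apply: ler_pM => //.
  by rewrite indicE; case: (_ \in _); rewrite ?normr1 ?normr0.
have g0 y : 0 <= g r0 y by have /andP[] := gB r0 y.
have := ge0_integral_density W0 mW mYr mE (mg r0) g0.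
rewrite ge0_integral_mscale//=; last 2 first.
- exact/measurable_EFinP.
- by move=> y _; rewrite lee_fin.
rewrite (ge0_integral_distribution (Y r0) (f := EFin \o g r0)); last 2 first.
- exact/measurable_EFinP.
- by move=> y; rewrite lee_fin.
rewrite (rint_fin (gint r0)) rint_fin; last first.
  apply: (@bounded_rint _ _ _ _ _ (WB * B)) => [|w].
    by apply: measurable_funM => //; exact: measY.
  rewrite normrM; apply: ler_pM => //; first by rewrite ger0_norm.
  by have /andP[? ?] := gB r0 (Y r0 w); rewrite ger0_norm.
move=> [e]; rewrite (bigD1 r0)//= mulrC -/c e; apply: Rint_eq => w.
by rewrite /prodY (bigD1 r0)//= mulrC.
Qed.

Lemma independent_prod (g : R -> R) (B : R) :
  measurable_fun setT (g : measurableTypeR R -> R) -> (forall y, 0 <= g y <= B) ->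
  (\int[P]_w \prod_(m < n) g (Y m w))%R = \prod_(m < n) (\int[P]_w g (Y m w))%R.
Proof.
move=> mg gB; apply: (@independent_prod_step n (Num.max 1 B) (fun=> setT) (fun=> g)) => //.
- by rewrite le_max lexx.
- by move=> _ y; have /andP[-> h] := gB y; rewrite le_max h orbT.
- by move=> m; rewrite leqNgt ltn_ord.
Qed.

End independence.

(** * Characteristic functions *)

Section characteristic_function.
Context d (T : measurableType d) (R : realType) (P : probability T R).
Local Notation mu := (@lebesgue_measure R).
Variables (X eps : {RV P >-> measurableTypeR R}) (f : R -> R)
  (law : probability (measurableTypeR R) R).
Hypotheses (f0 : forall x, 0 <= f x) (fi : rint mu f) (f1 : (\int[mu]_x f x)%R = 1)
  (Xf : has_density X f) (el : has_law eps law) (ind : independent_pair X eps).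

Let mX : measurable_fun setT X. Proof. exact: measurable_funP. Qed.
Let meps : measurable_fun setT eps. Proof. exact: measurable_funP. Qed.

Let Q : probability (measurableTypeR R) R := distribution P X.

Lemma Rint_density (g : R -> R) (B : R) : measurable_fun setT (g : measurableTypeR R -> R) ->
  (forall x, `|g x| <= B) ->
  (\int[Q]_x g x)%R = (\int[mu]_x (f x * g x))%R.
Proof.
move=> mg gB.
have mE A : measurable A -> Q A = (\int[mu]_x (f x * \1_A x)%:E)%E.
  move=> mA; rewrite [LHS](Xf mA) integral_mkcond; apply: eq_integral => x _.
  by rewrite patchE indicE; case: ifP => _; rewrite ?mulr1 ?mulr0.
(* Shifting [g] by its bound reduces the claim to nonnegative functions. *)
have mgB : measurable_fun setT ((fun x => g x + B) : measurableTypeR R -> R).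
  exact: measurable_funD.
have gB0 x : 0 <= g x + B by have := gB x; rewrite ler_norml => /andP[h _]; lra.
have mid : measurable_fun setT (idfun : measurableTypeR R -> measurableTypeR R).
  exact: measurable_id.
have e : (\int[Q]_y (g y + B)%:E = \int[mu]_x (f x * (g x + B))%:E)%E.
  apply: (@ge0_integral_density _ _ (measurableTypeR R) (measurableTypeR R) R mu
    Q f idfun) => //.
  exact: rint_meas fi.
have gi : rint Q g by exact: (@bounded_rint _ (measurableTypeR R) _ Q g B mg gB).
have Bi : rint Q (fun=> B).
  exact: prob_rint_cst.
have fgi : rint mu (fun x => f x * g x).
  apply: (rint_le _ (rintZ B fi)) => [|x].
    by apply: measurable_funM => //; exact: rint_meas fi.
  by rewrite normrM ger0_norm// mulrC ler_wpM2r.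
have fBi : rint mu (fun x => f x * (g x + B)).
  by apply: rint_eq (rintD fgi (rintZ B fi)) => x; ring.
move: e; rewrite (rint_fin (rintD gi Bi)) (rint_fin fBi) => -[].
rewrite RintegralD// Rintegral_cst//= probability_setT mulr1.
have -> : (\int[mu]_x (f x * (g x + B)))%R = (\int[mu]_x (f x * g x + B * f x))%R.
  by apply: Rint_eq => x; ring.
rewrite RintegralD//; last exact: rintZ.
rewrite RintegralZl// f1; lra.
Qed.

Let XE (w : T) : measurableTypeR R * measurableTypeR R := (X w, eps w).

Let mXE : measurable_fun setT XE. Proof. exact: measurable_fun_pair. Qed.

(** Independence says that the joint law agrees with a product measure on
    rectangles, which determine it. *)
Lemma cintegral_joint (G : measurableTypeR R * measurableTypeR R -> R[i]) :
  cmeas G -> (forall z, normc (G z) <= 1) ->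
  cintegral P (fun w => G (X w, eps w)) =
  cintegral Q (fun x => cintegral law (fun e => G (x, e))).
Proof.
move=> mG G1.
pose XEm : {mfun T >-> (measurableTypeR R * measurableTypeR R)%type} :=
  HB.pack XE (isMeasurableFun.Build _ _ _ _ _ mXE).
pose prod := (Q \x law)%E.
have prodE A : measurable A -> prod A = distribution P XEm A.
  apply: product_measure_unique => A1 A2 mA1 mA2.
  have := ind mA1 mA2; rewrite (el mA2) => <-.
  by congr (P _); apply/seteqP; split.
have real (g : measurableTypeR R * measurableTypeR R -> R) :
    measurable_fun setT g -> (forall z, `|g z| <= 1) ->
    (\int[P]_w g (X w, eps w))%R = (\int[prod]_z g z)%R.
  move=> mg g1; rewrite /Rintegral; congr fine.
  rewrite [RHS](eq_measure_integral (distribution P XEm)); last first.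
    by move=> A mA _; exact: prodE.
  rewrite integral_distribution//; first exact/measurable_EFinP.
  apply: (@bounded_rint _ _ _ P (fun w => g (XE w)) 1) => [|w]; last exact: g1.
  exact: (measurableT_comp mg mXE).
rewrite -(@cintegral_prod _ _ _ _ _ Q law G (fun=> 1) (fun=> 1))//; last first.
- by move=> x y; rewrite mulr1.
- exact: prob_rint_cst.
- exact: prob_rint_cst.
apply: complex_eqP => /=; apply: real.
- exact: mG.1.
- by move=> z; exact: le_trans (normc_Re _) (G1 z).
- exact: mG.2.
- by move=> z; exact: le_trans (normc_Im _) (G1 z).
Qed.

Lemma characteristic_function_sum (u : R) :
  cintegral P (fun w => expi (u * (X w + eps w))) =
  conjc (fourier f u) * conjc (fourier_law law u).
Proof.
have mu1 : measurable_fun setT ((fun x => u * x) : measurableTypeR R -> R).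
  exact: measurable_mul1.
have mG : cmeas (fun z : measurableTypeR R * measurableTypeR R => expi (u * (z.1 + z.2))).
  by apply: cmeas_expi; apply: measurable_funM => //; exact: measurable_funD.
have G1 (z : measurableTypeR R * measurableTypeR R) : normc (expi (u * (z.1 + z.2))) <= 1.
  by rewrite normc_expi.
have /= -> := cintegral_joint mG G1.
have cl : cintble law (fun e => expi (u * e)).
  apply: (cintble_le (cmeas_expi mu1) (prob_rint_cst _ 1)) => x.
  by rewrite normc_expi.
have eL : conjc (fourier_law law u) = cintegral law (fun e => expi (u * e)).
  rewrite /fourier_law -[in RHS](conj_conjc (cintegral law _)).
  congr conjc; rewrite -(cintegral_conj cl).2; apply: eq_cintegral => x.
  by rewrite conj_expi.
rewrite [X in _ = _ * X]eL.
set L := cintegral law _.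
have cX : cintble Q (fun x => expi (u * x)).
  apply: (cintble_le (cmeas_expi mu1) (prob_rint_cst _ 1)) => x.
  by rewrite normc_expi.
have -> : (fun x => cintegral law (fun e => expi (u * (x + e)))) =
    (fun x => L * expi (u * x)).
  apply/funext => x; rewrite mulrC -(cintegralZ _ cl).2; apply: eq_cintegral => e.
  by rewrite mulrDr expiD.
rewrite (cintegralZ _ cX).2 mulrC; congr (_ * _).
rewrite /fourier; apply: complex_eqP; rewrite ?ReJ ?ImJ /=.
  rewrite (@Rint_density _ 1); last 2 first.
  - by have [] := cmeas_expi mu1.
  - by move=> x; rewrite ler_norml cos_geN1 cos_le1.
  by apply: Rint_eq => x; rewrite mul0r subr0 cosN.
rewrite (@Rint_density _ 1); last 2 first.
- by have [] := cmeas_expi mu1.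
- by move=> x; rewrite ler_norml sin_geN1 sin_le1.
have i1 : rint mu (fun x => f x * sin (u * x)).
  apply: (rint_le _ fi) => [|x].
    by apply: measurable_funM; [exact: rint_meas fi|have [] := cmeas_expi mu1].
  by rewrite normrM (ger0_norm (f0 x)) ler_piMr// ler_norml sin_geN1 sin_le1.
rewrite -[LHS]opprK -RintN//; congr (- _).
by apply: Rint_eq => x; rewrite mul0r addr0 sinN mulrN.
Qed.

Lemma normc_fourier_law (u : R) : normc (fourier_law law u) <= 1.
Proof.
have <- : (\int[law]_x cst 1 x)%R = 1 :> R.
  rewrite Rintegral_cst// mul1r.
  by transitivity (fine (1%E : \bar R)) => //; congr fine; exact: probability_setT.
apply: normc_cintegral => [||x].
- by apply: cmeas_expi; apply: measurable_funN; exact: measurable_mul1.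
- exact: prob_rint_cst.
- by rewrite normc_expi.
Qed.

End characteristic_function.

(** * Random values of an inverse Fourier transform *)

Section spectral_integral.
Context (R : realType).
Local Notation mu := (@lebesgue_measure R).
Variables (q : R -> R[i]) (b : R -> R) (A : R).
Hypotheses (mq : cmeas q) (bi : rint mu b) (qb : forall t, normc (q t) <= b t)
  (bA : forall t, b t <= A).

Definition spectral (y : R) : R[i] := cintegral mu (fun t => q t * expi (t * y)).

Let b0 t : 0 <= b t. Proof. exact: le_trans (normc_ge0 _) (qb t). Qed.

Let A0 : 0 <= A. Proof. exact: le_trans (b0 0) (bA 0). Qed.

Let spectral_integrand y : cintble mu (fun t => q t * expi (t * y)).
Proof.
apply: (cintble_le _ bi) => [|t]; last by rewrite normcM normc_expi mulr1.
by apply: cmeasM => //; apply: cmeas_expi; exact: measurable_funM.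
Qed.

Lemma normc_spectral y : normc (spectral y) <= (\int[mu]_t b t)%R.
Proof.
apply: normc_cintegral => // [|t]; first exact: cintble_meas (spectral_integrand y).
by rewrite normcM normc_expi mulr1.
Qed.

Lemma cmeas_spectral : cmeas (spectral : measurableTypeR R -> R[i]).
Proof.
apply: (cmeas_param (m := mu)
  (F := fun z : measurableTypeR R * measurableTypeR R => q z.2 * expi (z.2 * z.1)) (b := b)) => //.
- apply: cmeasM; first exact: cmeas_comp mq.
  by apply: cmeas_expi; exact: measurable_funM.
- by move=> y t; rewrite normcM normc_expi mulr1.
Qed.

Context d (T : measurableType d) (P : probability T R) (Y : T -> R).
Hypothesis mY : measurable_fun setT (Y : T -> measurableTypeR R).

Local Notation char u := (cintegral P (fun w => expi (u * Y w))).

Lemma spectral_expectation (v : R) :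
  cintble P (fun w => expi (v * Y w) * spectral (Y w)) /\
  cintegral P (fun w => expi (v * Y w) * spectral (Y w)) =
  cintegral mu (fun t => q t * char (t + v)).
Proof.
pose F (z : T * measurableTypeR R) : R[i] := q z.2 * expi ((z.2 + v) * Y z.1).
have mY1 : measurable_fun setT (fun z : T * measurableTypeR R => Y z.1).
  exact: (measurableT_comp mY).
have mF : cmeas F.
  apply: cmeasM; first exact: cmeas_comp mq.
  by apply: cmeas_expi; apply: measurable_funM => //; exact: measurable_funD.
have Fb w t : normc (F (w, t)) <= 1 * b t.
  by rewrite normcM normc_expi mulr1 mul1r.
have E w : expi (v * Y w) * spectral (Y w) = cintegral mu (fun t => F (w, t)).
  rewrite -(cintegralZ _ (spectral_integrand (Y w))).2; apply: eq_cintegral => t.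
  by rewrite /F /= mulrDl expiD; ring.
have i1 := cintble_inner1 mF (prob_rint_cst P 1) bi Fb.
rewrite (funext E); split=> //.
rewrite (cintegral_fubini mF (prob_rint_cst P 1) bi Fb).
apply: eq_cintegral => t; rewrite /F /=.
have ce : cintble P (fun w => expi ((t + v) * Y w)).
  apply: (cintble_le (cmeas_expi _) (prob_rint_cst P 1)) => [|w].
    exact: (measurable_funM _ mY).
  by rewrite normc_expi.
by rewrite (cintegralZ _ ce).2.
Qed.

Variable K : R.
Hypotheses (ci : rint mu (fun u : R => normc (char u)))
  (cK : (\int[mu]_u normc (char u))%R <= K).

Let mchar : cmeas ((fun u : R => char u) : measurableTypeR R -> R[i]).
Proof.
apply: (cmeas_param (m := P)
  (F := fun z : measurableTypeR R * T => expi (z.1 * Y z.2)) (b := fun=> 1)).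
- apply: cmeas_expi; apply: measurable_funM => //; exact: (measurableT_comp mY).
- exact: prob_rint_cst.
- by move=> u w; rewrite normc_expi.
Qed.

(** The square of [spectral] is a double integral against the characteristic
    function of [Y] at frequency differences, so that its mean only involves
    the mass of that function. *)
Lemma spectral_second_moment :
  (\int[P]_w (normc (spectral (Y w)) ^+ 2))%R <= (\int[mu]_t b t)%R * (A * K).
Proof.
have inner v : normc (cintegral P (fun w => expi (v * Y w) * spectral (Y w))) <= A * K.
  rewrite (spectral_expectation v).2.
  have [s1 s2] := rint_affine v ltr01 ci.
  have E1 : (fun t => normc (char (1 * t + v))) = (fun t => normc (char (t + v))).
    by apply/funext => t; rewrite mul1r.
  rewrite E1 in s1; rewrite E1 invr1 mul1r in s2.
  apply: (@le_trans _ _ (\int[mu]_t (A * normc (char (t + v))))%R).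
    apply: normc_cintegral; last by move=> t; rewrite normcM ler_wpM2r ?normc_ge0// (le_trans (qb t)).
      apply: cmeasM => //; have := cmeas_affine 1 v mchar.
      by under eq_fun do rewrite mul1r.
    exact: rintZ.
  by rewrite RintegralZl// s2 ler_wpM2l.
pose F (z : T * measurableTypeR R) : R[i] :=
  conjc (q z.2) * (expi (- z.2 * Y z.1) * spectral (Y z.1)).
have mY1 : measurable_fun setT (fun z : T * measurableTypeR R => (Y z.1 : measurableTypeR R)).
  exact: (measurableT_comp mY).
have mF : cmeas F.
  apply: cmeasM; first by apply: cmeas_conj; exact: cmeas_comp mq.
  apply: cmeasM; last exact: cmeas_comp mY1 cmeas_spectral.
  by apply: cmeas_expi; apply: measurable_funM => //; exact: measurable_funN.
set Ib := (\int[mu]_t b t)%R.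
have Ib0 : 0 <= Ib by apply: Rintegral_ge0.
have Fb w t : normc (F (w, t)) <= Ib * b t.
  rewrite !normcM normc_conj normc_expi mul1r mulrC ler_pM ?normc_ge0//.
  exact: normc_spectral.
have E w : (normc (spectral (Y w)) ^+ 2)%:C = cintegral mu (fun t => F (w, t)).
  rewrite -mulc_conj.
  have [_ <-] := cintegral_conj (spectral_integrand (Y w)).
  have [h _] := cintegral_conj (spectral_integrand (Y w)).
  rewrite -(cintegralZ _ h).2; apply: eq_cintegral => t.
  by rewrite /F /= conjcM conj_expi mulNr; ring.
have <- : complex.Re (cintegral P (fun w => cintegral mu (fun t => F (w, t)))) =
    (\int[P]_w (normc (spectral (Y w)) ^+ 2))%R.
  by rewrite -(funext E) cintegral_real.
rewrite (cintegral_fubini mF (prob_rint_cst P Ib) bi Fb).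
apply: le_trans (ler_norm _) _; apply: le_trans (normc_Re _) _.
have -> : Ib * (A * K) = (\int[mu]_t (A * K * b t))%R by rewrite RintegralZl// mulrC.
apply: normc_cintegral; last 1 first.
- move=> t; have [h e] := spectral_expectation (- t).
  have [_ e2] := cintegralZ (conjc (q t)) h.
  apply: (@le_trans _ _ (normc (conjc (q t) *
    cintegral P (fun w => expi (- t * Y w) * spectral (Y w))))).
    by rewrite -e2.
  rewrite normcM normc_conj mulrC.
  by apply: ler_pM; rewrite ?normc_ge0// inner.
- apply: (cmeas_param (m := P) (F := fun z : measurableTypeR R * T => F (z.2, z.1))
    (b := fun=> Ib * A)).
  + by apply: (cmeas_comp (f := fun z : measurableTypeR R * T => (z.2, z.1))) mF;
      exact: measurable_fun_pair.
  + exact: prob_rint_cst.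
  + by move=> t w; apply: le_trans (Fb w t) _; rewrite ler_wpM2l.
- exact: rintZ.
Qed.

End spectral_integral.

(** * Bessel inequality for exponentials *)

Section trigonometric_bessel.
Context (R : realType).
Local Notation mu := (@lebesgue_measure R).

Lemma sin_int_pi (m : int) : sin (m%:~R * pi : R) = 0.
Proof.
have nat (n : nat) : sin (n%:R * pi : R) = 0.
  elim: n => [|n IH]; first by rewrite mul0r sin0.
  by rewrite -natr1 mulrDl mul1r sinDpi IH oppr0.
case: m => n; first by rewrite -pmulrn.
by rewrite NegzE mulrNz mulNr sinN -pmulrn nat oppr0.
Qed.

Lemma conjc_sum (I : Type) (s : seq I) (F : I -> R[i]) :
  conjc (\sum_(i <- s) F i) = \sum_(i <- s) conjc (F i).
Proof.
elim: s => [|i s IH]; first by rewrite !big_nil; apply: complex_eqP; rewrite /= ?oppr0.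
rewrite !big_cons -IH.
by apply: complex_eqP; rewrite ?(ReD, ImD, ReJ, ImJ)// opprD.
Qed.

Variables (om L : R) (J : nat).
Hypotheses (om0 : 0 < om) (L0 : 0 < L) (omL : om * L = J%:R * pi).

Local Notation I := (\1_`[- L, L]%classic : R -> R).

Let LL : - L <= L. Proof. by rewrite ge0_cp// ltW. Qed.

Let Ii : rint mu I. Proof. exact: (rint_indic_itv LL).1. Qed.

Let I01 t : 0 <= I t <= 1.
Proof. by rewrite indicE; case: (_ \in _); rewrite ?lexx ler01. Qed.

Let mwave (m : int) : measurable_fun setT (fun t : R => om * m%:~R * t).
Proof. exact: measurable_mul1. Qed.

Lemma trig_orthogonal (m : int) :
  cintegral mu (fun t => (I t)%:C * expi (om * m%:~R * t)) = (2 * L * (m == 0)%:R)%:C.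
Proof.
have [->|m0] := eqVneq m 0.
  rewrite mulr1 -[X in X%:C]/(2 * L).
  have -> : (fun t => (I t)%:C * expi (om * 0%:~R * t)) = (fun t => (I t)%:C).
    by apply/funext => t; rewrite mulr0 mul0r expi0 mulr1.
  rewrite cintegral_real (rint_indic_itv LL).2; congr (_%:C); ring.
rewrite mulr0; set w := om * m%:~R.
have w0 : w != 0 by apply: mulf_neq0; [rewrite gt_eqF|rewrite intr_eq0].
apply: complex_eqP => /=.
- have -> : (\int[mu]_x (I x * cos (w * x) - 0 * sin (w * x)))%R =
     (\int[mu]_(x in `[- L, L]) cos (w * x))%R.
    rewrite [RHS]Rintegral_mkcond; apply: Rint_eq => t.
    by rewrite patchE indicE; case: ifP; rewrite !mul0r subr0 ?mul1r.
  have dF (t : R) : is_derive t 1 (fun t => sin (w * t) / w) (cos (w * t)).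
    by apply: is_derive_eq; rewrite /GRing.scale /=; field.
  rewrite /Rintegral (@continuous_FTC2 _ _ (fun t => sin (w * t) / w)).
  + rewrite mulrN sinN -EFinB /= (_ : w * L = (J%:Z * m)%:~R * pi).
      by rewrite sin_int_pi; ring.
    by rewrite /w mulrAC omL intrM; ring.
  + by rewrite gtrN.
  + apply: continuous_subspaceT => t; apply: continuous_comp; last exact: continuous_cos.
    by apply: cvgMr; exact: cvg_id.
  + have cF : continuous (fun t => sin (w * t) / w).
      move=> t; apply: differentiable_continuous; apply/derivable1_diffP.
      exact: ex_derive.
    split; first by move=> t _; exact: ex_derive.
      by apply: cvg_at_right_filter; exact: cF.
    by apply: cvg_at_left_filter; exact: cF.
  + by move=> t _; rewrite derive1E; exact: derive_val.
- have iS : rint mu (fun t => I t * sin (w * t)).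
    apply: (rint_le _ Ii) => [|t].
      by apply: measurable_funM; [exact: rint_meas Ii|have [] := cmeas_expi (mwave m)].
    have /andP[h _] := I01 t.
    by rewrite normrM ger0_norm// ler_piMr// ler_norml sin_geN1 sin_le1.
  transitivity (\int[mu]_t (I t * sin (w * t)))%R.
    by apply: Rint_eq => t; rewrite mul0r addr0.
  have [_] := Rint_opp iS.
  have IN t : I (- t) = I t.
    rewrite !indicE; congr (nat_of_bool _)%:R; apply/idP/idP; rewrite !inE/= !in_itv/=;
    by move=> /andP[? ?]; apply/andP; split; lra.
  under Rint_eq do rewrite IN mulrN sinN mulrN.
  by rewrite RintN// => e; lra.
Qed.

Variables (H : R -> R[i]) (b : R -> R) (A : R).
Hypotheses (mH : cmeas H) (bi : rint mu b) (Hb : forall t, normc (H t) <= b t)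
  (bA : forall t, b t <= A) (HI : forall t, b t = b t * I t).

Let c k := cintegral mu (fun t => H t * expi (- (om * k%:~R * t))).

(** The exponentials [expi (om * k * t)] are orthogonal on [-L, L], where [H] is
    supported, and [c k / (2 * L)] are the coefficients of [H]: the mean square
    of [H] minus its expansion is nonnegative. *)
Lemma trig_bessel (s : seq int) : uniq s ->
  \sum_(k <- s) normc (c k) ^+ 2 <= 2 * L * (A * (\int[mu]_t b t)%R).
Proof.
move=> us.
have b0 t : 0 <= b t by exact: le_trans (normc_ge0 _) (Hb t).
have HIt t : H t = (I t)%:C * H t.
  rewrite indicE; case: (boolP (t \in _)) => [_|nt]; first by rewrite mul1r.
  have : normc (H t) <= 0.
    by apply: le_trans (Hb t) _; rewrite HI indicE (negbTE nt) mulr0.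
  rewrite mul0r => h; apply: eq0_normc; apply/eqP.
  by rewrite eq_le h normc_ge0.
pose e k (t : R) : R[i] := expi (om * k%:~R * t).
have me k : cmeas (e k) by apply: cmeas_expi.
pose S t := \sum_(k <- s) c k * e k t.
have mS : cmeas S by apply: cmeas_sum => k; apply: cmeasM => //; exact: cmeas_cst.
have Sb : exists B, forall t, normc (S t) <= B.
  exists (\sum_(k <- s) normc (c k)) => t; apply: le_trans (normc_sum _ _) _.
  by apply: ler_sum => k _; rewrite normcM normc_expi mulr1.
have [B SB] := Sb.
have B0 : 0 <= B by exact: le_trans (normc_ge0 _) (SB 0).
have cH k : cintble mu (fun t => H t * expi (- (om * k%:~R * t))).
  apply: (cintble_le _ bi) => [|t]; last by rewrite normcM normc_expi mulr1.
  by apply: cmeasM => //; apply: cmeas_expi; apply: measurable_funN.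
pose E := \sum_(k <- s) normc (c k) ^+ 2.
have cross : cintble mu (fun t => H t * conjc (S t)) /\
    cintegral mu (fun t => H t * conjc (S t)) = E%:C.
  have Ef : (fun t => H t * conjc (S t)) =
      (fun t => \sum_(k <- s) conjc (c k) * (H t * expi (- (om * k%:~R * t)))).
    apply/funext => t; rewrite /S conjc_sum mulr_sumr; apply: eq_bigr => k _.
    by rewrite conjcM conj_expi mulrCA.
  have ck k := cintegralZ (conjc (c k)) (cH k).
  have [h1 h2] := @cintegral_sum _ _ _ mu _ s
    (fun k t => conjc (c k) * (H t * expi (- (om * k%:~R * t)))) (fun k => (ck k).1).
  rewrite Ef; split=> //; rewrite h2 /E rmorph_sum/=; apply: eq_bigr => k _.
  by rewrite (ck k).2 -/(c k) mulrC mulc_conj.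
have IS : cintble mu (fun t => (I t)%:C * (S t * conjc (S t))) /\
    cintegral mu (fun t => (I t)%:C * (S t * conjc (S t))) = (2 * L * E)%:C.
  have ci (m : int) : cintble mu (fun t => (I t)%:C * expi (om * m%:~R * t)).
    by apply: cintble_modulated.
  have Ef : (fun t => (I t)%:C * (S t * conjc (S t))) =
      (fun t => \sum_(k <- s) \sum_(l <- s) (c k * conjc (c l)) *
         ((I t)%:C * expi (om * (k - l)%:~R * t))).
    apply/funext => t; rewrite {1}/S mulr_suml mulr_sumr; apply: eq_bigr => k _.
    rewrite /S conjc_sum !mulr_sumr; apply: eq_bigr => l _.
    rewrite conjcM conj_expi.
    rewrite (_ : om * (k - l)%:~R * t = om * k%:~R * t + - (om * l%:~R * t)); last first.
      by rewrite intrB; ring.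
    by rewrite expiD /e; ring.
  have ckl k l := cintegralZ (c k * conjc (c l)) (ci (k - l)).
  have ck k := @cintegral_sum _ _ _ mu _ s (fun l t => (c k * conjc (c l)) *
         ((I t)%:C * expi (om * (k - l)%:~R * t))) (fun l => (ckl k l).1).
  have [h1 h2] := @cintegral_sum _ _ _ mu _ s (fun k t => \sum_(l <- s) (c k * conjc (c l)) *
         ((I t)%:C * expi (om * (k - l)%:~R * t))) (fun k => (ck k).1).
  rewrite Ef; split=> //; rewrite h2 /E mulr_sumr rmorph_sum/=.
  apply: eq_big_seq => k ks; rewrite (ck k).2 (bigD1_seq k)//=.
  rewrite big1 ?addr0; last first.
    move=> l lk; rewrite (ckl k l).2 trig_orthogonal subr_eq0 eq_sym (negbTE lk).
    by rewrite mulr0 mulr0.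
  by rewrite (ckl k k).2 trig_orthogonal subrr eqxx mulr1 mulc_conj -rmorphM mulrC.
pose be := (2 * L)^-1.
have be0 : 0 < be by rewrite invr_gt0 mulr_gt0.
have i1 : rint mu (fun t => normc (H t) ^+ 2) /\
    (\int[mu]_t (normc (H t) ^+ 2))%R <= A * (\int[mu]_t b t)%R.
  have le t : normc (H t) ^+ 2 <= A * b t.
    by rewrite expr2 ler_pM ?normc_ge0// (le_trans (Hb t)).
  have i : rint mu (fun t => normc (H t) ^+ 2).
    apply: (rint_le _ (rintZ A bi)) => [|t]; last by rewrite ger0_norm ?sqr_ge0.
    by apply: measurable_funX; exact: cmeas_normc.
  by split=> //; rewrite -RintegralZl//; apply: Rint_le => //; exact: rintZ.
pose i2 := cross.1.1; pose i3 := IS.1.1.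
have v2 := congr1 (@complex.Re R) cross.2; have v3 := congr1 (@complex.Re R) IS.2.
rewrite /= in v2 v3.
have : 0 <= (\int[mu]_t (I t * normc (H t - be%:C * S t) ^+ 2))%R.
  by apply: Rintegral_ge0 => t _; have /andP[h _] := I01 t; rewrite mulr_ge0// sqr_ge0.
have -> : (\int[mu]_t (I t * normc (H t - be%:C * S t) ^+ 2))%R =
  (\int[mu]_t (normc (H t) ^+ 2 - 2 * be * complex.Re (H t * conjc (S t)) +
     be ^+ 2 * complex.Re ((I t)%:C * (S t * conjc (S t)))))%R.
  apply: Rint_eq => t; rewrite !sqr_normcE; move: (HIt t); move: (H t) (S t) => [x y] [u v].
  have : I t = 0 \/ I t = 1 by rewrite indicE; case: (_ \in _); [right|left].
  case=> -> /=; last by move=> _; ring.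
  by rewrite mul0r => -[-> ->]; ring.
rewrite RintegralD//; last 2 first.
- by apply: rintB; [exact: i1.1|exact: rintZ].
- exact: rintZ.
rewrite RintegralB//; [|exact: i1.1|exact: rintZ].
rewrite RintegralZl// RintegralZl// v2 v3 -/E.
have -> : be ^+ 2 * (2 * L * E) = be * E by rewrite /be; field; rewrite gt_eqF.
have := i1.2; set Q := (\int[mu]_t (normc (H t) ^+ 2))%R => QA h.
have : be * E <= A * (\int[mu]_t b t)%R by lra.
by rewrite /be mulrC ler_pdivrMr ?mulr_gt0// mulrC.
Qed.

End trigonometric_bessel.

(** * Exponential moments of empirical means *)

Section elementary_exponential_bounds.
Context (R : realType).

Lemma expR_quadratic (u : R) : u <= 2^-1 -> expR u <= 1 + u + 2 * u ^+ 2.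
Proof.
move=> u2; have u1 : 0 < 1 - u by lra.
have h : expR u * (1 - u) <= 1.
  have := expR_ge1Dx (- u); rewrite expRN => h.
  by rewrite mulrC -ler_pdivlMr ?expR_gt0// mul1r.
rewrite -(ler_pM2r u1); apply: le_trans h _.
have : 0 <= u ^+ 2 * (1 - 2 * u) by rewrite mulr_ge0 ?sqr_ge0//; lra.
by rewrite !expr2; nra.
Qed.

Lemma expRB1_le (x : R) : expR x - 1 <= x * expR x.
Proof.
have := expR_ge1Dx (- x); rewrite expRN => h.
have : expR x * (1 - x) <= 1.
  by rewrite mulrC -ler_pdivlMr ?expR_gt0// mul1r.
by lra.
Qed.

(** The tangent of [ln] at [M] takes the place of Jensen's inequality when [M]
    bounds the mean of [x]. *)
Lemma ln_le_div (x M : R) : 0 < x -> 0 < M -> ln x <= ln M + x / M - 1.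
Proof.
move=> x0 M0; have xM : 0 < x / M by rewrite divr_gt0.
have := expR_ge1Dx (ln (x / M)); rewrite lnK ?posrE// ln_div ?posrE//; lra.
Qed.

End elementary_exponential_bounds.

Section maximal_inequality.
Context d d0 (T : measurableType d) (T0 : measurableType d0) (R : realType).
Variables (P : probability T R) (P0 : probability T0 R) (n : nat).
Variables (Y : 'I_n -> {RV P >-> measurableTypeR R}) (Y0 : T0 -> R).
Hypotheses (n0 : (0 < n)%N) (mY0 : measurable_fun setT (Y0 : T0 -> measurableTypeR R))
  (iidY : iid_copies Y P0 Y0).

Lemma Rint_copy (g : R -> R) (B : R) m :
  measurable_fun setT (g : measurableTypeR R -> R) -> (forall y, `|g y| <= B) ->
  (\int[P]_w g (Y m w))%R = (\int[P0]_w g (Y0 w))%R.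
Proof.
move=> mg gB.
pose Z : {mfun T0 >-> measurableTypeR R} :=
  HB.pack (Y0 : T0 -> measurableTypeR R) (isMeasurableFun.Build _ _ _ _ _ mY0).
rewrite /Rintegral; congr fine.
rewrite -(@integral_distribution _ _ _ _ _ P (Y m) (EFin \o g)); last 2 first.
- exact/measurable_EFinP.
- by apply: (@bounded_rint _ _ _ _ _ B) => //; exact: (measurableT_comp mg).
rewrite -(@integral_distribution _ _ _ _ _ P0 Z (EFin \o g)); last 2 first.
- exact/measurable_EFinP.
- by apply: (@bounded_rint _ _ _ _ _ B) => //; exact: (measurableT_comp mg).
by apply: eq_measure_integral => A mA _; exact: (iidY.2 m A mA).
Qed.

Section one_function.
Variables (g : R -> R) (U : R).
Hypotheses (mg : measurable_fun setT (g : measurableTypeR R -> R))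
  (gU : forall y, `|g y| <= U).

Local Notation e := (\int[P0]_w g (Y0 w))%R.
Local Notation v := (\int[P0]_w (g (Y0 w) ^+ 2))%R.

Definition centered_mean w : R := n%:R^-1 * \sum_(m < n) g (Y m w) - e.

Let U0 : 0 <= U. Proof. exact: le_trans (normr_ge0 _) (gU 0). Qed.

Let gi : rint P0 (fun w => g (Y0 w)).
Proof. by apply: (@bounded_rint _ _ _ _ _ U) => //; exact: (measurableT_comp mg). Qed.

Let g2i : rint P0 (fun w => g (Y0 w) ^+ 2).
Proof.
apply: (@bounded_rint _ _ _ _ _ (U ^+ 2)) => [|w].
  by apply: measurable_funX; exact: (measurableT_comp mg).
by rewrite normrX; apply: lerXn2r; rewrite ?nnegrE.
Qed.

Let eU : `|e| <= U.
Proof.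
have <- : (\int[P0]_x cst U x)%R = U.
  rewrite Rintegral_cst//; transitivity (U * fine (1%E : \bar R)); last by rewrite mulr1.
  by congr (_ * fine _); exact: probability_setT.
by apply: Rint_norm_le => //; [exact: (measurableT_comp mg)|exact: prob_rint_cst].
Qed.

Lemma measurable_centered_mean : measurable_fun setT centered_mean.
Proof.
apply: measurable_funB => //; apply: measurable_funM => //.
by apply: measurable_sum => m; exact: (measurableT_comp mg).
Qed.

(** As in Bernstein's inequality, the second moment rather than the range
    enters the exponent. *)
Lemma one_mgf (th : R) : `|th| * (4 * U) <= 1 ->
  (\int[P0]_w expR (th * (g (Y0 w) - e)))%R <= expR (2 * th ^+ 2 * v).
Proof.
move=> thU.
have small w : th * (g (Y0 w) - e) <= 2^-1.
  apply: le_trans (ler_norm _) _; rewrite normrM.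
  have : `|g (Y0 w) - e| <= 2 * U by apply: le_trans (ler_normB _ _) _; move: (gU (Y0 w)) eU; lra.
  move=> h; apply: le_trans (ler_wpM2l (normr_ge0 th) h) _; lra.
apply: (@le_trans _ _ (1 + 2 * th ^+ 2 * v)); last first.
  exact: expR_ge1Dx.
have ci : rint P0 (fun w => 1 + th * (g (Y0 w) - e) + 2 * (th * (g (Y0 w) - e)) ^+ 2).
  apply: rint_eq (rintD (rintD (prob_rint_cst P0 (1 - th * e + 2 * (th * e) ^+ 2))
    (rintZ (th - 4 * th ^+ 2 * e) gi)) (rintZ (2 * th ^+ 2) g2i)) => w.
  by ring.
apply: le_trans (Rint_le _ ci (fun w => expR_quadratic (small w))) _.
  apply: (@bounded_rint _ _ _ _ _ (expR 2^-1)) => [|w].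
    apply: (measurableT_comp (@measurable_expR R)); apply: measurable_funM => //.
    by apply: measurable_funB => //; exact: (measurableT_comp mg).
  by rewrite ger0_norm ?expR_ge0// ler_expR small.
have -> : (\int[P0]_w (1 + th * (g (Y0 w) - e) + 2 * (th * (g (Y0 w) - e)) ^+ 2))%R =
   (\int[P0]_w (cst (1 - th * e + 2 * (th * e) ^+ 2) w
    + (th - 4 * th ^+ 2 * e) * g (Y0 w) + (2 * th ^+ 2) * g (Y0 w) ^+ 2))%R.
  by apply: Rint_eq => w /=; ring.
rewrite RintegralD//; last 2 first.
- by apply: rintD; [exact: prob_rint_cst|exact: rintZ].
- exact: rintZ.
rewrite RintegralD//; [|exact: prob_rint_cst|exact: rintZ].
rewrite !RintegralZl// Rintegral_cst//.
have -> : fine (P0 [set: T0]) = 1.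
  by transitivity (fine (1%E : \bar R)) => //; congr fine; exact: probability_setT.
have := sqr_ge0 (th * e); rewrite !expr2; lra.
Qed.

Lemma mean_mgf (la : R) : `|la| * (4 * U) <= n%:R ->
  rint P (fun w => expR (la * centered_mean w)) /\
  (\int[P]_w expR (la * centered_mean w))%R <= expR (2 * la ^+ 2 * v / n%:R).
Proof.
move=> laU; have nn0 : 0 < n%:R :> R by rewrite ltr0n.
pose th := la / n%:R.
have thU : `|th| * (4 * U) <= 1.
  by rewrite normrM [X in _ * X * _]gtr0_norm ?invr_gt0// mulrAC ler_pdivrMr// mul1r.
pose h y := expR (th * (g y - e)).
have mh : measurable_fun setT (h : measurableTypeR R -> R).
  apply: (measurableT_comp (@measurable_expR R)); apply: measurable_funM => //.
  exact: measurable_funB.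
have hB y : 0 <= h y <= expR 1.
  rewrite expR_ge0 ler_expR; apply: le_trans (ler_norm _) _; rewrite normrM.
  have : `|g y - e| <= 2 * U by apply: le_trans (ler_normB _ _) _; move: (gU y) eU; lra.
  move=> hy; apply: le_trans (ler_wpM2l (normr_ge0 th) hy) _; have := normr_ge0 th; nra.
have E w : expR (la * centered_mean w) = \prod_(m < n) h (Y m w).
  rewrite /h -expR_sum; congr expR; rewrite -mulr_sumr sumrB sumr_const card_ord.
  by rewrite /centered_mean /th -mulr_natr; field; rewrite gt_eqF.
have mc := measurable_centered_mean.
split.
  apply: (@bounded_rint _ _ _ _ _ (expR 1 ^+ n)) => [|w].
    by apply: (measurableT_comp (@measurable_expR R)); exact: measurable_funM.
  rewrite ger0_norm ?expR_ge0// E -[X in _ <= _ ^+ X]card_ord -prodr_const.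
  by apply: ler_prod => m _; exact: hB.
rewrite (Rint_eq P E) (independent_prod iidY.1 mh hB).
apply: (@le_trans _ _ (\prod_(m < n) expR (2 * th ^+ 2 * v))).
  apply: ler_prod => m _; apply/andP; split.
    by apply: Rintegral_ge0 => w _; exact: expR_ge0.
  rewrite (Rint_copy (B := expR 1) m mh); first exact: one_mgf.
  by move=> y; rewrite ger0_norm ?expR_ge0//; have /andP[] := hB y.
rewrite prodr_const card_ord -expRM_natl ler_expR /th le_eqVlt; apply/orP; left; apply/eqP.
by field; rewrite gt_eqF.
Qed.

(** Preferred to the exponential because its mean is of the order of the second
    moment, hence summable over an infinite family of functions. *)
Definition cosh1 w (la : R) : R :=
  (expR (la * centered_mean w) + expR (- la * centered_mean w)) / 2 - 1.

Lemma cosh1_ge0 w la : 0 <= cosh1 w la.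
Proof.
have := expR_ge1Dx (la * centered_mean w); have := expR_ge1Dx (- la * centered_mean w).
rewrite /cosh1 !mulNr; lra.
Qed.

Lemma mean_cosh1 (la : R) : `|la| * (4 * U) <= n%:R ->
  rint P (fun w => cosh1 w la) /\
  (\int[P]_w cosh1 w la)%R <= 2 * la ^+ 2 * v / n%:R * expR (2 * la ^+ 2 * v / n%:R).
Proof.
move=> laU; have [i1 l1] := mean_mgf laU.
have [i2 l2] := @mean_mgf (- la) (eq_ind_r (fun x => x * _ <= _) laU (normrN la)).
rewrite sqrrN in l2.
have E : (fun w => cosh1 w la) =
   (fun w => 2^-1 * (expR (la * centered_mean w) + expR (- la * centered_mean w)) - cst 1 w).
  by apply/funext => w; rewrite /cosh1 mulrC.
have i3 := rintZ 2^-1 (rintD i1 i2).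
rewrite E; split; first by apply: rintB => //; exact: prob_rint_cst.
rewrite RintegralB//; last exact: prob_rint_cst.
rewrite RintegralZl//; last exact: rintD.
rewrite RintegralD// Rintegral_cst//.
have -> : fine (P [set: T]) = 1.
  by transitivity (fine (1%E : \bar R)) => //; congr fine; exact: probability_setT.
apply: le_trans (expRB1_le _); lra.
Qed.

End one_function.
End maximal_inequality.

(** * A maximal inequality for infinite families *)

Section maximal_inequality_family.
Context d d0 (T : measurableType d) (T0 : measurableType d0) (R : realType).
Variables (P : probability T R) (P0 : probability T0 R) (n : nat).
Variables (Y : 'I_n -> {RV P >-> measurableTypeR R}) (Y0 : T0 -> R).
Hypotheses (n0 : (0 < n)%N) (mY0 : measurable_fun setT (Y0 : T0 -> measurableTypeR R))
  (iidY : iid_copies Y P0 Y0).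
Variables (g : int -> R -> R) (U B s2 la : R).
Hypotheses (mg : forall k, measurable_fun setT (g k : measurableTypeR R -> R))
  (gU : forall k y, `|g k y| <= U)
  (gB : forall y K, zpart (fun k => g k y ^+ 2) K <= B)
  (gs2 : forall k, (\int[P0]_w (g k (Y0 w) ^+ 2))%R <= s2)
  (la0 : 0 < la) (laU : la * (4 * U) <= n%:R).

Let v k := (\int[P0]_w (g k (Y0 w) ^+ 2))%R.

Let r := 2 * la ^+ 2 / n%:R.

Let M := 1 + r * B * expR (r * s2).

Let r0 : 0 <= r. Proof. by rewrite mulr_ge0// mulr_ge0// sqr_ge0. Qed.

Let U0 : 0 <= U. Proof. exact: le_trans (normr_ge0 _) (gU 0 0). Qed.

Let v0 k : 0 <= v k. Proof. by apply: Rintegral_ge0 => w _; exact: sqr_ge0. Qed.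

Let vB K : zpart v K <= B.
Proof.
have i k : rint P0 (fun w => g k (Y0 w) ^+ 2).
  apply: (@bounded_rint _ _ _ _ _ (U ^+ 2)) => [|w].
    by apply: measurable_funX; exact: (measurableT_comp (mg k)).
  by rewrite normrX; apply: lerXn2r; rewrite ?nnegrE.
rewrite zpartE -Rint_sum//.
have -> : B = (\int[P0]_x cst B x)%R.
  rewrite Rintegral_cst//; transitivity (B * fine (1%E : \bar R)); first by rewrite mulr1.
  by congr (_ * fine _); apply/esym; exact: probability_setT.
apply: Rint_le => [||w]; [exact: rint_sum|exact: prob_rint_cst|].
by rewrite -zpartE; exact: gB.
Qed.

Let ch k w := cosh1 P0 Y Y0 (g k) w la.

Let ch0 k w : 0 <= ch k w. Proof. exact: cosh1_ge0. Qed.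

Let laU' : `|la| * (4 * U) <= n%:R. Proof. by rewrite gtr0_norm. Qed.

Let ch_int k : rint P (ch k) /\ (\int[P]_w ch k w)%R <= v k * (r * expR (r * s2)).
Proof.
have [i l] := mean_cosh1 n0 mY0 iidY (mg k) (gU k) laU'.
split=> //; apply: le_trans l _; rewrite -/(v k).
rewrite (_ : 2 * la ^+ 2 * v k / n%:R = r * v k); last by rewrite /r; ring.
rewrite mulrA [X in _ <= X * _]mulrC; apply: ler_wpM2l; first by rewrite mulr_ge0.
by rewrite ler_expR ler_wpM2l// gs2.
Qed.

Let pair (i : nat) w := ch i%:Z w + ch (- i.+1%:Z) w.

Let S w : \bar R := (\sum_(0 <= i <oo) (pair i w)%:E)%E.

Let pair0 i w : 0 <= pair i w. Proof. by rewrite addr_ge0. Qed.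

Let mpair i : measurable_fun setT (pair i).
Proof. by apply: measurable_funD; exact: rint_meas (ch_int _).1. Qed.

Let ch_le_S k w : ((ch k w)%:E <= S w)%E.
Proof.
have pl (i : nat) : ((pair i w)%:E <= S w)%E.
  apply: le_trans (nneseries_lim_ge i.+1 _) => [|j _ _]; last by rewrite lee_fin.
  by rewrite big_nat_recr//= leeDr// sume_ge0// => j _; rewrite lee_fin.
case: k => i; first by apply: le_trans (pl i); rewrite lee_fin lerDl.
by apply: le_trans (pl i); rewrite lee_fin NegzE lerDr.
Qed.

Let mS : measurable_fun setT S.
Proof.
apply: ge0_emeasurable_sum => [k w _ _|k _]; first by rewrite lee_fin.
exact/measurable_EFinP.
Qed.

Let S0 w : (0 <= S w)%E.
Proof. by apply: nneseries_ge0 => i _ _; rewrite lee_fin. Qed.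

Let int_S : (\int[P]_w S w <= (M - 1)%:E)%E.
Proof.
rewrite integral_nneseries//; last 2 first.
- by move=> i; exact/measurable_EFinP.
- by move=> i w _; rewrite lee_fin.
apply: lime_le.
  by apply: is_cvg_nneseries => i _ _; apply: integral_ge0 => w _; rewrite lee_fin.
apply: nearW => K.
have pairE i : (\int[P]_w (pair i w)%:E)%E =
    ((\int[P]_w ch i%:Z w)%R + (\int[P]_w ch (- i.+1%:Z) w)%R)%:E.
  have [a _] := ch_int i%:Z; have [b _] := ch_int (- i.+1%:Z).
  by rewrite (rint_fin (rintD a b)) RintegralD.
under eq_bigr do rewrite pairE.
rewrite sumEFin lee_fin big_mkord.
apply: (@le_trans _ _ (zpart (fun k => v k * (r * expR (r * s2))) K)).
  apply: (zpart_le (u := fun k => (\int[P]_w ch k w)%R)) => k; exact: (ch_int k).2.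
have -> : (fun k => v k * (r * expR (r * s2))) = (fun k => r * expR (r * s2) * v k).
  by apply/funext => k; rewrite mulrC.
rewrite zpartZ /M addrAC subrr add0r [r * B * _]mulrAC.
by rewrite ler_wpM2l// mulr_ge0// expR_ge0.
Qed.

Let B0 : 0 <= B. Proof. by have := gB 0 0; rewrite /zpart big_ord0. Qed.

Let M1 : 1 <= M.
Proof. by rewrite lerDl mulr_ge0 ?expR_ge0// mulr_ge0. Qed.

Let M0 : 0 < M. Proof. exact: lt_le_trans M1. Qed.

Let c := ln 2 + ln M + M^-1 - 1.

Let c0 : 0 <= c.
Proof.
have := ln_le_div ltr01 M0; rewrite ln1 div1r => h.
have : 0 <= ln 2 :> R by apply: ln_ge0; rewrite ler1n.
by rewrite /c; lra.
Qed.

(** Each [exp (la * |G|)] is at most [2 * (1 + S)], where [S] is the sum of the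
    [cosh1] over the whole family: its mean is bounded by the sum of the second
    moments, hence by [B]. The logarithm is bounded by its tangent at [M], which
    makes [Z] affine in [S] and thus measurable with an explicit mean. *)
Lemma maximal_inequality : exists Z : T -> \bar R,
  [/\ measurable_fun setT Z, forall w, (0 <= Z w)%E,
    (forall w k, (`|centered_mean P0 Y Y0 (g k) w|%:E <= Z w)%E) &
    (\int[P]_w Z w <= (la^-1 * (ln 2 + ln M))%:E)%E].
Proof.
have li : (0 <= (la^-1)%:E)%E by rewrite lee_fin invr_ge0 ltW.
have Mi : (0 <= (M^-1)%:E)%E by rewrite lee_fin invr_ge0 ltW.
have cS w : (0 <= c%:E + (M^-1)%:E * S w)%E.
  by apply: adde_ge0; [rewrite lee_fin|exact: mule_ge0].
have mcS : measurable_fun setT (fun w => c%:E + (M^-1)%:E * S w)%E.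
  by apply: emeasurable_funD; [exact: measurable_cst|exact: measurable_funeM].
exists (fun w => (la^-1)%:E * (c%:E + (M^-1)%:E * S w))%E; split.
- exact: measurable_funeM.
- by move=> w; exact: mule_ge0.
- move=> w k; set G := centered_mean _ _ _ _ _.
  apply: (@le_trans _ _ ((la^-1)%:E * (c%:E + (M^-1)%:E * (ch k w)%:E))%E); last first.
    by apply: lee_wpmul2l => //; apply: leeD2l; exact: lee_wpmul2l.
  change (`|G|%:E <= (la^-1 * (c + M^-1 * ch k w))%:E)%E.
  rewrite lee_fin mulrC ler_pdivlMr// mulrC.
  have e2 : expR (la * `|G|) <= 2 * (1 + ch k w).
    rewrite /ch /cosh1 -/G.
    have [h|h] := ger0P G.
      by have := expR_ge0 (- la * G); lra.
    by rewrite mulrN -mulNr; have := expR_ge0 (la * G); lra.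
  have p1 : 0 < 1 + ch k w by rewrite ltr_pwDl.
  have : la * `|G| <= ln (2 * (1 + ch k w)).
    by rewrite -ler_expR lnK// posrE mulr_gt0.
  rewrite lnM ?posrE//; have := ln_le_div p1 M0; rewrite mulrDl div1r /c.
  by rewrite [ch k w / M]mulrC; lra.
- rewrite ge0_integralZl//.
  rewrite ge0_integralD//; last 2 first.
  + by move=> w _; exact: mule_ge0.
  + exact: measurable_funeM.
  have -> : (\int[P]__ c%:E = c%:E)%E.
    rewrite integral_cst// -[RHS]mule1; congr (_ * _)%E; exact: probability_setT.
  rewrite ge0_integralZl// EFinM; apply: lee_wpmul2l => //.
  apply: (@le_trans _ _ (c%:E + (M^-1)%:E * (M - 1)%:E)%E).
    by apply: leeD2l; exact: lee_wpmul2l.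
  change ((c + M^-1 * (M - 1))%:E <= (ln 2 + ln M)%:E)%E.
  by rewrite lee_fin /c mulrBr mulVf ?gt_eqF// mulr1; lra.
Qed.

End maximal_inequality_family.

(** * Dual functions and bias *)

Section weighted_zsums.
Context (R : realType).
Variables (rho : int -> R) (Phi : R).
Hypothesis rhoPhi : forall K, zpart (fun k => `|rho k|) K <= Phi.
Implicit Types (u v : int -> R) (B : R).

Lemma weighted_dom u B : (forall k, `|u k| <= B) ->
  (forall k, `|rho k * u k| <= B * `|rho k|) /\
  (forall K, zpart (fun k => B * `|rho k|) K <= B * Phi).
Proof.
move=> uB; have B0 : 0 <= B by exact: le_trans (normr_ge0 _) (uB 0).
split=> [k|K]; first by rewrite normrM mulrC ler_wpM2r.
by rewrite zpartZ ler_wpM2l.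
Qed.

Lemma weighted_zsum_cvg u B : (forall k, `|u k| <= B) ->
  zpart (fun k => rho k * u k) @ \oo --> zsum (fun k => rho k * u k).
Proof. by move=> /weighted_dom[h1 h2]; exact: zpart_cvg h1 h2. Qed.

Lemma weighted_zsum_le u B : (forall k, `|u k| <= B) ->
  `|zsum (fun k => rho k * u k)| <= B * Phi.
Proof. by move=> /weighted_dom[h1 h2]; exact: zsum_le h1 h2. Qed.

Lemma weighted_zsumD u v B : (forall k, `|u k| <= B) -> (forall k, `|v k| <= B) ->
  zsum (fun k => rho k * (u k + v k)) =
  zsum (fun k => rho k * u k) + zsum (fun k => rho k * v k).
Proof.
move=> uB vB; apply: cvg_lim => //.
have -> : (fun N : nat => \sum_(i < N) (rho i%:Z * (u i%:Z + v i%:Z) +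
      rho (- i.+1%:Z) * (u (- i.+1%:Z) + v (- i.+1%:Z)))) =
    (fun K => zpart (fun k => rho k * u k) K + zpart (fun k => rho k * v k) K).
  apply/funext => K; rewrite -[LHS]/(zpart (fun k => rho k * (u k + v k)) K) !zpartE.
  by rewrite -big_split; apply: eq_bigr => k _; rewrite mulrDr.
by apply: cvgD; exact: weighted_zsum_cvg.
Qed.

Lemma weighted_zsumZ (c : R) u B : (forall k, `|u k| <= B) ->
  zsum (fun k => rho k * (c * u k)) = c * zsum (fun k => rho k * u k).
Proof.
move=> uB; have [h1 h2] := weighted_dom uB.
by rewrite -(zsumZ c h1 h2); congr zsum; apply/funext => k; rewrite mulrCA.
Qed.

Lemma weighted_zsum_sum n (u : 'I_n -> int -> R) B : (forall m k, `|u m k| <= B) ->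
  zsum (fun k => rho k * \sum_(m < n) u m k) = \sum_(m < n) zsum (fun k => rho k * u m k).
Proof.
move=> uB; apply: cvg_lim => //.
have -> : (fun N : nat => \sum_(i < N) (rho i%:Z * (\sum_(m < n) u m i%:Z) +
      rho (- i.+1%:Z) * (\sum_(m < n) u m (- i.+1%:Z)))) =
    (fun K => \sum_(m < n) zpart (fun k => rho k * u m k) K).
  apply/funext => K; rewrite -[LHS]/(zpart (fun k => rho k * (\sum_(m < n) u m k)) K).
  under [RHS]eq_bigr do rewrite zpartE.
  by rewrite exchange_big zpartE; apply: eq_bigr => k _; rewrite mulr_sumr.
by apply: cvg_sumr => m; apply: weighted_zsum_cvg; exact: uB.
Qed.

End weighted_zsums.

Section estimator.
Context (R : realType).
Local Notation mu := (@lebesgue_measure R).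
Variables (phi : R -> R) (a' a Phi : R).
Hypotheses (iphi : rint mu phi) (a'0 : 0 < a') (a'a : a' < a)
  (Sphi : fourier_support phi `<=` `[- a, a]%classic)
  (phiPhi : forall x K, zpart (fun k => `|translate phi k x|) K <= Phi)
  (rep : forall tau z : R, `|tau| < a' ->
    zsum (fun k => complex.Re (fourier (translate phi k) tau) * translate phi k z)
      = cos (tau * z) /\
    zsum (fun k => complex.Im (fourier (translate phi k) tau) * translate phi k z)
      = - sin (tau * z)).
Variables (law : probability (measurableTypeR R) R) (N Bm : R).
Hypotheses (N0 : 0 < N) (law0 : forall t, fourier_law law t != 0)
  (lawB : forall t, `|t| <= N * a -> (normc (fourier_law law t))^-1 <= Bm).

Let F1 := (\int[mu]_x `|phi x|)%R.

Let F10 : 0 <= F1. Proof. exact: Rintegral_ge0. Qed.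

Let a0 : 0 < a. Proof. exact: lt_trans a'0 a'a. Qed.

Let Phi0 : 0 <= Phi. Proof. by have := phiPhi 0 0; rewrite /zpart big_ord0. Qed.

(** The Fourier transform of the dual function [dual_phi], with [N] for [2 ^ j]. *)
Definition spectrum (k : int) (t : R) : R[i] :=
  fourier (translate phi k) (N^-1 * t) / (N%:C * conjc (fourier_law law t)).

(** One majorant for all the spectra: [phi] is band-limited, and [Bm] bounds the
    inverse of the noise transform on the dilated band. *)
Definition envelope (t : R) : R := F1 * Bm / N * \1_`[- (N * a), N * a]%classic t.

Lemma fourier_translate k t : fourier (translate phi k) t = expi (- (k%:~R * t)) * fourier phi t.
Proof.
have := fourier_affine (- k%:~R) t ltr01 iphi.
rewrite invr1 !mulr1 mul1r mulrN [t * _]mulrC => <-.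
by congr fourier; apply/funext => x; rewrite mul1r.
Qed.

Lemma fourier_translate_le k t : normc (fourier (translate phi k) t) <= F1.
Proof. by rewrite fourier_translate normcM normc_expi mul1r; exact: fourier_le. Qed.

Let Bm0 : 0 <= Bm.
Proof.
apply: le_trans (lawB (t := 0) _); first by rewrite invr_ge0 normc_ge0.
by rewrite normr0 mulr_ge0// ltW.
Qed.

Lemma envelope_le t : envelope t <= F1 * Bm / N.
Proof.
apply: ler_piMr; first by rewrite divr_ge0 ?mulr_ge0// ltW.
by rewrite indicE; case: (_ \in _); rewrite ?ler01.
Qed.

Let NaNa : - (N * a) <= N * a. Proof. by rewrite ge0_cp// mulr_ge0// ltW. Qed.

Lemma rint_envelope : rint mu envelope.
Proof. by apply: rintZ; exact: (rint_indic_itv NaNa).1. Qed.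

Lemma Rint_envelope : (\int[mu]_t envelope t)%R = F1 * Bm * (2 * a).
Proof.
rewrite RintegralZl//; last exact: (rint_indic_itv NaNa).1.
by rewrite (rint_indic_itv NaNa).2; field; rewrite gt_eqF.
Qed.

Lemma spectrum_le k t : normc (spectrum k t) <= envelope t.
Proof.
rewrite /spectrum normcM normcV normcM normc_conj normcR gtr0_norm// fourier_translate.
rewrite normcM normc_expi mul1r /envelope.
have NE u : (N^-1 * u \in `[- a, a]%classic) = (u \in `[- (N * a), N * a]%classic).
  have e : (N^-1 * `|u| <= a) = (`|u| <= N * a) by rewrite mulrC ler_pdivrMr// [a * _]mulrC.
  by apply/idP/idP; rewrite !inE/= !in_itv/= -!ler_norml normrM gtr0_norm ?invr_gt0// e.
have h := fourier_le_indic (N^-1 * t) iphi Sphi.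
rewrite indicE NE in h; rewrite indicE.
have [tN|tN] := boolP (t \in _).
  rewrite tN in h.
  rewrite mulr1 in h; rewrite mulr1 invfM mulrA [F1 * Bm / N]mulrAC.
  apply: ler_pM; rewrite ?divr_ge0 ?normc_ge0 ?invr_ge0 ?normc_ge0 ?(ltW N0)//.
    by rewrite ler_pM2r ?invr_gt0.
  by apply: lawB; move: tN; rewrite inE/= in_itv/= -ler_norml.
rewrite (negbTE tN) mulr0 in h; rewrite mulr0.
have -> : normc (fourier phi (N^-1 * t)) = 0 by apply/eqP; rewrite eq_le h normc_ge0.
by rewrite mul0r.
Qed.

Lemma cmeas_fourier_law : cmeas (fourier_law law : measurableTypeR R -> R[i]).
Proof.
apply: (cmeas_param (m := law)
  (F := fun z : measurableTypeR R * measurableTypeR R => expi (- (z.1 * z.2))) (b := fun=> 1)).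
- by apply: cmeas_expi; apply: measurable_funN; exact: measurable_funM.
- exact: prob_rint_cst.
- by move=> t x; rewrite normc_expi.
Qed.

Lemma cmeas_spectrum k : cmeas (spectrum k).
Proof.
apply: cmeasM.
  have := cmeas_affine N^-1 0 (cmeas_fourier (translate_rint k iphi).1).
  by under eq_fun do rewrite addr0.
apply: cmeasV; apply: cmeasM; first exact: cmeas_cst.
exact: cmeas_conj cmeas_fourier_law.
Qed.

Definition dual (k : int) (y : R) : R[i] := ((2 * pi)^-1)%:C * spectral (spectrum k) y.

Let p2 : 0 < (2 * pi)^-1 :> R. Proof. by rewrite invr_gt0 mulr_gt0// pi_gt0. Qed.

Lemma dual_le k y : normc (dual k y) <= (2 * pi)^-1 * (F1 * Bm * (2 * a)).
Proof.
rewrite normcM normcR gtr0_norm// ler_pM2l// -Rint_envelope.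
exact: (normc_spectral (cmeas_spectrum k) rint_envelope (spectrum_le k)).
Qed.

Lemma cmeas_dual k : cmeas (dual k : measurableTypeR R -> R[i]).
Proof.
apply: cmeasM; first exact: cmeas_cst.
exact: (cmeas_spectral (cmeas_spectrum k) rint_envelope (spectrum_le k)).
Qed.

(** The spectra differ only by the phases [expi (- (k * t / N))], so that the
    values at [y] of the dual functions are trigonometric coefficients of a
    single function. The functions [expi (k * t / N)] are orthogonal over
    [- J * pi * N, J * pi * N], which contains its support. *)
Lemma dual_bessel (J : nat) y K : a <= J%:R * pi ->
  zpart (fun k => normc (dual k y) ^+ 2) K <=
  (2 * pi)^-1 ^+ 2 * (2 * (J%:R * pi * N) * (F1 * Bm / N * (F1 * Bm * (2 * a)))).
Proof.
move=> aJ; set L := J%:R * pi * N.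
have L0 : 0 < L by rewrite mulr_gt0// (lt_le_trans a0).
have NL : N^-1 * L = J%:R * pi by rewrite /L mulrC mulfK// gt_eqF.
have Ni : 0 < N^-1 by rewrite invr_gt0.
pose H t := spectrum 0 t * expi (t * y).
have mH : cmeas H.
  by apply: cmeasM; [exact: cmeas_spectrum|apply: cmeas_expi; exact: measurable_funM].
have HE t : normc (H t) <= envelope t.
  by rewrite normcM normc_expi mulr1 spectrum_le.
have EI t : envelope t = envelope t * \1_`[- L, L]%classic t.
  rewrite /envelope -[RHS]mulrA; congr (_ * _); rewrite !indicE.
  case: (boolP (t \in `[- (N * a), N * a]%classic)) => [tN|_]; last by rewrite mul0r.
  rewrite mul1r mem_set//; move: tN; rewrite inE/= !in_itv/= -!ler_norml => tN.
  by apply: le_trans tN _; rewrite /L mulrC ler_pM2r.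
have := trig_bessel Ni L0 NL mH rint_envelope HE envelope_le EI (uniq_zwindow K).
rewrite Rint_envelope => h.
rewrite zpartE.
have -> : \sum_(k <- zwindow K) normc (dual k y) ^+ 2 = (2 * pi)^-1 ^+ 2 *
   \sum_(k <- zwindow K) normc (cintegral mu (fun t => H t * expi (- (N^-1 * k%:~R * t)))) ^+ 2.
  rewrite mulr_sumr; apply: eq_bigr => k _; rewrite /dual normcM normcR gtr0_norm// exprMn.
  congr (_ * normc _ ^+ 2); apply: eq_cintegral => t.
  have e0 : expi (- ((0 : int)%:~R * (N^-1 * t))) = 1 :> R[i].
    by rewrite mul0r oppr0 expi0.
  rewrite /H /spectrum !fourier_translate e0.
  by rewrite (_ : k%:~R * (N^-1 * t) = N^-1 * k%:~R * t); ring.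
by apply: ler_wpM2l => //; exact: sqr_ge0.
Qed.


Variable f : R -> R.
Hypotheses (fi : rint mu f) (cf : continuous f)
  (Ffi : rint mu (fun t => normc (fourier f t))).
Context d0 (T0 : measurableType d0) (P0 : probability T0 R) (Y0 : T0 -> R).
Hypotheses (mY0 : measurable_fun setT (Y0 : T0 -> measurableTypeR R))
  (law1 : forall u, normc (fourier_law law u) <= 1)
  (charY : forall u, cintegral P0 (fun w => expi (u * Y0 w)) =
     conjc (fourier f u) * conjc (fourier_law law u)).

Let Kf := (\int[mu]_t normc (fourier f t))%R.

(** Smaller by a factor [N] than the square of the uniform bound [dual_le]: the
    integrability of the transform of [f] replaces the length of the band. *)
Lemma dual_second_moment k :
  (\int[P0]_w (normc (dual k (Y0 w)) ^+ 2))%R <=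
  (2 * pi)^-1 ^+ 2 * (F1 * Bm * (2 * a) * (F1 * Bm / N * Kf)).
Proof.
have ms := cmeas_spectrum k; have sl := spectrum_le k.
have cle u : normc (cintegral P0 (fun w => expi (u * Y0 w))) <= normc (fourier f u).
  rewrite charY normcM !normc_conj; apply: ler_piMr; [exact: normc_ge0|exact: law1].
have mch : cmeas ((fun u : R => cintegral P0 (fun w => expi (u * Y0 w))) :
    measurableTypeR R -> R[i]).
  have -> : (fun u : R => cintegral P0 (fun w => expi (u * Y0 w))) =
      (fun u => conjc (fourier f u) * conjc (fourier_law law u)).
    by apply/funext => u; exact: charY.
  apply: cmeasM; apply: cmeas_conj; [exact: cmeas_fourier|exact: cmeas_fourier_law].
have ci : rint mu (fun u : R => normc (cintegral P0 (fun w => expi (u * Y0 w)))).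
  apply: (rint_le (cmeas_normc mch) Ffi) => u.
  by rewrite ger0_norm ?normc_ge0.
have cK : (\int[mu]_u normc (cintegral P0 (fun w => expi (u * Y0 w))))%R <= Kf.
  exact: Rint_le.
have := spectral_second_moment ms rint_envelope sl envelope_le mY0 ci cK.
rewrite Rint_envelope => h.
have -> : (\int[P0]_w (normc (dual k (Y0 w)) ^+ 2))%R =
    (\int[P0]_w ((2 * pi)^-1 ^+ 2 * normc (spectral (spectrum k) (Y0 w)) ^+ 2))%R.
  by apply: Rint_eq => w; rewrite /dual normcM normcR gtr0_norm// exprMn.
rewrite RintegralZl//; first by apply: ler_wpM2l => //; exact: sqr_ge0.
apply: (@bounded_rint _ _ _ _ _ ((F1 * Bm * (2 * a)) ^+ 2)) => [|w].
  apply: measurable_funX; apply: cmeas_normc.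
  exact: cmeas_comp mY0 (cmeas_spectral ms rint_envelope sl).
rewrite ger0_norm ?sqr_ge0// -Rint_envelope; apply: lerXn2r; rewrite ?nnegrE ?normc_ge0//.
  by apply: le_trans (normc_ge0 _) (normc_spectral ms rint_envelope sl 0).
exact: (normc_spectral ms rint_envelope sl).
Qed.

Definition dual_mean k := cintegral P0 (fun w => dual k (Y0 w)).

(** Deconvolution: the transform of the noise, brought by the observations,
    cancels the denominator of the spectrum. *)
Lemma dual_meanE k : dual_mean k = ((2 * pi)^-1 / N)%:C *
  cintegral mu (fun t => conjc (fourier f t) * fourier (translate phi k) (N^-1 * t)).
Proof.
have ms := cmeas_spectrum k; have sl := spectrum_le k.
have [h e] := spectral_expectation ms rint_envelope sl P0 mY0 0.
have E1 : (fun w => expi (0 * Y0 w) * spectral (spectrum k) (Y0 w)) =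
    (fun w => spectral (spectrum k) (Y0 w)).
  by apply/funext => w; rewrite mul0r expi0 mul1r.
rewrite E1 in h e.
rewrite /dual_mean /dual (cintegralZ _ h).2 e rmorphM/= -mulrA; congr (_ * _).
have ig : cintble mu (fun t => conjc (fourier f t) * fourier (translate phi k) (N^-1 * t)).
  apply: (cintble_le _ (rintZ F1 Ffi)) => [|t].
    apply: cmeasM; first exact/cmeas_conj/cmeas_fourier.
    have := cmeas_affine N^-1 0 (cmeas_fourier (translate_rint k iphi).1).
    by under eq_fun do rewrite addr0.
  by rewrite normcM normc_conj mulrC ler_wpM2r ?normc_ge0// fourier_translate_le.
rewrite -(cintegralZ _ ig).2; apply: eq_cintegral => t.
rewrite addr0 charY /spectrum.
have l0 : conjc (fourier_law law t) != 0.
  apply: contra (law0 t) => /eqP h0.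
  by apply/eqP; rewrite -(conj_conjc (fourier_law _ _)) h0; apply: complex_eqP; rewrite /= ?oppr0.
have Nc : N%:C != 0 :> R[i].
  by apply/eqP => /(congr1 (@complex.Re R))/= /eqP; rewrite gt_eqF.
have -> : (N^-1)%:C = N%:C^-1 :> R[i].
  by apply: (mulfI Nc); rewrite -rmorphM/= divff ?gt_eqF// divff.
by field; rewrite Nc l0.
Qed.

Let G (t : R) : R := ((N * a' <= `|t|)%R : bool)%:R.

(** On frequencies below [N * a'] the expansion reproduces the exponentials, so
    that only the spectral tail of [f] contributes to the bias. *)
Lemma bias_le x :
  normc (N%:C * czsum (fun k => (phi (N * x - k%:~R))%:C * dual_mean k) - (f x)%:C) <=
  (2 * pi)^-1 * (2 * (F1 * Phi) + 1) * (\int[mu]_t (G t * normc (fourier f t)))%R.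
Proof.
pose rho k := translate phi k (N * x).
have rP K : zpart (fun k => `|rho k|) K <= Phi by exact: phiPhi.
pose ph k t := fourier (translate phi k) (N^-1 * t).
have phR t k : `|complex.Re (ph k t)| <= F1.
  exact: le_trans (normc_Re _) (fourier_translate_le _ _).
have phI t k : `|complex.Im (ph k t)| <= F1.
  exact: le_trans (normc_Im _) (fourier_translate_le _ _).
pose D t : R[i] := zsum (fun k => rho k * complex.Re (ph k t)) +i*
   zsum (fun k => rho k * complex.Im (ph k t)).
pose W K t := conjc (fourier f t) * \sum_(k <- zwindow K) (rho k)%:C * ph k t.
have mph k : cmeas (ph k : measurableTypeR R -> R[i]).
  have := cmeas_affine N^-1 0 (cmeas_fourier (translate_rint k iphi).1).
  by under eq_fun do rewrite addr0.
have mW K : cmeas (W K : measurableTypeR R -> R[i]).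
  apply: cmeasM; first exact/cmeas_conj/cmeas_fourier.
  by apply: cmeas_sum => k; apply: cmeasM => //; exact: cmeas_cst.
have WB K t : normc (W K t) <= (F1 * Phi) * normc (fourier f t).
  rewrite normcM normc_conj mulrC ler_wpM2r ?normc_ge0//.
  apply: le_trans (normc_sum _ _) _; apply: (@le_trans _ _ (F1 * zpart (fun k => `|rho k|) K)).
    rewrite zpartE mulr_sumr; apply: ler_sum => k _; rewrite normcM normcR mulrC.
    by rewrite ler_wpM2r// fourier_translate_le.
  by rewrite ler_wpM2l.
have SR K t : complex.Re (\sum_(k <- zwindow K) (rho k)%:C * ph k t) =
    zpart (fun k => rho k * complex.Re (ph k t)) K.
  rewrite zpartE; elim: (zwindow K) => [|k s IH]; first by rewrite !big_nil.
  by rewrite !big_cons ReD IH ReM/= mul0r subr0.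
have SI K t : complex.Im (\sum_(k <- zwindow K) (rho k)%:C * ph k t) =
    zpart (fun k => rho k * complex.Im (ph k t)) K.
  rewrite zpartE; elim: (zwindow K) => [|k s IH]; first by rewrite !big_nil.
  by rewrite !big_cons ImD IH ImM/= mul0r addr0.
have cR t : (fun K => complex.Re (W K t)) @ \oo --> complex.Re (conjc (fourier f t) * D t).
  rewrite ReM/=; under eq_fun do rewrite /W ReM SR SI.
  by apply: cvgB; apply: cvgMr; apply: (weighted_zsum_cvg rP); [exact: phR|exact: phI].
have cI t : (fun K => complex.Im (W K t)) @ \oo --> complex.Im (conjc (fourier f t) * D t).
  rewrite ImM/=; under eq_fun do rewrite /W ImM SR SI.
  by apply: cvgD; apply: cvgMr; apply: (weighted_zsum_cvg rP); [exact: phI|exact: phR].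
have [iD lR lI] := @cintegral_dct _ _ R mu W (fun t => conjc (fourier f t) * D t) _
  mW cR cI (rintZ (F1 * Phi) Ffi) WB.
have ic k : cintble mu (fun t => conjc (fourier f t) * ph k t).
  apply: (cintble_le _ (rintZ F1 Ffi)) => [|t].
    by apply: cmeasM => //; exact/cmeas_conj/cmeas_fourier.
  by rewrite normcM normc_conj mulrC ler_wpM2r ?normc_ge0// fourier_translate_le.
have Wint K : cintegral mu (W K) = (2 * pi * N)%:C * \sum_(k <- zwindow K) (rho k)%:C * dual_mean k.
  have WE : W K = (fun t => \sum_(k <- zwindow K) (rho k)%:C * (conjc (fourier f t) * ph k t)).
    by apply/funext => t; rewrite /W mulr_sumr; apply: eq_bigr => k _; rewrite mulrCA.
  have ick k := cintegralZ (rho k)%:C (ic k).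
  have [_ e] := @cintegral_sum _ _ _ mu _ (zwindow K)
    (fun k t => (rho k)%:C * (conjc (fourier f t) * ph k t)) (fun k => (ick k).1).
  rewrite WE e mulr_sumr; apply: eq_bigr => k _; rewrite (ick k).2 dual_meanE.
  rewrite [in RHS]mulrCA; congr (_ * _); rewrite mulrA -rmorphM/=.
  have -> : 2 * pi * N * ((2 * pi)^-1 / N) = 1.
    by rewrite mulrACA divff ?gt_eqF ?mulr_gt0 ?pi_gt0// mul1r divff// gt_eqF.
  by rewrite rmorph1 mul1r.
have mB k : normc (dual_mean k) <= (2 * pi)^-1 / N * (F1 * Kf).
  rewrite dual_meanE normcM normcR ger0_norm; last by rewrite divr_ge0 ?ltW.
  apply: ler_wpM2l; first by rewrite divr_ge0 ?ltW.
  rewrite /Kf -RintegralZl//; apply: normc_cintegral => [||t].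
  - exact: cintble_meas (ic k).
  - exact: rintZ.
  - by rewrite normcM normc_conj mulrC ler_wpM2r ?normc_ge0// fourier_translate_le.
have mBR k : `|complex.Re (dual_mean k)| <= (2 * pi)^-1 / N * (F1 * Kf).
  exact: le_trans (normc_Re _) (mB k).
have mBI k : `|complex.Im (dual_mean k)| <= (2 * pi)^-1 / N * (F1 * Kf).
  exact: le_trans (normc_Im _) (mB k).
have p20 : 0 < 2 * pi :> R by rewrite mulr_gt0// pi_gt0.
have E : (2 * pi)%:C * (N%:C * czsum (fun k => (rho k)%:C * dual_mean k)) =
    cintegral mu (fun t => conjc (fourier f t) * D t).
  have SmR K : complex.Re (\sum_(k <- zwindow K) (rho k)%:C * dual_mean k) =
      zpart (fun k => rho k * complex.Re (dual_mean k)) K.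
    rewrite zpartE; elim: (zwindow K) => [|k s IH]; first by rewrite !big_nil.
    by rewrite !big_cons ReD IH ReM/= mul0r subr0.
  have SmI K : complex.Im (\sum_(k <- zwindow K) (rho k)%:C * dual_mean k) =
      zpart (fun k => rho k * complex.Im (dual_mean k)) K.
    rewrite zpartE; elim: (zwindow K) => [|k s IH]; first by rewrite !big_nil.
    by rewrite !big_cons ImD IH ImM/= mul0r addr0.
  have zR : zsum (fun k => complex.Re ((rho k)%:C * dual_mean k)) =
      zsum (fun k => rho k * complex.Re (dual_mean k)).
    by congr zsum; apply/funext => k; rewrite ReM/= mul0r subr0.
  have zI : zsum (fun k => complex.Im ((rho k)%:C * dual_mean k)) =
      zsum (fun k => rho k * complex.Im (dual_mean k)).
    by congr zsum; apply/funext => k; rewrite ImM/= mul0r addr0.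
  apply: complex_eqP.
    rewrite -(cvg_lim (@Rhausdorff R) lR); apply/esym/cvg_lim => //.
    under eq_fun do rewrite Wint ReM SmR /= mul0r subr0.
    rewrite !ReM/= !mul0r !subr0 zR mulrA.
    by apply: cvgMr; exact: (weighted_zsum_cvg rP mBR).
  rewrite -(cvg_lim (@Rhausdorff R) lI); apply/esym/cvg_lim => //.
  under eq_fun do rewrite Wint ImM SmI /= mul0r addr0.
  rewrite !ImM/= !mul0r !addr0 zI mulrA.
  by apply: cvgMr; exact: (weighted_zsum_cvg rP mBI).
have me1 : measurable_fun setT (fun t : R => t * x) by exact: measurable_funM.
have iinv : cintble mu (fun t => fourier f t * expi (t * x)).
  apply: (cintble_le _ Ffi) => [|t]; last by rewrite normcM normc_expi mulr1.
  by apply: cmeasM; [exact: cmeas_fourier|exact: cmeas_expi].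
have iinv2 : cintble mu (fun t => conjc (fourier f t) * expi (- (t * x))) /\
    cintegral mu (fun t => conjc (fourier f t) * expi (- (t * x))) = (2 * pi * f x)%:C.
  have [i e] := cintegral_conj iinv.
  have Ef : (fun t => conjc (fourier f t * expi (t * x))) =
      (fun t => conjc (fourier f t) * expi (- (t * x))).
    by apply/funext => t; rewrite conjcM conj_expi.
  rewrite Ef in i e; split=> //; rewrite e fourier_inversion ?conjcR//; exact: cf.
have [iB eB] := cintegralB iD iinv2.1.
rewrite iinv2.2 -E in eB.
have -> : N%:C * czsum (fun k => (phi (N * x - k%:~R))%:C * dual_mean k) - (f x)%:C =
    ((2 * pi)^-1)%:C * cintegral mu (fun t => conjc (fourier f t) * D t -
       conjc (fourier f t) * expi (- (t * x))).
  rewrite eB -[X in N%:C * X]/(czsum (fun k => (rho k)%:C * dual_mean k)).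
  rewrite [(2 * pi * f x)%:C]rmorphM/= -mulrBr mulrA -rmorphM/= mulVf ?gt_eqF//.
  by rewrite rmorph1 mul1r.
rewrite normcM normcR gtr0_norm// -mulrA; apply: ler_wpM2l; first exact: ltW.
have iG : rint mu (fun t => G t * normc (fourier f t)).
  apply: (rint_le _ Ffi) => [|t].
    apply: measurable_funM; last exact: rint_meas Ffi.
    have -> : G = (fun t => if N * a' <= `|t| then 1 else 0).
      by apply/funext => t; rewrite /G; case: ifP.
    by apply: measurable_fun_ifT => //; apply: measurable_fun_ler => //; exact: measurableT_comp.
  rewrite normrM [X in _ * X]ger0_norm ?normc_ge0// ler_piMl ?normc_ge0//.
  by rewrite /G; case: (N * a' <= `|t|); rewrite ?normr1 ?normr0.
rewrite -RintegralZl//; apply: normc_cintegral => [||t].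
- exact: cintble_meas iB.
- exact: rintZ.
rewrite -mulrBr normcM normc_conj /G.
have [tN|tN] := leP (N * a') `|t|.
  rewrite mul1r mulrC ler_wpM2r ?normc_ge0//.
  apply: le_trans (ler_normcD _ _) _; rewrite normcNE normc_expi lerD2r.
  apply: le_trans (normc_le_ReIm _) _ => /=.
  have h1 := weighted_zsum_le rP (phR t); have h2 := weighted_zsum_le rP (phI t); lra.
rewrite mul0r mulr0 (_ : D t - _ = 0) ?normc0 ?mulr0//.
have tau : `|N^-1 * t| < a'.
  by rewrite normrM gtr0_norm ?invr_gt0// mulrC ltr_pdivrMr// mulrC.
have [rR rI] := rep (N * x) tau.
have e1 : N^-1 * t * (N * x) = t * x by rewrite mulrACA mulVf ?gt_eqF// mul1r.
rewrite e1 in rR rI.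
have -> : D t = expi (- (t * x)); last by rewrite subrr.
apply: complex_eqP => /=; rewrite ?cosN ?sinN -?rR -?rI;
  by congr zsum; apply/funext => k; rewrite mulrC.
Qed.

End estimator.

(** * Error at a point *)

Section pointwise_error.
Context (R : realType).
Local Notation mu := (@lebesgue_measure R).
Variables (phi : R -> R) (Phi : R) (law : probability (measurableTypeR R) R) (j N : R).
Hypotheses (phiPhi : forall x K, zpart (fun k => `|translate phi k x|) K <= Phi)
  (Phi0 : 0 < Phi) (N0 : 0 < N) (jN : 2 `^ j = N).

Let ReRM (r : R) z : complex.Re (r%:C * z) = r * complex.Re z.
Proof. by rewrite ReM/= mul0r subr0. Qed.

Let ImRM (r : R) z : complex.Im (r%:C * z) = r * complex.Im z.
Proof. by rewrite ImM/= mul0r addr0. Qed.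

Lemma dual_phiE k y : dual_phi phi law j k y = dual phi law N k y.
Proof.
rewrite /dual_phi /inv_fourier /dual; congr (_ * _); apply: eq_cintegral => t.
by rewrite /spectrum powRN jN.
Qed.

Lemma deconv_kernelE x y : deconv_kernel phi law j x y =
  N%:C * czsum (fun k => (translate phi k (N * x))%:C * dual phi law N k y).
Proof.
rewrite /deconv_kernel jN.
have -> : dual_phi phi law j = dual phi law N.
  by apply/funext => k; apply/funext => z; exact: dual_phiE.
by [].
Qed.

Context d0 (T0 : measurableType d0) (P0 : probability T0 R) (Y0 : T0 -> R).
Context d (T : measurableType d) (P : probability T R) (n : nat).
Variable Y : 'I_n -> {RV P >-> measurableTypeR R}.
Hypotheses (n0 : (0 < n)%N) (U : R) (dU : forall k y, normc (dual phi law N k y) <= U).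

Let gR k y := complex.Re (dual phi law N k y).
Let gI k y := complex.Im (dual phi law N k y).

Let gRU k y : `|gR k y| <= U. Proof. exact: le_trans (normc_Re _) (dU k y). Qed.
Let gIU k y : `|gI k y| <= U. Proof. exact: le_trans (normc_Im _) (dU k y). Qed.

(* The real and imaginary parts of the estimator are treated alike. *)
Let part_le (g : int -> R -> R) (gU : forall k y, `|g k y| <= U) (w : T) (z : \bar R) x (b : R) :
  (0 <= z)%E -> (forall k, (`|centered_mean P0 Y Y0 (g k) w|%:E <= z)%E) ->
  (`|n%:R^-1 * \sum_(m < n) N * zsum (fun k => translate phi k x * g k (Y m w)) - b|%:E
   <= (N * Phi)%:E * z +
     `|N * zsum (fun k => translate phi k x * (\int[P0]_w g k (Y0 w))%R) - b|%:E)%E.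
Proof.
have NP : 0 < N * Phi by rewrite mulr_gt0.
case: z => [z| |//] z0 Gz; last by rewrite gt0_muley ?lte_fin// addye// leey.
have {}Gz k : `|centered_mean P0 Y Y0 (g k) w| <= z by rewrite -lee_fin.
rewrite -EFinM -EFinD lee_fin; rewrite lee_fin in z0.
set e := fun k => (\int[P0]_w g k (Y0 w))%R.
pose G k := centered_mean P0 Y Y0 (g k) w.
pose rho k := translate phi k x.
have rP K : zpart (fun k => `|rho k|) K <= Phi by exact: phiPhi.
have nn0 : 0 < n%:R :> R by rewrite ltr0n.
pose a (m : 'I_n) k := g k (Y m w).
have U0 : 0 <= U by exact: le_trans (normr_ge0 _) (gU 0 0).
have aU m k : `|a m k| <= U by exact: gU.
have sU k : `|\sum_(m < n) a m k| <= n%:R * U.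
  apply: le_trans (ler_norm_sum _ _ _) _.
  apply: (@le_trans _ _ (\sum_(m < n) U)); first by apply: ler_sum => m _; exact: aU.
  by rewrite sumr_const card_ord mulr_natl.
have GE k : G k = n%:R^-1 * (\sum_(m < n) a m k) - e k by [].
have eB k : `|e k| <= U + z.
  have -> : e k = n%:R^-1 * (\sum_(m < n) a m k) - G k by rewrite GE; ring.
  apply: le_trans (ler_normB _ _) _; apply: lerD; last exact: Gz.
  by rewrite normrM gtr0_norm ?invr_gt0// mulrC ler_pdivrMr// mulrC.
have GB k : `|G k| <= U + z by apply: le_trans (Gz k) _; rewrite lerDr.
have -> : n%:R^-1 * \sum_(m < n) N * zsum (fun k => translate phi k x * g k (Y m w)) =
    N * (zsum (fun k => rho k * G k) + zsum (fun k => rho k * e k)).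
  rewrite -mulr_sumr mulrCA -(weighted_zsum_sum rP aU) -(weighted_zsumZ rP _ sU).
  rewrite -(weighted_zsumD rP GB eB); congr (_ * zsum _); apply/funext => k.
  by rewrite GE subrK.
rewrite mulrDr -addrA; apply: le_trans (ler_normD _ _) _; rewrite lerD2r.
rewrite normrM gtr0_norm// -[N * Phi * z]mulrA ler_pM2l// [Phi * z]mulrC.
exact: (weighted_zsum_le rP (u := G)).
Qed.

(** The weights [phi (N * x - k)] have an absolute sum of at most [Phi] for every
    [x]: bounds [zR] and [zI] for the centred means, which do not involve [x],
    control the stochastic error at all points at once. *)
Lemma estimator_error_le (w : T) (zR zI : \bar R) x (b : R) :
  (0 <= zR)%E -> (0 <= zI)%E ->
  (forall k, (`|centered_mean P0 Y Y0 (gR k) w|%:E <= zR)%E) ->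
  (forall k, (`|centered_mean P0 Y Y0 (gI k) w|%:E <= zI)%E) ->
  ((normc (deconv_estimator phi law (fun m => Y m w) x j - b%:C))%:E <=
   (N * Phi)%:E * (zR + zI) +
   (2 * normc (N%:C * czsum (fun k => (phi (N * x - k%:~R))%:C *
      dual_mean phi law N P0 Y0 k) - b%:C))%:E)%E.
Proof.
move=> R0 I0 GR GI.
have hR := part_le gRU (N * x) b R0 GR.
have hI := part_le gIU (N * x) 0 I0 GI.
set est := deconv_estimator _ _ _ _ _.
set bias := N%:C * _ - b%:C.
have sumRe (F : 'I_n -> R[i]) : complex.Re (\sum_(m < n) F m) = \sum_(m < n) complex.Re (F m).
  by elim/big_rec2: _ => [//|m x1 y1 _ <-]; rewrite ReD.
have sumIm (F : 'I_n -> R[i]) : complex.Im (\sum_(m < n) F m) = \sum_(m < n) complex.Im (F m).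
  by elim/big_rec2: _ => [//|m x1 y1 _ <-]; rewrite ImD.
have nR : (n%:R : R[i])^-1 = (n%:R^-1)%:C.
  have nn0 : n%:R != 0 :> R by rewrite pnatr_eq0 -lt0n.
  have nc : n%:R = (n%:R)%:C :> R[i] by rewrite rmorph_nat.
  have nc0 : (n%:R : R[i]) != 0.
    by rewrite nc; apply/eqP => /(congr1 (@complex.Re R))/= /eqP; exact/negP.
  by apply: (mulfI nc0); rewrite divff// nc -rmorphM/= divff.
have estE : est = (n%:R^-1)%:C * \sum_(m < n) N%:C * czsum (fun k =>
    (translate phi k (N * x))%:C * dual phi law N k (Y m w)).
  rewrite /est /deconv_estimator nR.
  have kE : deconv_kernel phi law j x = (fun y => N%:C * czsum (fun k =>
      (translate phi k (N * x))%:C * dual phi law N k y)).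
    by apply/funext => y; exact: deconv_kernelE.
  by rewrite kE.
have eR : complex.Re (est - b%:C) = n%:R^-1 * \sum_(m < n) N *
    zsum (fun k => translate phi k (N * x) * gR k (Y m w)) - b.
  rewrite ReD ReN estE ReRM sumRe; congr (_ * _ - _).
  apply: eq_bigr => m _; rewrite ReRM; congr (_ * zsum _).
  by apply/funext => k; exact: ReRM.
have eI : complex.Im (est - b%:C) = n%:R^-1 * \sum_(m < n) N *
    zsum (fun k => translate phi k (N * x) * gI k (Y m w)) - 0.
  rewrite ImD ImN estE ImRM sumIm oppr0; congr (_ * _ + _).
  apply: eq_bigr => m _; rewrite ImRM; congr (_ * zsum _).
  by apply/funext => k; exact: ImRM.
have bR : complex.Re bias =
    N * zsum (fun k => translate phi k (N * x) * (\int[P0]_w gR k (Y0 w))%R) - b.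
  rewrite /bias ReD ReN ReRM; congr (_ * zsum _ - _).
  by apply/funext => k; exact: ReRM.
have bI : complex.Im bias =
    N * zsum (fun k => translate phi k (N * x) * (\int[P0]_w gI k (Y0 w))%R) - 0.
  rewrite /bias ImD ImN ImRM oppr0; congr (_ * zsum _ + _).
  by apply/funext => k; exact: ImRM.
rewrite -eR -bR in hR; rewrite -eI -bI in hI.
apply: (@le_trans _ _ (`|complex.Re (est - b%:C)|%:E + `|complex.Im (est - b%:C)|%:E)%E).
  by rewrite -EFinD lee_fin normc_le_ReIm.
apply: le_trans (leeD hR hI) _.
have NP : 0 <= N * Phi by rewrite mulr_ge0// ltW.
rewrite ge0_muleDr// addeACA leeD2l// -EFinD lee_fin.
have := normc_Re bias; have := normc_Im bias; lra.
Qed.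

End pointwise_error.

(** * Exponentially weighted tails *)

Section exponential_weights.
Context (R : realType).
Local Notation mu := (@lebesgue_measure R).

(** The Cauchy kernel is a convenient integrable majorant: its integral is known
    and rescales well. *)
Lemma expR_powR_decay (k s : R) : 0 < k -> 0 < s ->
  exists2 c, 0 < c & forall v, 0 <= v -> expR (- (k * v `^ s)) <= c / (1 + v ^+ 2).
Proof.
move=> k0 s0; pose m := Num.truncn (2 / s).
have ms : 2 <= s * m.+1%:R.
  by rewrite mulrC -ler_pdivrMr//; apply/ltW; exact: truncnS_gt.
pose F := (m.+1`!)%:R : R; have F0 : 0 < F by rewrite ltr0n fact_gt0.
pose A := k ^+ m.+1; have A0 : 0 < A by rewrite exprn_gt0.
have c20 : 0 < 2 * F / A by rewrite divr_gt0 ?mulr_gt0.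
exists (2 + 2 * F / A) => [|v v0]; first by rewrite addr_gt0.
have v20 : 0 < 1 + v ^+ 2 by have := sqr_ge0 v; lra.
have k1 : 0 <= k * v `^ s by rewrite mulr_ge0 ?powR_ge0// ltW.
rewrite ler_pdivlMr//; have [v1|v1] := lerP v 1.
  have e1 : expR (- (k * v `^ s)) <= 1 by rewrite -expR0 ler_expR oppr_le0.
  have v21 : v ^+ 2 <= 1 by rewrite expr_le1.
  have : expR (- (k * v `^ s)) * (1 + v ^+ 2) <= 1 * 2 by apply: ler_pM => //; [exact: ltW|lra].
  lra.
have e0 := expR_gt0 (k * v `^ s).
rewrite expRN mulrC ler_pdivrMr//.
have h : A * v ^+ 2 / F <= expR (k * v `^ s).
  apply: le_trans (expR_ge1Dxn m k1); rewrite -/F.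
  have : A * v ^+ 2 / F <= (k * v `^ s) ^+ m.+1 / F; last by lra.
  rewrite ler_pM2r ?invr_gt0// exprMn ler_pM2l//.
  rewrite -(powR_mulrn _ v0) -(powR_mulrn _ (powR_ge0 _ _)) -powRrM.
  by apply: ler_powR => //; exact: ltW.
have : 2 * F / A * (A * v ^+ 2 / F) <= 2 * F / A * expR (k * v `^ s) by rewrite ler_pM2l.
have -> : 2 * F / A * (A * v ^+ 2 / F) = 2 * v ^+ 2 by field; rewrite !gt_eqF.
have v21 : 1 <= v ^+ 2 by rewrite exprn_ege1// ltW.
rewrite mulrDl => h2; lra.
Qed.

(** With [v = |t| / T], expand [(T ^ s - T0 ^ s) * (v ^ s - 1) >= 0]: the
    exponent at [t] splits into the one at [T] and one of scale [T0], so that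
    the constant does not depend on [T]. *)
Lemma tail_envelope (k s T0 : R) : 0 < k -> 0 < s -> 0 < T0 ->
  exists2 c, 0 < c & forall T t, T0 <= T -> T <= `|t| ->
    expR (- (k * `|t| `^ s)) <= c * expR (- (k * T `^ s)) / (1 + (T^-1 * t) ^+ 2).
Proof.
move=> k0 s0 T00; have p0 : 0 < k * T0 `^ s by rewrite mulr_gt0 ?powR_gt0.
have [c c0 ch] := expR_powR_decay p0 s0.
exists (expR (k * T0 `^ s) * c) => [|T t T0T Tt]; first by rewrite mulr_gt0// expR_gt0.
have T_gt0 : 0 < T by exact: lt_le_trans T00 T0T.
pose v := T^-1 * `|t|.
have v1 : 1 <= v by rewrite /v mulrC ler_pdivlMr// mul1r.
have v0 : 0 <= v by lra.
have -> : (T^-1 * t) ^+ 2 = v ^+ 2 by rewrite /v !exprMn real_normK// num_real.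
have tE : `|t| `^ s = T `^ s * v `^ s.
  by rewrite -powRM ?(ltW T_gt0)// /v mulVKf// gt_eqF.
have vs : 1 <= v `^ s by have := @ge0_ler_powR _ s (ltW s0) 1 v; rewrite powR1 !nnegrE; apply.
have Ts : T0 `^ s <= T `^ s by rewrite ge0_ler_powR ?nnegrE// ltW.
have -> : expR (k * T0 `^ s) * c * expR (- (k * T `^ s)) / (1 + v ^+ 2) =
    expR (k * T0 `^ s) * expR (- (k * T `^ s)) * (c / (1 + v ^+ 2)) by ring.
apply: (@le_trans _ _ (expR (k * T0 `^ s) * expR (- (k * T `^ s)) *
   expR (- (k * T0 `^ s * v `^ s)))); last first.
  by rewrite ler_pM2l ?mulr_gt0 ?expR_gt0//; exact: ch.
rewrite -!expRD ler_expR tE.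
have : 0 <= k * ((T `^ s - T0 `^ s) * (v `^ s - 1)).
  by rewrite mulr_ge0 ?(ltW k0)// mulr_ge0// subr_ge0.
lra.
Qed.

Section weighted_norm.
Variables (c0 s : R).
Hypotheses (c00 : 0 < c0) (s0 : 0 < s).

Let E (t : R) := expR (2 * c0 * `|t| `^ s).

Let E0 t : 0 < E t. Proof. exact: expR_gt0. Qed.

Let amgm (x e th : R) : 0 < e -> 0 < th -> x <= th * (x ^+ 2 * e) + th^-1 * e^-1.
Proof.
move=> e0 th0; have te : 0 < th * e by rewrite mulr_gt0.
rewrite -invfM mulrCA mulrC.
rewrite -(ler_pM2r te) mulrDl mulVf ?gt_eqF//.
have h2 := sqr_ge0 (x * (th * e) - 2^-1).
have -> : (th * e * x ^+ 2 * (th * e)) = (x * (th * e)) ^+ 2 by ring.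
have h3 : (x * (th * e) - 2^-1) ^+ 2 = (x * (th * e)) ^+ 2 - x * (th * e) + 4^-1 by field.
rewrite h3 in h2; lra.
Qed.

Variables (h : R -> R) (A : R).
Hypotheses (mh : measurable_fun setT h) (h0 : forall t, 0 <= h t)
  (hA : (\int[mu]_t ((h t) ^+ 2 * E t)%:E <= A%:E)%E).

Let mE : measurable_fun setT E.
Proof.
apply: measurableT_comp => //; apply: measurable_funM => //.
exact: (measurableT_comp (measurable_powR s) (@normr_measurable R setT)).
Qed.

Let hE : rint mu (fun t => h t ^+ 2 * E t) /\ (\int[mu]_t (h t ^+ 2 * E t))%R <= A.
Proof.
apply: ge0_rint => //.
- by apply: measurable_funM => //; exact: measurable_funX.
- by move=> t; rewrite mulr_ge0 ?sqr_ge0// ltW.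
Qed.

Let cauchy_scaled (T : R) : 0 < T -> rint mu (fun t => (1 + (T^-1 * t) ^+ 2)^-1) /\
  (\int[mu]_t (1 + (T^-1 * t) ^+ 2)^-1)%R = T * pi.
Proof.
move=> T0; have [i e] := oneDsqr_integral R.
have Ti : 0 < T^-1 by rewrite invr_gt0.
have [i2 e2] := rint_affine 0 Ti i; rewrite e invrK in e2; split.
  by apply: rint_eq i2 => t; rewrite addr0.
by rewrite -e2; apply: Rint_eq => t; rewrite addr0.
Qed.

Lemma exp_weight_rint c : (forall v, 0 <= v -> expR (- (2 * c0 * v `^ s)) <= c / (1 + v ^+ 2)) ->
  rint mu h /\ (\int[mu]_t h t)%R <= A + c * pi.
Proof.
move=> hc; have [i e] := oneDsqr_integral R; have [iE eE] := hE.
have ib := rintD iE (rintZ c i).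
have hb t : h t <= h t ^+ 2 * E t + c * (1 + t ^+ 2)^-1.
  apply: le_trans (amgm _ (E0 t) ltr01) _; rewrite mul1r invr1 mul1r lerD2l.
  by have := hc _ (normr_ge0 t); rewrite expRN real_normK// num_real.
have ih : rint mu h.
  by apply: (rint_le _ ib) => [|t]; [exact: mh|rewrite ger0_norm].
split=> //; apply: le_trans (Rint_le ih ib hb) _.
rewrite RintegralD//; last exact: rintZ.
by rewrite RintegralZl// e lerD2r.
Qed.

(** The parameter [th] balances the two sides of the inequality of arithmetic
    and geometric means: the weighted square of [h], bounded by [A], and the
    inverse of the weight, bounded by [tail_envelope]. *)
Lemma exp_weight_tail c T th : 0 < T -> 0 < th -> rint mu h ->
  (forall t, T <= `|t| -> expR (- (2 * c0 * `|t| `^ s)) <=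
     c * expR (- (2 * c0 * T `^ s)) / (1 + (T^-1 * t) ^+ 2)) ->
  0 <= c ->
  (\int[mu]_t (((T <= `|t|)%R : bool)%:R * h t))%R <=
  th * A + th^-1 * (c * expR (- (2 * c0 * T `^ s)) * (T * pi)).
Proof.
move=> T0 th0 ih hc c_ge0; have [i e] := cauchy_scaled T0; have [iE eE] := hE.
set q := c * expR _; have q0 : 0 <= q by rewrite mulr_ge0// expR_ge0.
have ib := rintD (rintZ th iE) (rintZ (th^-1 * q) i).
have iG : rint mu (fun t => ((T <= `|t|)%R : bool)%:R * h t).
  apply: (rint_le _ ih) => [|t].
    apply: measurable_funM => //.
    have -> : (fun t : R => ((T <= `|t|)%R : bool)%:R) = (fun t : R => if T <= `|t| then 1 else 0 : R).
      by apply/funext => t; case: ifP.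
    by apply: measurable_fun_ifT => //; apply: measurable_fun_ler => //; exact: measurableT_comp.
  rewrite normrM [X in _ * X]ger0_norm// ler_piMl//.
  by case: (T <= `|t|); rewrite ?normr1 ?normr0.
apply: le_trans (Rint_le iG ib _) _ => [t|]; last first.
  rewrite RintegralD//; [|exact: rintZ|exact: rintZ].
  by rewrite !RintegralZl// e -mulrA lerD2r ler_pM2l.
have p0 : 0 < 1 + (T^-1 * t) ^+ 2 by have := sqr_ge0 (T^-1 * t); lra.
have b0 : 0 <= th * (h t ^+ 2 * E t) by rewrite mulr_ge0 ?(ltW th0)// mulr_ge0 ?sqr_ge0// ltW.
have thi : 0 < th^-1 by rewrite invr_gt0.
have [Tt|Tt] := leP T `|t|; last first.
  by rewrite mul0r addr_ge0// mulr_ge0 ?invr_ge0 ?(ltW p0)// mulr_ge0// ltW.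
rewrite mul1r; apply: le_trans (amgm _ (E0 t) th0) _; rewrite lerD2l -mulrA ler_pM2l//.
by have := hc t Tt; rewrite expRN.
Qed.

End weighted_norm.
End exponential_weights.

(** * Calibration of the maximal inequality *)

Section rates.
Context (R : realType).

Lemma ln_le_self (x : R) : 0 < x -> ln x <= x.
Proof. by move=> x0; have := ln_le_div x0 ltr01; rewrite ln1; lra. Qed.

Lemma ln3_gt1 : 1 < ln 3 :> R.
Proof.
rewrite -[X in X < _]expRK ltr_ln ?posrE ?expR_gt0//.
(* [exp 1 <= (8 / 7) ^ 8 < 3]. *)
have -> : expR 1 = (expR (- (8^-1))) ^- 8 :> R.
  by rewrite -expRM_natl -expRN; congr expR; field.
have h : 1 + - 8^-1 <= expR (- (8^-1)) :> R by exact: expR_ge1Dx.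
have h8 : (1 + - 8^-1) ^+ 8 <= expR (- (8^-1)) ^+ 8 :> R.
  by apply: lerXn2r; rewrite ?nnegrE ?expR_ge0//; lra.
rewrite -[ltRHS]invrK ltf_pV2 ?posrE ?exprn_gt0 ?expR_gt0 ?invr_gt0//.
by apply: lt_le_trans h8; lra.
Qed.

Lemma lnln3_gt0 : 0 < ln (ln 3) :> R.
Proof. by rewrite ln_gt0// ln3_gt1. Qed.

Lemma ln_ge_ln3 (n : nat) : (3 <= n)%N -> ln 3 <= ln n%:R :> R.
Proof. by move=> n3; rewrite ler_ln ?posrE ?ler_nat// ltr0n; lia. Qed.

Lemma lnln_ge (n : nat) : (3 <= n)%N -> ln (ln 3) <= ln (ln n%:R) :> R.
Proof.
move=> n3; have h := ln_ge_ln3 n3; have h3 := ln3_gt1.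
by rewrite ler_ln ?posrE//; lra.
Qed.

(** [n] is the exponential of [ln n], which exceeds any power of [ln n]. *)
Lemma log_growth (sg : R) : exists2 c : R, 0 < c &
  forall n, (3 <= n)%N -> ln (ln n%:R) * ln n%:R `^ sg <= c * n%:R.
Proof.
pose m := Num.truncn sg; exists (m.+2`!)%:R => [|n n3]; first by rewrite ltr0n fact_gt0.
have n0 : 0 < n%:R :> R by rewrite ltr0n; lia.
set D := ln n%:R; have D1 : 1 < D by exact: lt_le_trans ln3_gt1 (ln_ge_ln3 n3).
have D0 : 0 < D by lra.
have h1 : ln D * D `^ sg <= D * D ^+ m.+1.
  apply: ler_pM; rewrite ?powR_ge0 ?ln_le_self//; first by rewrite ln_ge0// ltW.
  by rewrite -powR_mulrn ?(ltW D0)//; apply: ler_powR; apply: ltW => //; exact: truncnS_gt.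
apply: le_trans h1 _; rewrite -exprS.
have F0 : 0 < (m.+2`!)%:R :> R by rewrite ltr0n fact_gt0.
have h2 := expR_ge1Dxn m.+1 (ltW D0); rewrite lnK ?posrE// in h2.
by rewrite mulrC -ler_pdivrMr//; lra.
Qed.

(** The exponent is taken as large as the boundedness of the summands permits;
    the maximum of infinitely many means then costs only an iterated logarithm,
    since [ln (1 + r B exp (r s2))] is of order [ln (ln n)]. *)
Lemma maximal_rate (cU cB cs sg : R) : 0 <= cU -> 0 <= cB -> 0 <= cs -> 0 < sg ->
  exists2 c : R, 0 < c & forall (n : nat) (M : R), (3 <= n)%N -> 0 < M ->
  exists la : R, [/\ 0 < la, la * (4 * (cU * M)) <= n%:R &
   la^-1 * (ln 2 + ln (1 + 2 * la ^+ 2 / n%:R * (cB * M ^+ 2) *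
      expR (2 * la ^+ 2 / n%:R * (cs * M ^+ 2 / ln n%:R `^ sg)))) <=
   c * (M * Num.sqrt (ln (ln n%:R) / n%:R) / Num.sqrt (ln n%:R `^ sg))].
Proof.
move=> cU0 cB0 cs0 sg0; have [cn cn0 hn] := log_growth sg.
pose th := (1 + 16 * cU ^+ 2 * cn)^-1.
have q0 : 0 <= 16 * cU ^+ 2 * cn by rewrite !mulr_ge0// ltW.
have th0 : 0 < th by rewrite invr_gt0; lra.
have th1 : th <= 1 by rewrite invf_le1; lra.
have thq : th * (16 * cU ^+ 2 * cn) <= 1.
  by rewrite mulrC ler_pdivrMr; lra.
clearbody th.
pose b := 2 * th ^+ 2 * cB; have b0 : 0 <= b by rewrite !mulr_ge0// ltW.
pose c3 := 2 * th ^+ 2 * cs; have c30 : 0 <= c3 by rewrite !mulr_ge0// ltW.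
have l30 := lnln3_gt0; set l3 := ln (ln 3) in l30.
pose c5 := (2 + b) / l3 + (1 + sg + c3).
have c50 : 0 < c5 by rewrite ltr_wpDl ?divr_ge0; lra.
exists (c5 / th) => [|n M n3 M0]; first by rewrite divr_gt0.
have l3l := lnln_ge n3; set D := ln n%:R in l3l *; set l := ln D in l3l *.
rewrite -/l3 in l3l.
have l0 : 0 < l by lra.
have D1 : 1 < D by exact: lt_le_trans ln3_gt1 (ln_ge_ln3 n3).
have D0 : 0 < D by lra.
have hn3 := hn n n3; rewrite -/D -/l in hn3.
set De := D `^ sg in hn3 *; have De0 : 0 < De by rewrite /De powR_gt0.
have n0 : 0 < n%:R :> R by rewrite ltr0n; exact: leq_trans n3.
pose S := Num.sqrt (n%:R * l * De).
have nlD : 0 < n%:R * l * De by rewrite !mulr_gt0.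
have S0 : 0 < S by rewrite sqrtr_gt0.
have S2 : S ^+ 2 = n%:R * l * De by rewrite sqr_sqrtr// ltW.
exists (th * S / M); split; first by rewrite divr_gt0// mulr_gt0.
  have -> : th * S / M * (4 * (cU * M)) = 4 * cU * th * S by field; rewrite gt_eqF.
  have h0 : 0 <= 4 * cU * th * S by rewrite !mulr_ge0// ltW.
  rewrite -(ler_pXn2r (n := 2)) ?nnegrE ?(ltW n0)//.
  rewrite exprMn S2 !exprMn.
  have -> : 4 ^+ 2 * cU ^+ 2 * th ^+ 2 * (n%:R * l * De) = 16 * cU ^+ 2 * th ^+ 2 * (n%:R * (l * De)) by ring.
  apply: (@le_trans _ _ (16 * cU ^+ 2 * th ^+ 2 * (n%:R * (cn * n%:R)))).
    have k0 : 0 <= 16 * cU ^+ 2 * th ^+ 2.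
      by rewrite mulr_ge0 ?sqr_ge0// mulr_ge0// sqr_ge0.
    by rewrite ler_wpM2l ?ler_pM2l.
  have -> : 16 * cU ^+ 2 * th ^+ 2 * (n%:R * (cn * n%:R)) =
      th * (th * (16 * cU ^+ 2 * cn)) * n%:R ^+ 2 by ring.
  rewrite ler_piMl ?sqr_ge0//; apply: mulr_ile1 => //; first exact: ltW.
  by rewrite mulr_ge0// ltW.
have rE : 2 * (th * S / M) ^+ 2 / n%:R = 2 * th ^+ 2 * l * De / M ^+ 2.
  rewrite !exprMn S2 exprVn; field; by rewrite !gt_eqF.
have rs : 2 * (th * S / M) ^+ 2 / n%:R * (cs * M ^+ 2 / De) = c3 * l.
  by rewrite rE /c3; field; rewrite !gt_eqF.
have rB : 2 * (th * S / M) ^+ 2 / n%:R * (cB * M ^+ 2) = b * (l * De).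
  by rewrite rE /b; field; rewrite gt_eqF.
rewrite rs rB; clear rE rs rB; clearbody b c3.
have lnB : ln (1 + b * (l * De) * expR (c3 * l)) <= b + (1 + sg + c3) * l.
  have DeE : De = expR (sg * l) by rewrite /De /powR gt_eqF.
  have le1 : l <= expR l by have := expR_ge1Dx l; lra.
  have ge1 : 1 <= expR ((1 + sg + c3) * l).
    by rewrite -[X in X <= _]expR0 ler_expR mulr_ge0 ?(ltW l0)//; lra.
  have hb : b * (l * De) * expR (c3 * l) <= b * expR ((1 + sg + c3) * l).
    rewrite -mulrA ler_wpM2l// !mulrDl mul1r !expRD DeE.
    by rewrite ler_pM2r ?expR_gt0// ler_pM2r ?expR_gt0.
  have hx : 1 + b * (l * De) * expR (c3 * l) <= (1 + b) * expR ((1 + sg + c3) * l).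
    by rewrite mulrDl mul1r; apply: lerD.
  have p0 : 0 < 1 + b * (l * De) * expR (c3 * l).
    have : 0 <= b * (l * De) * expR (c3 * l); last lra.
    by rewrite mulr_ge0 ?expR_ge0// mulr_ge0// mulr_ge0 ?ltW.
  apply: (@le_trans _ _ (ln ((1 + b) * expR ((1 + sg + c3) * l)))).
    by rewrite ler_ln ?posrE// mulr_gt0 ?expR_gt0//; lra.
  rewrite lnM ?posrE ?expR_gt0//; last lra.
  rewrite expRK lerD2r; have := @ln_le_div _ (1 + b) 1; rewrite ln1 divr1.
  by move=> h; have := h _ ltr01; lra.
have tot : ln 2 + ln (1 + b * (l * De) * expR (c3 * l)) <= c5 * l.
  have ln2 : ln 2 <= 2 :> R by exact: ln_le_self.
  have h : 2 + b <= (2 + b) / l3 * l.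
    by rewrite mulrAC ler_pdivlMr// ler_pM2l//; lra.
  by rewrite /c5 mulrDl; lra.
have la0 : 0 < (th * S / M)^-1 by rewrite invr_gt0 divr_gt0// mulr_gt0.
apply: (@le_trans _ _ ((th * S / M)^-1 * (c5 * l))); first by rewrite ler_pM2l.
have SE : S = Num.sqrt (l / n%:R) * n%:R * Num.sqrt De.
  have -> : S = Num.sqrt (l / n%:R * (n%:R ^+ 2 * De)).
    by congr Num.sqrt; field; rewrite gt_eqF.
  rewrite sqrtrM ?divr_ge0 ?(ltW l0) ?(ltW n0)// [Num.sqrt (_ ^+ 2 * _)]sqrtrM ?sqr_ge0//.
  by rewrite sqrtr_sqr gtr0_norm// mulrA.
have sl : 0 < Num.sqrt (l / n%:R) by rewrite sqrtr_gt0 divr_gt0.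
have sD : 0 < Num.sqrt De by rewrite sqrtr_gt0.
have lE : l = Num.sqrt (l / n%:R) ^+ 2 * n%:R.
  by rewrite sqr_sqrtr ?divr_ge0 ?(ltW l0) ?(ltW n0)// divfK// gt_eqF.
rewrite le_eqVlt; apply/orP; left; apply/eqP.
rewrite SE [X in c5 * X]lE; field.
by rewrite !gt_eqF.
Qed.

End rates.

(** * Risk bound at a given resolution *)

Section risk.
Context (R : realType).
Local Notation mu := (@lebesgue_measure R).
Variables (phi : R -> R) (a' a Phi : R).
Hypotheses (iphi : rint mu phi) (a'0 : 0 < a') (a'a : a' < a)
  (Sphi : fourier_support phi `<=` `[- a, a]%classic)
  (phiPhi : forall x K, zpart (fun k => `|translate phi k x|) K <= Phi)
  (Phi0 : 0 < Phi)
  (rep : forall tau z : R, `|tau| < a' ->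
    zsum (fun k => complex.Re (fourier (translate phi k) tau) * translate phi k z)
      = cos (tau * z) /\
    zsum (fun k => complex.Im (fourier (translate phi k) tau) * translate phi k z)
      = - sin (tau * z)).
Variables (law : probability (measurableTypeR R) R) (N Bm j : R) (J : nat).
Hypotheses (N0 : 0 < N) (law0 : forall t, fourier_law law t != 0)
  (lawB : forall t, `|t| <= N * a -> (normc (fourier_law law t))^-1 <= Bm)
  (Bm0 : 0 < Bm) (jN : 2 `^ j = N) (aJ : a <= J%:R * pi).
Variable f : R -> R.
Hypotheses (fi : rint mu f) (cf : continuous f)
  (Ffi : rint mu (fun t => normc (fourier f t))).
Context d0 (T0 : measurableType d0) (P0 : probability T0 R) (Y0 : T0 -> R).
Hypotheses (mY0 : measurable_fun setT (Y0 : T0 -> measurableTypeR R))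
  (charY : forall u, cintegral P0 (fun w => expi (u * Y0 w)) =
     conjc (fourier f u) * conjc (fourier_law law u)).
Context d (T : measurableType d) (P : probability T R) (n : nat).
Variable Y : 'I_n -> {RV P >-> measurableTypeR R}.
Hypotheses (n0 : (0 < n)%N) (iidY : iid_copies Y P0 Y0).
Variables (K la : R).
Hypotheses (FfK : (\int[mu]_t normc (fourier f t))%R <= K) (la0 : 0 < la).

(** This constant and the next two collect what [dual_le], [dual_bessel] and
    [dual_second_moment] contribute besides the powers of [Bm] and [N]. *)
Definition range_const := (2 * pi)^-1 * ((\int[mu]_x `|phi x|)%R * (2 * a)).

Definition bessel_const := (2 * pi)^-1 ^+ 2 *
  (2 * (J%:R * pi) * ((\int[mu]_x `|phi x|)%R ^+ 2 * (2 * a))).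

Definition variance_const := (2 * pi)^-1 ^+ 2 *
  ((\int[mu]_x `|phi x|)%R ^+ 2 * (2 * a) * K).

Hypothesis laU : la * (4 * (range_const * Bm)) <= n%:R.

Let r := 2 * la ^+ 2 / n%:R.

Let eq_to_le (x y : R) : x = y -> x <= y. Proof. by move->. Qed.

(** The supremum over [x] is compared pointwise with one measurable random
    variable, so that its own measurability is not an issue. *)
Lemma estimator_risk_le :
  (\int[P]_omega ereal_sup [set (normc (deconv_estimator phi law (fun m => Y m omega) x j
       - (f x)%:C))%:E | x in [set: R]]
   <= (N * Phi * (2 * (la^-1 * (ln 2 + ln (1 + r * (bessel_const * Bm ^+ 2) *
           expR (r * (variance_const * Bm ^+ 2 / N)))))) +
       2 * ((2 * pi)^-1 * (2 * ((\int[mu]_x `|phi x|)%R * Phi) + 1) *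
         (\int[mu]_t (((N * a' <= `|t|)%R : bool)%:R * normc (fourier f t)))%R))%:E)%E.
Proof.
set Z0 := la^-1 * _; set b0 := 2 * (_ * _ * _).
have NPhi : 0 <= N * Phi by rewrite mulr_ge0// ltW.
have dU k y : normc (dual phi law N k y) <= range_const * Bm.
  apply: le_trans (dual_le iphi a'0 a'a Sphi N0 lawB k y) _.
  by rewrite /range_const; apply: eq_to_le; ring.
have dB y Q : zpart (fun k => normc (dual phi law N k y) ^+ 2) Q <= bessel_const * Bm ^+ 2.
  apply: le_trans (dual_bessel iphi a'0 a'a Sphi N0 lawB y Q aJ) _.
  rewrite /bessel_const; apply: eq_to_le; move: (pi : R) => p.
  by set c := (2 * p)^-1; move: c => c; field; rewrite gt_eqF.
have dV k : (\int[P0]_w (normc (dual phi law N k (Y0 w)) ^+ 2))%R <=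
    variance_const * Bm ^+ 2 / N.
  apply: le_trans (dual_second_moment iphi a'0 a'a Sphi N0 lawB fi Ffi mY0
    (normc_fourier_law law) charY k) _.
  have a0 : 0 < a by exact: lt_trans a'a.
  rewrite /variance_const; have := sqr_ge0 (2 * pi : R)^-1.
  set c := _ ^+ 2; set F1 := (\int[mu]_x `|phi x|)%R; set Kf := (\int[mu]_t _)%R => c_ge0.
  have F10 : 0 <= F1 by exact: Rintegral_ge0.
  have -> : c * (F1 * Bm * (2 * a) * (F1 * Bm / N * Kf)) =
      c * (F1 ^+ 2 * (2 * a) * Bm ^+ 2 / N) * Kf by ring.
  have -> : c * (F1 ^+ 2 * (2 * a) * K) * Bm ^+ 2 / N =
      c * (F1 ^+ 2 * (2 * a) * Bm ^+ 2 / N) * K by ring.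
  apply: ler_wpM2l FfK; apply: mulr_ge0 => //; apply: divr_ge0; last exact: ltW.
  by rewrite mulr_ge0 ?sqr_ge0// mulr_ge0 ?sqr_ge0// mulr_ge0// ltW.
have part (g : int -> R -> R) :
    (forall k, measurable_fun setT (g k : measurableTypeR R -> R)) ->
    (forall k y, `|g k y| <= normc (dual phi law N k y)) ->
    exists Z : T -> \bar R, [/\ measurable_fun setT Z, forall w, (0 <= Z w)%E,
      forall w k, (`|centered_mean P0 Y Y0 (g k) w|%:E <= Z w)%E &
      (\int[P]_w Z w <= Z0%:E)%E].
  move=> mg gd.
  have g2 k y : g k y ^+ 2 <= normc (dual phi law N k y) ^+ 2.
    by rewrite -real_normK ?num_real//; apply: lerXn2r; rewrite ?nnegrE ?normc_ge0.
  apply: (maximal_inequality n0 mY0 iidY mg (U := range_const * Bm)) => //.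
  - by move=> k y; exact: le_trans (gd k y) (dU k y).
  - by move=> y Q; apply: le_trans (dB y Q); apply: zpart_le => k; exact: g2.
  - move=> k; apply: le_trans (dV k); have md := cmeas_dual iphi a'0 a'a Sphi N0 lawB k.
    have nb y : `|normc (dual phi law N k y) ^+ 2| <= (range_const * Bm) ^+ 2.
      rewrite ger0_norm ?sqr_ge0//; apply: lerXn2r => //; rewrite nnegrE ?normc_ge0//.
      exact: le_trans (normc_ge0 _) (dU 0 0).
    apply: Rint_le => [||w]; last exact: g2.
    + apply: (@bounded_rint _ _ _ _ _ ((range_const * Bm) ^+ 2)) => [|w].
        by apply: measurable_funX; exact: measurableT_comp (mg k) mY0.
      by apply: le_trans (nb (Y0 w)); rewrite !ger0_norm ?sqr_ge0.
    + apply: (@bounded_rint _ _ _ _ _ ((range_const * Bm) ^+ 2)) => [|w]; last exact: nb.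
      by apply: measurable_funX; exact: (measurableT_comp (cmeas_normc md) mY0).
have md k := cmeas_dual iphi a'0 a'a Sphi N0 lawB k.
have [ZR [mZR ZR0 ZRB ZRI]] := part (fun k y => complex.Re (dual phi law N k y))
  (fun k => (md k).1) (fun k y => normc_Re _).
have [ZI [mZI ZI0 ZIB ZII]] := part (fun k y => complex.Im (dual phi law N k y))
  (fun k => (md k).2) (fun k y => normc_Im _).
have pt w x : ((normc (deconv_estimator phi law (fun m => Y m w) x j - (f x)%:C))%:E <=
    (N * Phi)%:E * (ZR w + ZI w) + b0%:E)%E.
  apply: le_trans (estimator_error_le phiPhi Phi0 N0 jN n0 dU x (f x)
    (ZR0 w) (ZI0 w) (ZRB w) (ZIB w)) _.
  rewrite leeD2l// lee_fin ler_pM2l//.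
  exact: (bias_le iphi a'0 a'a Sphi phiPhi rep N0 law0 lawB fi cf Ffi mY0 charY).
have sup0 w : (0 <= ereal_sup [set (normc (deconv_estimator phi law (fun m => Y m w) x j
       - (f x)%:C))%:E | x in [set: R]])%E.
  apply: (@le_trans _ _ (normc (deconv_estimator phi law (fun m => Y m w) 0 j
       - (f 0)%:C))%:E); first by rewrite lee_fin normc_ge0.
  by apply: ereal_sup_ubound; exists 0.
have b00 : 0 <= b0.
  rewrite /b0 !mulr_ge0 ?invr_ge0 ?mulr_ge0 ?pi_ge0//.
    rewrite addr_ge0// !mulr_ge0 ?(ltW Phi0)//; exact: Rintegral_ge0.
  by apply: Rintegral_ge0 => t _; rewrite mulr_ge0 ?normc_ge0.
apply: le_trans (ge0_le_integral_nomeas _ sup0 (g := fun w => ((N * Phi)%:E * (ZR w + ZI w) + b0%:E)%E) _) _.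
  by move=> w; apply: ub_ereal_sup => _ [x _ <-]; exact: pt.
have mZ : measurable_fun setT (fun w => ZR w + ZI w)%E by exact: emeasurable_funD.
have Z_ge0 w : (0 <= ZR w + ZI w)%E by rewrite adde_ge0.
rewrite ge0_integralD//; last 2 first.
  by move=> w _; rewrite mule_ge0// lee_fin.
  by apply: emeasurable_funM.
rewrite integral_cst// [X in (_ + _ * X)%E](_ : _ = 1%E); last exact: probability_setT.
rewrite mule1 EFinD leeD2r// ge0_integralZl_EFin// [(_ * (2 * _))%:E]EFinM.
apply: lee_wpmul2l; first by rewrite lee_fin.
rewrite ge0_integralD// mulr_natl mulr2n EFinD.
exact: leeD.
Qed.

End risk.

(** * Resolution and rates *)

Section bandwidth.
Context (R : realType).
Variables (a' c0 s : R).
Hypotheses (a'0 : 0 < a') (c00 : 0 < c0) (s0 : 0 < s).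

(** The factor of [(ln n) ^ (1 / s)] in the prescribed resolution [2 ^ j]. *)
Definition resolution_const := ((2 * a' `^ s * c0)^-1) `^ s^-1.

Lemma resolution_const_gt0 : 0 < resolution_const.
Proof. by rewrite powR_gt0// invr_gt0 !mulr_gt0// powR_gt0. Qed.

Lemma resolutionE (D : R) : 0 <= D ->
  ((2 * a' `^ s * c0)^-1 * D) `^ s^-1 = resolution_const * D `^ s^-1.
Proof.
move=> D0; rewrite powRM// invr_ge0 mulr_ge0 ?(ltW c00)//.
by rewrite mulr_ge0// powR_ge0.
Qed.

(** The resolution is tuned so that the spectral weight of the smoothness class
    at the first frequency missed by the expansion is exactly [n]. *)
Lemma weight_at_cutoff (D : R) : 0 < D ->
  2 * c0 * (resolution_const * D `^ s^-1 * a') `^ s = D.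
Proof.
move=> D0; have k0 := resolution_const_gt0.
rewrite !powRM ?mulr_ge0 ?powR_ge0 ?(ltW k0) ?(ltW a'0)//.
rewrite /resolution_const -!powRrM mulVf ?gt_eqF// !powRr1 ?(ltW D0)//; last first.
  by rewrite invr_ge0 !mulr_ge0 ?powR_ge0// ltW.
have a's : 0 < a' `^ s by exact: powR_gt0.
by field; rewrite !gt_eqF.
Qed.

End bandwidth.

(** The ill-posedness of the deconvolution costs the factor [De ^ w]. *)
Lemma law_inverse_le (R : realType) (C w k a De t x : R) :
  0 < C -> 0 <= w -> 1 <= De -> 0 <= k -> 0 < a -> `|t| <= k * De * a ->
  C * (1 + `|t| ^+ 2) `^ (- w / 2) <= x ->
  x^-1 <= C^-1 * (1 + (k * a) ^+ 2) `^ (w / 2) * De `^ w.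
Proof.
move=> C0 w0 De1 k0 a0 ta Cx.
have p1 (y : R) : 0 < 1 + y ^+ 2 by have := sqr_ge0 y; lra.
have lb0 : 0 < C * (1 + `|t| ^+ 2) `^ (- w / 2) by rewrite mulr_gt0 ?powR_gt0.
have w20 : 0 <= w / 2 by rewrite divr_ge0.
apply: (@le_trans _ _ (C * (1 + `|t| ^+ 2) `^ (- w / 2))^-1).
  by rewrite lef_pV2 ?posrE//; exact: lt_le_trans Cx.
rewrite invfM -mulrA ler_pM2l ?invr_gt0// mulNr powRN invrK.
have De0 : 0 <= De by lra.
have -> : De `^ w = (De ^+ 2) `^ (w / 2).
  rewrite -powR_mulrn// -powRrM; congr (_ `^ _); by field.
rewrite -powRM ?(ltW (p1 _)) ?sqr_ge0//; apply: ge0_ler_powR; rewrite ?nnegrE ?(ltW (p1 _))//.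
  by rewrite mulr_ge0 ?sqr_ge0// ltW.
have t2 : `|t| ^+ 2 <= (k * De * a) ^+ 2.
  by apply: lerXn2r; rewrite ?nnegrE ?mulr_ge0 ?(ltW a0).
have D2 : 1 <= De ^+ 2 by rewrite exprn_ege1.
rewrite mulrDl mul1r; apply: lerD => //; apply: (le_trans t2).
by rewrite -exprMn (_ : k * De * a = k * a * De)//; ring.
Qed.

Section square_roots.
Context (R : realType).
Variables (De n : R).
Hypotheses (De0 : 0 < De) (n0 : 0 < n).

(** [sqrt (De / n)] is the weight that makes both terms of [exp_weight_tail] of
    the same order at the cutoff. *)
Lemma balanced_tail (b c : R) :
  (Num.sqrt (De / n))^-1 * (c * n^-1 * (De * b)) = Num.sqrt (De / n) * (c * b).
Proof.
have v0 : 0 < Num.sqrt (De / n) by rewrite sqrtr_gt0 divr_gt0.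
have DE : De = Num.sqrt (De / n) ^+ 2 * n by rewrite sqr_sqrtr ?divr_ge0 ?(ltW De0) ?(ltW n0)// divfK// gt_eqF.
rewrite [X in _ * (X * b)]DE; move: (Num.sqrt _) v0 => v v0.
by field; rewrite !gt_eqF.
Qed.

Lemma sqrt_rate_le (l3 l q : R) : 0 < l3 -> l3 <= l -> 1 <= q ->
  Num.sqrt (De / n) <= Num.sqrt (l / n) * (q * Num.sqrt De) / Num.sqrt l3.
Proof.
move=> l30 l3l q1; have s0 : 0 < Num.sqrt l3 by rewrite sqrtr_gt0.
have l0 : 0 < l by exact: lt_le_trans l3l.
rewrite ler_pdivlMr// !sqrtrM ?(ltW De0) ?(ltW l0)//.
have -> : Num.sqrt l * Num.sqrt n^-1 * (q * Num.sqrt De) =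
    Num.sqrt De * Num.sqrt n^-1 * (q * Num.sqrt l) by ring.
rewrite ler_pM2l ?mulr_gt0 ?sqrtr_gt0 ?invr_gt0//.
have sl : Num.sqrt l3 <= Num.sqrt l by exact: ler_wsqrtr.
by apply: le_trans sl _; rewrite ler_peMl ?sqrtr_ge0.
Qed.

End square_roots.

(** * Convergence rate of the estimator *)

Theorem corollary1 (R : realType) (phi psi : R -> R) (a' a c0 s L C w : R)
  (Hwav : wavelet_condition phi psi a' a)
  (Hc0 : 0 < c0) (Hs : 0 < s) (HL : 0 < L) (HC : 0 < C) (Hw : 0 <= w) :
  exists C' : R,
    forall (law_eps : probability (measurableTypeR R) R),
      (forall t : R,
         C * (1 + `|t| ^+ 2) `^ (- w / 2) <= normc (fourier_law law_eps t)) ->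
    forall n : nat, (3 <= n)%N ->
    forall j : R, 2 `^ j = ((2 * a' `^ s * c0)^-1 * ln n%:R) `^ s^-1 ->
    forall f : R -> R, supersmooth c0 s L f ->
    forall (d0 : measure_display) (T0 : measurableType d0) (P0 : probability T0 R)
           (X eps : {RV P0 >-> measurableTypeR R}),
      has_density X f -> has_law eps law_eps -> independent_pair X eps ->
    forall (d : measure_display) (T : measurableType d) (P : probability T R)
           (Y : 'I_n -> {RV P >-> measurableTypeR R}),
      iid_copies Y P0 (fun omega => X omega + eps omega) ->
      (\int[P]_omega
         ereal_sup
           [set (normc (deconv_estimator phi law_eps (fun m => Y m omega) x j
                        - (f x)%:C))%:E | x in [set: R]]
       <= (C' * (Num.sqrt (ln (ln n%:R) / n%:R)
                 * (ln n%:R) `^ ((w + 1 / 2) / s)))%:E)%E.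
Proof.
case: Hwav => pair cphi Lp [/andP[a'0 a'a] Sphi Spsi] [/bounded_translate_sumP[Phi Phi0 phiPhi] _].
have a0 : 0 < a by exact: lt_trans a'0 a'a.
have [Lphi Lpsi] := Lp 1%E (lexx _).
have iphi : rint (@lebesgue_measure R) phi by exact/Lfun1_integrable.
have ipsi : rint (@lebesgue_measure R) psi by exact/Lfun1_integrable.
have rep := wavelet_reproduces_expi pair cphi iphi ipsi a'0 a'a Sphi Spsi phiPhi.
have pi0 := pi_gt0 R.
have [J aJ] : exists J : nat, a <= J%:R * pi.
  exists (Num.truncn (a / pi)).+1; rewrite -ler_pdivrMr//.
  by apply/ltW; exact: truncnS_gt.
set F1 := (\int[@lebesgue_measure R]_x `|phi x|)%R.
have F10 : 0 <= F1 by exact: Rintegral_ge0.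
pose k0 := resolution_const a' c0 s; have k00 : 0 < k0 by exact: resolution_const_gt0.
have c20 : 0 < 2 * c0 by rewrite mulr_gt0.
have T00 : 0 < k0 * a' by rewrite mulr_gt0.
have [c1 c10 decay] := expR_powR_decay c20 Hs.
have [c2 c20' tail] := tail_envelope c20 Hs T00.
pose A := 2 * pi * L; have A0 : 0 <= A by rewrite !mulr_ge0// ltW.
pose K := A + c1 * pi; have K0 : 0 <= K by rewrite addr_ge0// mulr_ge0// ltW.
pose Cb := C^-1 * (1 + (k0 * a) ^+ 2) `^ (w / 2).
have Cb0 : 0 < Cb.
  rewrite mulr_gt0 ?invr_gt0// powR_gt0//.
  by have := sqr_ge0 (k0 * a); lra.
have si0 : 0 < s^-1 by rewrite invr_gt0.
have cU0 : 0 <= range_const phi a.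
  by rewrite /range_const !mulr_ge0 ?invr_ge0 ?mulr_ge0// ltW.
have cB0 : 0 <= bessel_const phi a J.
  rewrite /bessel_const mulr_ge0 ?sqr_ge0// mulr_ge0//.
    by rewrite mulr_ge0// mulr_ge0// ltW.
  by rewrite mulr_ge0 ?sqr_ge0// mulr_ge0// ltW.
have cs0 : 0 <= variance_const phi a K / k0.
  rewrite /variance_const divr_ge0 ?(ltW k00)// mulr_ge0 ?sqr_ge0// mulr_ge0//.
  by rewrite mulr_ge0 ?sqr_ge0// mulr_ge0// ltW.
have [c3 c30 rate] := maximal_rate cU0 cB0 cs0 si0.
have l30 := lnln3_gt0 R; set l3 := ln (ln 3) in l30.
pose c4 := (2 * pi)^-1 * (2 * (F1 * Phi) + 1).
have c40 : 0 <= c4.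
  by rewrite mulr_ge0 ?invr_ge0 ?addr_ge0 ?mulr_ge0// ltW.
pose c5 := A + c2 * (k0 * a' * pi).
have c50 : 0 <= c5 by rewrite addr_ge0// !mulr_ge0// ltW.
exists (2 * k0 * Phi * c3 * Cb + 2 * c4 * c5 / Num.sqrt l3).
move=> law lawC n n3 j jE f [cf f0 f1 fsm] d0 T0 P0 X eps Xf epslaw indep d T P Y iidY.
set D := ln n%:R in jE *; set De := D `^ s^-1.
have D1 : 1 < D by exact: lt_le_trans (ln3_gt1 R) (ln_ge_ln3 R n3).
have D0 : 0 < D by exact: lt_trans D1.
have De1 : 1 <= De.
  have := @ge0_ler_powR _ s^-1 (ltW si0) 1 D; rewrite powR1 !nnegrE; apply=> //; exact: ltW.
have De0 : 0 < De by exact: lt_le_trans De1.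
rewrite (resolutionE a' s Hc0 (ltW D0)) -/k0 -/De in jE.
set N := k0 * De in jE; have N0 : 0 < N by rewrite mulr_gt0.
have n0 : (0 < n)%N by exact: leq_trans n3.
have nR0 : 0 < n%:R :> R by rewrite ltr0n.
have mf : measurable_fun setT f by exact: continuous_measurable_fun.
have [fi _] : rint (@lebesgue_measure R) f /\ (\int[@lebesgue_measure R]_x f x)%R <= 1.
  by apply: ge0_rint => //; rewrite f1.
have f1R : (\int[@lebesgue_measure R]_x f x)%R = 1.
  by apply: EFin_inj; rewrite -rint_fin// f1.
have mFf := cmeas_normc (cmeas_fourier fi).
have Ff0 t : 0 <= normc (fourier f t) by exact: normc_ge0.
have [Ffi FfK] := exp_weight_rint mFf Ff0 fsm decay.
have TE : 2 * c0 * (N * a') `^ s = D by exact: weight_at_cutoff.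
have T_gt0 : 0 < N * a' by rewrite mulr_gt0.
have T0T : k0 * a' <= N * a' by rewrite ler_pM2r// /N ler_peMr// ltW.
pose th := Num.sqrt (De / n%:R).
have th0 : 0 < th by rewrite sqrtr_gt0 divr_gt0.
have tailB := exp_weight_tail mFf Ff0 fsm T_gt0 th0 Ffi
  (fun t => tail (N * a') t T0T) (ltW c20').
rewrite TE expRN lnK ?posrE// in tailB.
pose Bm := Cb * De `^ w; have Bm0 : 0 < Bm by rewrite mulr_gt0 ?powR_gt0.
have law0 t : fourier_law law t != 0.
  apply/eqP => h; have := lawC t; rewrite h normc0 leNgt => /negP; apply.
  by rewrite mulr_gt0// powR_gt0//; have := sqr_ge0 `|t|; lra.
have lawB t : `|t| <= N * a -> (normc (fourier_law law t))^-1 <= Bm.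
  by move=> tN; exact: law_inverse_le HC Hw De1 (ltW k00) a0 tN (lawC t).
have charY := characteristic_function_sum f0 fi f1R Xf epslaw indep.
have mY0 : measurable_fun setT ((fun w => X w + eps w) : T0 -> measurableTypeR R).
  have mX : measurable_fun setT X by exact: measurable_funP.
  have me : measurable_fun setT eps by exact: measurable_funP.
  exact: measurable_funD mX me.
have [la [la0 laU laB]] := rate n Bm n3 Bm0.
apply: le_trans (estimator_risk_le iphi a'0 a'a Sphi phiPhi Phi0 rep N0 law0 lawB jE aJ
  fi cf Ffi mY0 charY n0 iidY FfK la0 laU) _.
rewrite lee_fin -/F1 -/c4 -/D.
rewrite -/D -/De in laB.
have sE : variance_const phi a K / k0 * Bm ^+ 2 / De = variance_const phi a K * Bm ^+ 2 / N.
  by rewrite /N; field; rewrite !gt_eqF.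
rewrite sE in laB.
have rE : D `^ ((w + 1 / 2) / s) = De `^ w * Num.sqrt De.
  rewrite -powR12_sqrt ?(ltW De0)// -powRD; last by apply/implyP => _; rewrite gt_eqF.
  by rewrite /De -powRrM; congr (_ `^ _); rewrite mulrC mul1r.
set l := ln D in laB *.
have l3l : l3 <= l by exact: lnln_ge.
have sD0 : 0 < Num.sqrt De by rewrite sqrtr_gt0.
have DeE : De = Num.sqrt De ^+ 2 by rewrite sqr_sqrtr// ltW.
rewrite rE [X in _ <= X]mulrDl; apply: lerD.
  apply: (@le_trans _ _ (N * Phi * (2 * (c3 * (Bm * Num.sqrt (l / n%:R) / Num.sqrt De))))).
    apply: ler_wpM2l; first by rewrite mulr_ge0 ?(ltW N0) ?(ltW Phi0).
    by apply: ler_wpM2l => //; exact: laB.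
  rewrite le_eqVlt; apply/orP; left; apply/eqP.
  rewrite /N /Bm [X in k0 * X]DeE; move: (De `^ w) => q.
  by move: (Num.sqrt _) sD0 => v v0; field; rewrite gt_eqF.
have thE : th^-1 * (c2 * n%:R^-1 * (N * a' * pi)) = th * (c2 * (k0 * a' * pi)).
  by rewrite -balanced_tail//; congr (_ * (_ * _)); rewrite /N; ring.
rewrite -/A thE -mulrDr -/c5 in tailB.
have q1 : 1 <= De `^ w by rewrite -(powRr0 De); apply: ler_powR.
have thle := sqrt_rate_le De0 nR0 l30 l3l q1; rewrite -/th in thle.
apply: (@le_trans _ _ (2 * (c4 * (th * c5)))); first by apply: ler_wpM2l => //; apply: ler_wpM2l.
have -> : 2 * (c4 * (th * c5)) = 2 * c4 * c5 * th by ring.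
have -> : 2 * c4 * c5 / Num.sqrt l3 * (Num.sqrt (l / n%:R) * (De `^ w * Num.sqrt De)) =
  2 * c4 * c5 * (Num.sqrt (l / n%:R) * (De `^ w * Num.sqrt De) / Num.sqrt l3) by ring.
by rewrite ler_wpM2l// mulr_ge0// mulr_ge0.
Qed.
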